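(* Let $k$ be a field and let $P$ be a tree-type poset having at least two elements. Then $$\operatorname{int\text{-}res\text{-}gl.dim}P=\#\operatorname{leaf}(P)-2,$$ where $\operatorname{leaf}(P)$ is the set of leaves of $P$. In particular, $\operatorname{int\text{-}res\text{-}gl.dim}P$ is determined by the underlying graph of the Hasse diagram of $P$.
   Context: The Hasse diagram of a finite poset $P$ is the directed graph with vertex set $P$ and an arrow $x\to y$ iff $y$ covers $x$ ($x<y$ with nothing strictly between). A finite poset is a tree-type poset if the underlying graph of its Hasse diagram is a tree (a connected simple graph without cycles). A leaf of $P$ is an element incident to exactly one arrow of the Hasse diagram. Let $\operatorname{rep}P$ be the category of functors from $P$ (as a category with a unique morphism $a\to b$ iff $a\le b$) to finite-dimensional $k$-vector spaces. A subset $S\subseteq P$ is an interval if it is convex ($x\le z\le y$, $x,y\in S$ imply $z\in S$) and connected (any two elements of $S$ are joined by a finite sequence in $S$ with consecutive elements comparable). The interval module $\mathbb I_S$ has value $k$ on $S$, $0$ elsewhere, and identity maps between the copies of $k$. Let $\mathscr I_P$ be the full subcategory of $\operatorname{rep}P$ of finite direct sums of interval modules (up to isomorphism). An interval cover of $M\in\operatorname{rep}P$ is a morphism $\varphi\colon V\to M$ with $V\in\mathscr I_P$ such that $\operatorname{Hom}(U,V)\to\operatorname{Hom}(U,M)$ is surjective for all $U\in\mathscr I_P$ and every endomorphism $\kappa$ of $V$ with $\varphi=\varphi\kappa$ is an automorphism. An interval resolution of $M\neq0$ is an exact sequence $\cdots\to V_1\xrightarrow{\varphi_1}V_0\xrightarrow{\varphi_0}M\to0$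 with $V_i\in\mathscr I_P$, $\varphi_0$ an interval cover of $M$, and $V_i\to\ker\varphi_{i-1}$ an interval cover for each $i>0$; over a finite poset every module has one, unique up to isomorphism. Put $\operatorname{int\text{-}res\text{-}dim}M=\sup\{m\ge 0:V_m\ne0\}$ (and $0$ for $M=0$), and $\operatorname{int\text{-}res\text{-}gl.dim}P=\sup_{M\in\operatorname{rep}P}\operatorname{int\text{-}res\text{-}dim}M$. *)

(* Defs.v *)
From HB Require Import structures.
From mathcomp Require Import all_boot all_order all_algebra.
From mathcomp Require Import classical_sets constructive_ereal.

Set Implicit Arguments.
Unset Strict Implicit.
Unset Printing Implicit Defensive.

Import Order.TTheory GRing.Theory Num.Theory.
Local Open Scope order_scope.

Section Hasse.
Context {d : Order.disp_t} (P : finPOrderType d).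

Definition covers (y x : P) : bool :=
  (x < y) && [forall z, ~~ ((x < z) && (z < y))].

(* The pair (x, y) is the arrow x -> y. *)
Definition hasse_arrows : {set P * P} := [set a | covers a.2 a.1].

Definition hasse_adj : rel P :=
  [rel x y | ((x, y) \in hasse_arrows) || ((y, x) \in hasse_arrows)].

Definition leaf : {set P} :=
  [set x | #|[set a in hasse_arrows | (a.1 == x) || (a.2 == x)]| == 1%N].

End Hasse.

Arguments hasse_adj {d} P.

(* The nonemptiness of a tree is left to the hypotheses of the statement. *)
Definition is_tree (T : finType) (e : rel T) : Prop :=
  [/\ symmetric e, irreflexive e,
      forall x y, connect e x y
    & forall c : seq T, (2 < size c)%N -> ~ ucycle e c].

Definition tree_type {d} (P : finPOrderType d) : Prop := is_tree (hasse_adj P).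

Definition graph_iso (T U : finType) (e : rel T) (f : rel U) : Prop :=
  exists2 h : T -> U, bijective h & forall x y, f (h x) (h y) = e x y.

Section Interval.
Context {d : Order.disp_t} (P : finPOrderType d).

Definition convex_set (S : {set P}) : bool :=
  [forall x in S, forall y in S, forall z, (x <= z <= y) ==> (z \in S)].

Definition connected_set (S : {set P}) : bool :=
  [forall x in S, forall y in S,
     connect [rel a b | [&& a \in S, b \in S & a >=< b]] x y].

(* The empty set is allowed; its interval module is zero, which is an empty
   direct sum anyway. *)
Definition interval : predArgType :=
  {S : {set P} | convex_set S && connected_set S}.

End Interval.

Section Rep.
Context (k : fieldType) {d : Order.disp_t} (P : finPOrderType d).
Local Open Scope lfun_scope.

Record rep := Rep {
  rep_obj :> P -> vectType k;
  rep_map : forall x y, x <= y -> 'Hom(rep_obj x, rep_obj y);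
  rep_map_id : forall x (xx : x <= x), rep_map xx = \1;
  rep_map_comp : forall x y z (xy : x <= y) (yz : y <= z) (xz : x <= z),
    rep_map xz = rep_map yz \o rep_map xy
}.

Record hom (M N : rep) := Hom {
  hom_map :> forall x, 'Hom(M x, N x);
  hom_nat : forall x y (xy : x <= y),
    rep_map N xy \o hom_map x = hom_map y \o rep_map M xy
}.

Definition is_iso (M N : rep) (f : hom M N) : Prop :=
  exists g : hom N M, forall x, g x \o f x = \1 /\ f x \o g x = \1.

Definition isomorphic (M N : rep) : Prop := exists f : hom M N, is_iso f.

Definition is_zero (M : rep) : bool := [forall x, \dim {:M x} == 0%N].

(* 'rV[k]_(x \in S) is k = 'rV[k]_1 when x \in S and 0 = 'rV[k]_0 otherwise;
   pid_mx 1 is the identity 1 x 1 matrix when both x, y \in S. *)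
Definition intmod_obj (S : {set P}) (x : P) : vectType k := 'rV[k]_(x \in S).

Definition intmod_map (S : {set P}) (x y : P) :
    'Hom(intmod_obj S x, intmod_obj S y) :=
  linfun (mulmxr (pid_mx 1 : 'M[k]_(x \in S, y \in S))).

Lemma intmod_map_id (S : {set P}) (x : P) : intmod_map S x x = \1.
Proof.
apply/lfunP=> v; rewrite id_lfunE lfunE /=.
suff -> : (pid_mx 1 : 'M[k]_(x \in S)) = 1%:M%R by rewrite mulmx1.
by case: (x \in S); [rewrite pid_mx_1 | apply/matrixP => -[]].
Qed.

Lemma intmod_map_comp (S : interval P) (x y z : P) :
  x <= y -> y <= z ->
  intmod_map (val S) x z = intmod_map (val S) y z \o intmod_map (val S) x y.
Proof.
move=> xy yz; apply/lfunP=> v; rewrite comp_lfunE !lfunE /= -mulmxA.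
congr (mulmx _ _); rewrite mul_pid_mx.
case: S v => S /= /andP[/forall_inP cS _] _.
have [xS|] := boolP (x \in S); last first.
  by move=> _; apply/matrixP => -[].
have [zS|] := boolP (z \in S); last first.
  by move=> _; apply/matrixP => i [].
suff -> : y \in S by [].
have /forall_inP/(_ z zS)/forallP/(_ y)/implyP := cS x xS.
by apply; rewrite xy.
Qed.

Definition interval_module (S : interval P) : rep :=
  @Rep (intmod_obj (val S)) (fun x y _ => intmod_map (val S) x y)
    (fun x _ => intmod_map_id (val S) x)
    (fun x y z xy yz _ => intmod_map_comp S xy yz).

Definition rep0 : rep :=
  @Rep (fun=> 'rV[k]_0) (fun _ _ _ => \1) (fun _ _ => erefl)
    (fun _ _ _ _ _ _ => esym (comp_lfun1l _)).

Section DirectSum.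
Variables M N : rep.

Definition dsum_fun x y (xy : x <= y) (v : M x * N x) : M y * N y :=
  (rep_map M xy v.1, rep_map N xy v.2).

Lemma dsum_fun_linear x y (xy : x <= y) : linear (dsum_fun xy).
Proof. by move=> a u v; rewrite /dsum_fun !linearP. Qed.

HB.instance Definition _ x y (xy : x <= y) :=
  GRing.isLinear.Build k (M x * N x)%type (M y * N y)%type _
    (dsum_fun xy) (dsum_fun_linear xy).

Lemma dsum_map_id x (xx : x <= x) : linfun (dsum_fun xx) = \1.
Proof.
apply/lfunP => -[u v].
by rewrite lfunE /= /dsum_fun /= !rep_map_id !id_lfunE.
Qed.

Lemma dsum_map_comp x y z (xy : x <= y) (yz : y <= z) (xz : x <= z) :
  linfun (dsum_fun xz) = linfun (dsum_fun yz) \o linfun (dsum_fun xy).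
Proof.
apply/lfunP => -[u v]; rewrite comp_lfunE !lfunE /= /dsum_fun /=.
by rewrite !(rep_map_comp _ xy yz xz) !comp_lfunE.
Qed.

Definition dsum : rep :=
  @Rep (fun x => (M x * N x)%type) (fun x y xy => linfun (dsum_fun xy))
    dsum_map_id dsum_map_comp.

End DirectSum.

Definition interval_decomposable (M : rep) : Prop :=
  exists s : seq (interval P),
    isomorphic M (foldr dsum rep0 (map interval_module s)).

Section Kernel.
Variables (M N : rep) (f : hom M N).

Definition ker_map x y (xy : x <= y) :
    'Hom(subvs_of (lker (f x)), subvs_of (lker (f y))) :=
  linfun (vsproj (lker (f y))) \o rep_map M xy \o linfun vsval.

Lemma ker_mapE x y (xy : x <= y) (v : subvs_of (lker (f x))) :
  vsval (ker_map xy v) = rep_map M xy (vsval v).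
Proof.
rewrite !comp_lfunE !lfunE /= vsprojK // memv_ker.
have /lfunP/(_ (vsval v)) := hom_nat f xy; rewrite !comp_lfunE => <-.
by have := subvsP v; rewrite memv_ker => /eqP->; rewrite linear0.
Qed.

Lemma ker_map_id x (xx : x <= x) : ker_map xx = \1.
Proof.
by apply/lfunP => v; apply: subvs_inj; rewrite ker_mapE rep_map_id !id_lfunE.
Qed.

Lemma ker_map_comp x y z (xy : x <= y) (yz : y <= z) (xz : x <= z) :
  ker_map xz = ker_map yz \o ker_map xy.
Proof.
apply/lfunP => v; apply: subvs_inj.
by rewrite comp_lfunE !ker_mapE (rep_map_comp _ xy yz) comp_lfunE.
Qed.

Definition ker : rep :=
  @Rep (fun x => subvs_of (lker (f x))) ker_map ker_map_id ker_map_comp.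

Lemma ker_incl_nat x y (xy : x <= y) :
  rep_map M xy \o linfun vsval = linfun vsval \o rep_map ker xy.
Proof.
apply/lfunP => v; rewrite comp_lfunE [RHS]comp_lfunE lfunE [RHS]lfunE.
exact/esym/ker_mapE.
Qed.

Definition ker_incl : hom ker M := @Hom ker M (fun x => linfun vsval) ker_incl_nat.

End Kernel.

Definition interval_cover (V M : rep) (phi : hom V M) : Prop :=
  [/\ interval_decomposable V,
      forall U : rep, interval_decomposable U -> forall g : hom U M,
        exists h : hom U V, forall x, g x = phi x \o h x
    & forall kappa : hom V V,
        (forall x, phi x = phi x \o kappa x) -> is_iso kappa].

(* g : V -> W takes values in ker f, and V -> ker f is an interval cover. *)
Definition covers_ker (V W N : rep) (g : hom V W) (f : hom W N) : Prop :=
  exists2 psi : hom V (ker f),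
    interval_cover psi & forall x, g x = ker_incl f x \o psi x.

Record interval_resolution (M : rep) := IntervalResolution {
  res_obj :> nat -> rep;
  res_aug : hom (res_obj 0) M;
  res_diff : forall i, hom (res_obj i.+1) (res_obj i);
  res_exact_aug : forall x, limg (res_aug x) = fullv;
  res_exact0 : forall x, limg (res_diff 0 x) = lker (res_aug x);
  res_exactS : forall i x, limg (res_diff i.+1 x) = lker (res_diff i x);
  res_cover_aug : interval_cover res_aug;
  res_cover0 : covers_ker (res_diff 0) res_aug;
  res_coverS : forall i, covers_ker (res_diff i.+1) (res_diff i)
}.

(* Dimensions live in \bar int, read as an extension of N u {+oo}.  Interval
   resolutions are unique up to isomorphism, so the supremum over all of them is
   the supremum for any one of them. *)
Definition int_res_dim (M : rep) : \bar int :=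
  if is_zero M then 0%E else
  supremum 0%E
    [set n | exists (V : interval_resolution M) (m : nat),
               ~~ is_zero (V m) /\ n = (m%:Z)%:E]%classic.

Definition int_res_gldim : \bar int :=
  supremum 0%E [set n | exists M : rep, n = int_res_dim M]%classic.

End Rep.

(* Main.v *)
Require Import Defs.
From HB Require Import structures.
From mathcomp Require Import all_boot all_order all_algebra.
From mathcomp Require Import constructive_ereal.
From mathcomp Require boolp classical_sets.
(* [interval] again denotes the intervals of a poset. *)
Import Defs.
Set Implicit Arguments.
Unset Strict Implicit.
Unset Printing Implicit Defensive.
Import Order.TTheory GRing.Theory Num.Theory.

(** Write L for the number of leaves of P.  In a tree-type poset the intervals
    are the subtrees of the Hasse diagram, two of them meet in a subtree, and
    Hom(I_S, I_T) has dimension at most one: it is nonzero exactly when S and T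
    meet and their intersection is a down-set of S and an up-set of T
    ([linked]).  A morphism I_S -> N is a family of vectors of N indexed by S
    ([is_section]); composing it with a canonical map I_R -> I_S restricts the
    family to R.  So every computation below takes place pointwise, with vectors
    or with scalars.

    Upper bound.  An interval J can be modified in two ways: it can grow through
    an edge y -> x, with x in J and y outside, by everything above y beyond that
    edge; it can be cut at an edge x -> y when, beyond that edge, J consists of
    all the elements below y, which are then removed.  Apart from two explicit
    families of J, different modifications act on disjoint branches of the tree,
    and each branch contains a leaf, so there are at most L of them ([card_op]).
    Performing them in all combinations gives a cube of intervals, hence a
    complex I_J -> (sum of the I_(J_a)) -> (sum of the I_(J_ab)) -> ...  For an
    interval X other than J some modification is invisible to Hom(-, X)
    ([neutral_exists]), which contracts the complex Hom(I_(J_s), X)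
    ([cube_diff_exact]): on sums of interval modules, the complex of the
    Hom(I_(J_s), -) resolves the simple functor at J ([exact_decomposable]).  On an
    arbitrary module it is exact in degrees at least L - 1, because the right end
    of the cube is right exact ([exact_top]).  Shifting dimensions along an interval resolution
    ([exact_shift]), it is exact in degree 1 for the syzygy with index L - 2.
    Let K be the next syzygy, the kernel of the cover V of that one.  As covers
    are minimal, a morphism I_J -> K is radical in V, so it comes from the first
    stage of the cube, and it does so inside K; this replaces J by larger
    intervals for the order given by nonzero maps through a fixed point.  That
    order is finite, so K has no nonzero section at all, and the resolution
    stops ([syzygy_zero]).  The two exceptional families, the principal down-sets
    and their halves on one side of an edge, are treated by hand inside
    [syzygy_sections_zero].

    Lower bound, for L > 2.  Deleting from P, for a set r of leaves, the minimal
    leaves that lie in r and the maximal leaves that do not, gives a cube of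
    dimension L, with sums C_n over the r with n elements and a complex
    C_L -> ... -> C_1 -> C_0.  The same contraction makes it Hom(I_X, -)-exact in
    positive degrees, and Hom(C_n, C_(n+1)) = 0, so each map is an interval cover
    of its image.  Thus C_L -> ... -> C_2 is the interval resolution of the kernel
    of C_1 -> C_0, of length L - 2 ([trim_resolution]). *)

(** * Cubes and their differential *)

Section Cube.
Variables (k : fieldType) (O : finType).
Local Open Scope ring_scope.

Definition cube_sign (b : O) (s : {set O}) : k :=
  (-1) ^+ #|[set c in s | enum_rank c < enum_rank b]|%N.

Lemma cube_sign_sqr b s : cube_sign b s * cube_sign b s = 1.
Proof. by rewrite /cube_sign -expr2 sqrr_sign. Qed.

Lemma cube_signU a b (s : {set O}) : a \notin s ->
  cube_sign b (a |: s) =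
  (if (enum_rank a < enum_rank b)%N then -1 else 1) * cube_sign b s.
Proof.
move=> as0; rewrite /cube_sign.
case: ifP => ab.
  have -> : [set c in a |: s | (enum_rank c < enum_rank b)%N] =
      a |: [set c in s | (enum_rank c < enum_rank b)%N].
    by apply/setP=> c; rewrite !inE; case: eqP => [->|]; rewrite ?ab.
  by rewrite cardsU1 !inE (negbTE as0) /= add1n exprS.
rewrite mul1r; congr (_ ^+ #|pred_of_set _|); apply/setP=> c; rewrite !inE.
by case: eqP => [->|]; rewrite ?ab ?andbF.
Qed.

(** Together with [cube_sign_sqr], all that the differential needs from the signs. *)
Lemma cube_signC a b (s : {set O}) : a != b -> a \notin s -> b \notin s ->
  cube_sign a s * cube_sign b (a |: s) = - (cube_sign b s * cube_sign a (b |: s)).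
Proof.
move=> ab as0 bs; rewrite !cube_signU //.
have : enum_rank a != enum_rank b :> nat.
  by apply: contra ab => /eqP/ord_inj/enum_rank_inj ->.
rewrite neq_ltn => /orP[] h; rewrite h ltnNge (ltnW h) /=.
  by rewrite mul1r mulN1r mulrN mulrC.
by rewrite mul1r mulN1r !mulrN opprK mulrC.
Qed.

Variable W : lmodType k.

(** The differential lowers the degree [#|s|].  [H] marks the vertices of the cube
    that are present at the point, or the interval, under consideration. *)
Definition cube_diff (H : pred {set O}) (c : {set O} -> W) (s : {set O}) : W :=
  if H s then \sum_(b | b \notin s) cube_sign b s *: c (b |: s) else 0.

(** The terms cancel in pairs, so characteristic 2 is no exception. *)
Lemma sum_antisym (F : O -> O -> W) (p : pred (O * O)) :
  (forall b c, p (b, c) = p (c, b)) -> (forall b, ~~ p (b, b)) ->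
  (forall b c, p (b, c) -> F b c = - F c b) ->
  \sum_b \sum_(c | p (b, c)) F b c = 0.
Proof.
move=> psym pirr anti.
rewrite pair_big_dep /=.
rewrite (bigID (fun x : O * O => (enum_rank x.1 < enum_rank x.2)%N)) /=.
rewrite [X in _ + X](reindex_inj (h := fun x : O * O => (x.2, x.1))) /=; last first.
  by case=> [a b] [c e] /= [-> ->].
apply/eqP; rewrite addr_eq0 -sumrN; apply/eqP; apply: eq_big => [[b c]|[b c]] /=.
  rewrite (psym c b); case pbc: (p (b, c)) => //=.
  rewrite -leqNgt ltn_neqAle; case: eqP => //= e.
  have {}e : b = c by apply: enum_rank_inj; apply: ord_inj.
  by move: (pirr b); rewrite {2}e pbc.
by move=> /andP[pbc _]; rewrite -anti // pbc.
Qed.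

Lemma cube_diff_sqr (H : pred {set O}) (c : {set O} -> W) (s : {set O}) :
  (forall s, ~~ H s -> c s = 0) ->
  (forall a b, a \notin s -> b \notin s -> H s -> H (b |: (a |: s)) -> H (a |: s)) ->
  cube_diff H (cube_diff H c) s = 0.
Proof.
move=> supp conv; rewrite /cube_diff; case: ifP => // Hs.
pose F b e := (cube_sign b s * cube_sign e (b |: s)) *: c (e |: (b |: s)).
rewrite (eq_bigr (fun b => \sum_(e | e \notin b |: s) F b e)); last first.
  move=> b bs; case: ifPn => Hbs.
    by rewrite scaler_sumr; apply: eq_bigr => e _; rewrite scalerA.
  rewrite scaler0 big1 // => e; rewrite !inE negb_or => /andP[_ es].
  rewrite /F supp ?scaler0 //; apply: contra Hbs.
  exact: conv.
rewrite big_mkcond /=.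
rewrite (eq_bigr (fun b => \sum_(e | [&& b \notin s, e \notin s & b != e]) F b e)).
  apply: (@sum_antisym F (fun x => [&& x.1 \notin s, x.2 \notin s & x.1 != x.2])) => /=.
  - by move=> b e; rewrite eq_sym andbCA.
  - by move=> b; rewrite eqxx !andbF.
  - move=> b e /and3P[bs es be]; rewrite /F cube_signC // scaleNr.
    by congr (- (_ *: c _)); rewrite setUCA.
move=> b _; case: ifPn => bs; last by rewrite big_pred0.
by apply: eq_bigl => e; rewrite !inE negb_or eq_sym andbC.
Qed.

(** If the direction [a] does not change [H], the cube is the cone of an identity;
    inserting [a] is a contracting homotopy. *)
Lemma cube_diff_exact (H : pred {set O}) (a : O) (c : {set O} -> W) (n : nat) :
  (forall s : {set O}, a \notin s -> H s = H (a |: s)) ->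
  (forall s, ~~ H s -> c s = 0) -> (forall s : {set O}, #|s| != n -> c s = 0) ->
  (forall s, cube_diff H c s = 0) ->
  exists w : {set O} -> W, [/\ forall s, ~~ H s -> w s = 0,
    forall s : {set O}, #|s| != n.+1 -> w s = 0 & forall s, cube_diff H w s = c s].
Proof.
move=> Ha supp cn c0.
pose w (s : {set O}) := if a \in s then cube_sign a (s :\ a) *: c (s :\ a) else 0.
have HD (s : {set O}) : a \in s -> H s = H (s :\ a).
  by move=> as0; rewrite [RHS]Ha ?setD1K // setD11.
exists w; split => [s Hs|s sn|s].
- rewrite /w; case: ifP => // as0.
  by rewrite supp ?scaler0 // -HD.
- rewrite /w; case: ifP => // as0; rewrite cn ?scaler0 //.
  by apply: contra sn => /eqP <-; rewrite (cardsD1 a s) as0.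
rewrite {1}/cube_diff; case: ifPn => Hs; last by rewrite supp.
case as0: (a \in s); last first.
  rewrite (bigD1 a) ?as0 //= big1 ?addr0; last first.
    move=> b /andP[bs ba]; rewrite /w !inE as0 orbF (eq_sym a) (negbTE ba).
    by rewrite scaler0.
  by rewrite /w setU11 setU1K ?as0 // scalerA cube_sign_sqr scale1r.
have := c0 (s :\ a); rewrite /cube_diff -HD // Hs (bigD1 a) ?setD11 //= setD1K //.
have aD : a \notin s :\ a by rewrite setD11.
have predE b : (b \notin s :\ a) && (b != a) = (b \notin s).
  by rewrite !inE; case: eqP => [->|]; rewrite ?as0 //= andbT.
rewrite (eq_bigl _ _ predE) => /eqP; rewrite addr_eq0 => /eqP cs.
transitivity (cube_sign a (s :\ a) *: - \sum_(b | b \notin s)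
                 cube_sign b (s :\ a) *: c (b |: s :\ a)); last first.
  by rewrite -cs scalerA cube_sign_sqr scale1r.
rewrite -sumrN scaler_sumr; apply: eq_bigr => b bs.
have ba : b != a by apply: contraNneq bs => ->.
have bD : b \notin s :\ a by rewrite !inE (negbTE bs) andbF.
have -> : w (b |: s) = cube_sign a (b |: s :\ a) *: c (b |: s :\ a).
  rewrite /w !inE as0 orbT.
  suff -> : (b |: s) :\ a = b |: s :\ a by [].
  by apply/setP=> x; rewrite !inE; case: (x =P b) => [->|]; rewrite ?ba.
rewrite scalerN !scalerA -scaleNr; congr (_ *: _).
have := cube_signC ba bD aD; rewrite setD1K // => qt.
have -> : cube_sign a (b |: s :\ a) =
    - (cube_sign b (s :\ a) * (cube_sign a (s :\ a) * cube_sign b s)).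
  by rewrite -mulrN -qt mulrA cube_sign_sqr mul1r.
rewrite mulrN; congr (- _).
by rewrite mulrCA [X in _ * X]mulrCA cube_sign_sqr mulr1 mulrC.
Qed.
End Cube.

(** * Subtrees and branches of a finite tree *)
Lemma connect_inv (T : finType) (r : rel T) (A : {pred T}) x y :
  (forall a b, r a b -> a \in A -> b \in A) ->
  connect r x y -> x \in A -> y \in A.
Proof.
move=> rA /connectP[p]; elim: p x => [|z p IH] x /=; first by move=> _ ->.
by case/andP=> xz pz lE xA; apply: (IH z) => //; apply: rA xz xA.
Qed.

Lemma connect_impl (T : finType) (r r' : rel T) x y :
  (forall a b, r a b -> r' a b) -> connect r x y -> connect r' x y.
Proof. by move=> h; apply: connect_sub => a b /h; apply: connect1. Qed.

Section Trees.
Variables (T : finType) (e : rel T).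

Definition on (S : {set T}) : rel T := [rel a b | [&& a \in S, b \in S & e a b]].

Definition subtree (S : {set T}) : bool :=
  [forall x in S, forall y in S, connect (on S) x y].

Lemma subtreeP (S : {set T}) :
  reflect (forall x y, x \in S -> y \in S -> connect (on S) x y) (subtree S).
Proof.
apply: (iffP forall_inP) => [h x y xS yS|h x xS].
  by have /forall_inP := h x xS; apply.
by apply/forall_inP => y yS; apply: h.
Qed.

(** What is reached from [y] without passing through [x]; for an edge xy, this is
    the side of [y] once the edge is deleted. *)
Definition branch (x y : T) : {set T} :=
  [set z | connect [rel a b | [&& a != x, b != x & e a b]] y z].

Hypothesis treeT : is_tree e.

Let e_sym : symmetric e. Proof. by case: treeT. Qed.
Let e_irr : irreflexive e. Proof. by case: treeT. Qed.
Let e_conn x y : connect e x y. Proof. by case: treeT. Qed.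

Lemma edge_neq x y : e x y -> x != y.
Proof. by apply: contraTneq => ->; rewrite e_irr. Qed.

Lemma on_sym (S : {set T}) : connect_sym (on S).
Proof.
apply: sym_connect_sym => a b; rewrite /on /=.
by rewrite e_sym andbCA.
Qed.

Lemma subtree_from (S : {set T}) x :
  (forall y, y \in S -> connect (on S) x y) -> subtree S.
Proof.
move=> h; apply/subtreeP => y z yS zS.
by apply: connect_trans (h z zS); rewrite on_sym h.
Qed.

Lemma path_avoid x y p :
  path [rel a b | [&& a != x, b != x & e a b]] y p -> y != x -> x \notin y :: p.
Proof.
elim: p y => [|z p IH] y /=; first by rewrite inE eq_sym.
by case/andP=> /and3P[yx zx _] pp _; rewrite inE negb_or eq_sym yx IH.
Qed.

Lemma branch_far x y : y \in branch x y. Proof. by rewrite inE. Qed.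

Lemma branch_near x y : e x y -> x \notin branch x y.
Proof.
move=> xy; rewrite inE; apply/negP => yx.
have : x \in [pred z | z != x].
  apply: connect_inv yx _ => [a b /and3P[]//|]; rewrite inE eq_sym.
  exact: edge_neq.
by rewrite inE eqxx.
Qed.

(** Another exit from the branch would close a cycle through [x].  All later uses
    of acyclicity go through this lemma. *)
Lemma branch_cross x y u w : e x y -> e u w ->
  u \in branch x y -> w \notin branch x y -> u = y /\ w = x.
Proof.
move=> xy uw uB wB.
have ux : u != x by apply: contraTneq uB => ->; apply: branch_near.
have wx : w = x.
  apply/eqP; apply: contraNT wB => wx; move: uB; rewrite !inE => uB.
  by apply: connect_trans uB _; apply: connect1; rewrite /= ux wx.
split=> //; apply/eqP; apply/negPn/negP => uy; subst w.
move: uB; rewrite inE => /connectP[p0 /shortenP[p pp up _] {p0} uE].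
have [_ _ _ acyc] := treeT.
have xp : x \notin y :: p by apply: (path_avoid pp); rewrite eq_sym edge_neq.
apply: (acyc (x :: y :: p)).
  by case: p uE {pp up xp} => //= ue; rewrite ue eqxx in uy.
rewrite /ucycle cons_uniq xp up /= andbT xy /= rcons_path -uE uw andbT.
by apply: sub_path pp => a b /and3P[].
Qed.

Lemma branch_cover x y z : e x y -> (z \in branch x y) || (z \in branch y x).
Proof.
move=> xy; have yx : e y x by rewrite e_sym.
rewrite -in_setU; apply: (connect_inv _ (e_conn x z)); last first.
  by rewrite in_setU branch_far orbT.
move=> a b ab; rewrite !in_setU.
have [bB _|bB] := boolP (b \in branch x y) => //=; case/orP=> aB.
  by have [_ ->] := branch_cross xy ab aB bB; apply: branch_far.
apply/negPn/negP => bB'; have [_ bE] := branch_cross yx ab aB bB'.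
by rewrite bE branch_far in bB.
Qed.

Lemma subtree_branch x y : subtree (branch x y).
Proof.
apply: (@subtree_from _ y) => z; rewrite inE => /connectP[p].
move=> pp ->.
have : forall u, connect [rel a b | [&& a != x, b != x & e a b]] y u ->
   path [rel a b | [&& a != x, b != x & e a b]] u p ->
   connect (on (branch x y)) u (last u p).
  elim: p {pp} => [|w p IH] u yu /=; first by rewrite connect0.
  case/andP => uw pw.
  have yw : connect [rel a b | [&& a != x, b != x & e a b]] y w.
    by apply: connect_trans yu (connect1 _).
  apply: connect_trans (IH w yw pw); apply: connect1.
  by rewrite /on /= !inE yu yw; case/and3P: uw.
by apply.
Qed.

Lemma subtree_exit (S A : {set T}) p q : subtree S -> p \in S -> q \in S ->
  p \in A -> q \notin A ->
  exists u w, [/\ u \in S, w \in S, e u w, u \in A & w \notin A].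
Proof.
move=> /subtreeP cS pS qS pA qA.
have [[u w /and5P[]]|h] := pickP [pred a : T * T | [&& a.1 \in S, a.2 \in S, e a.1 a.2, a.1 \in A & a.2 \notin A]].
  by exists u, w.
case/negP: qA; apply: (connect_inv (r := on S) (x := p)) => //; last exact: cS.
move=> a b /and3P[aS bS ab] aA; apply/negPn/negP => bA.
by have := h (a, b); rewrite /= aS bS ab aA bA.
Qed.

(** A subtree reaching both sides of an edge contains that edge. *)
Lemma subtree_cross (S : {set T}) x y p q : e x y -> subtree S ->
  p \in S -> p \in branch x y -> q \in S -> q \notin branch x y ->
  (x \in S) && (y \in S).
Proof.
move=> xy cS pS pB qS qB.
have [u [w [uS wS uw uB wB]]] := subtree_exit cS pS qS pB qB.
by have [<- <-] := branch_cross xy uw uB wB; rewrite uS wS.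
Qed.

Lemma branch_disj x y z : e x y -> z \in branch x y -> z \notin branch y x.
Proof.
move=> xy zB; apply/negP => zB'; have yx : e y x by rewrite e_sym.
have := subtree_cross yx (subtree_branch x y) zB zB' (branch_far x y)
  (branch_near yx).
by rewrite (negbTE (branch_near xy)) andbF.
Qed.

Lemma branchC x y z : e x y -> (z \in branch y x) = (z \notin branch x y).
Proof.
move=> xy; apply/idP/idP; first by apply: branch_disj; rewrite e_sym.
by move=> zB; have := branch_cover z xy; rewrite (negbTE zB).
Qed.

Lemma path_in (p : seq T) x (S : {set T}) : path e x p -> uniq (x :: p) -> subtree S ->
  x \in S -> last x p \in S -> {subset x :: p <= S}.
Proof.
move=> pp up cS; elim: p x pp up => [|y p IH] x pp up xS lS z.
  by rewrite inE => /eqP->.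
rewrite inE => /predU1P[->//|]; apply: IH => //; first by case/andP: pp.
  by move: up; rewrite cons_uniq => /andP[].
move: pp up; rewrite /= => /andP[xy pp] /andP[xp up].
have lB : last y p \in branch x y.
  rewrite inE; apply/connectP; exists p => //.
  move: xp; have: y != x by rewrite eq_sym edge_neq.
  elim: p y pp {xy lS up} => //= w p IH y /andP[yw pw] yx.
  rewrite !inE !negb_or => /and3P[xy xw xp].
  rewrite yx yw (eq_sym w) xw /=; apply: IH => //; first by rewrite eq_sym.
  by rewrite inE negb_or xw.
by case/andP: (subtree_cross xy cS lS lB xS (branch_near xy)).
Qed.

(** Stating the geodesic through the subtrees containing its ends makes every
    intersection of subtrees a subtree. *)
Lemma tree_geodesic x y : exists p, [/\ path e x p, last x p = y &
  forall S : {set T}, subtree S -> x \in S -> y \in S -> {subset x :: p <= S}].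
Proof.
have /connectP[p0 /shortenP[p pp up _] ->] := e_conn x y.
by exists p; split => // S cS xS lS; apply: path_in.
Qed.

Lemma path_connect_on (S : {set T}) x p : path e x p -> {subset x :: p <= S} ->
  connect (on S) x (last x p).
Proof.
move=> pp sS; apply/connectP; exists p => //.
elim: p x pp sS => //= y p IH x /andP[xy pp] sS.
rewrite /on /= xy !sS ?inE ?eqxx ?orbT //= IH // => z zp.
by apply: sS; rewrite inE zp orbT.
Qed.

Lemma subtree_bigcap (I : Type) (F : I -> {set T}) (S : {set T}) :
  (forall i, subtree (F i)) -> (forall z, reflect (forall i, z \in F i) (z \in S)) ->
  subtree S.
Proof.
move=> cF SP; apply/subtreeP => x y xS yS.
have [p [pp lp sub]] := tree_geodesic x y; rewrite -lp.
apply: path_connect_on => // z zp; apply/SP => i.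
by apply: sub zp => //; [apply: (elimT (SP _) xS)|apply: (elimT (SP _) yS)].
Qed.

Lemma subtreeI (S S' : {set T}) : subtree S -> subtree S' -> subtree (S :&: S').
Proof.
move=> cS cS'; apply: (@subtree_bigcap bool (fun b => if b then S else S')).
  by case.
move=> z; rewrite inE; apply: (iffP andP) => [[a b] []//|h].
by split; [apply: (h true)|apply: (h false)].
Qed.

Lemma subtreeT : subtree setT.
Proof.
apply/subtreeP => x y _ _; apply: connect_impl (e_conn x y) => a b /=.
by rewrite /on /= !inE.
Qed.

Lemma subtree0 : subtree set0.
Proof. by apply/subtreeP => y z; rewrite inE. Qed.

Lemma branch_sub x y u v : e x y -> e u v -> u \in branch x y -> v \in branch x y ->
  x \notin branch u v -> branch u v \subset branch x y.
Proof.
move=> xy uv uB vB xB; apply/subsetP => z zB; apply/negPn/negP => zB'.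
have := subtree_cross xy (subtree_branch u v) (branch_far u v) vB zB zB'.
by rewrite (negbTE xB).
Qed.

Lemma branch_next_sub x y z : e x y -> e y z -> z != x -> branch y z \subset branch x y.
Proof.
move=> xy yz zx; apply: branch_sub => //; first exact: branch_far.
  apply/negPn/negP => zB; move: zx.
  by have [_ ->] := branch_cross xy yz (branch_far x y) zB; rewrite eqxx.
apply/negP => xB; have [xz _] := branch_cross yz xy xB (branch_near yz).
by rewrite xz eqxx in zx.
Qed.

Definition deg1 (x : T) : bool := #|[set y | e x y]| == 1%N.

(** Walk away from [x] until there is nowhere left to go. *)
Lemma branch_deg1 x y : e x y -> exists2 z, z \in branch x y & deg1 z.
Proof.
have [n] := ubnP #|branch x y|; elim: n x y => // n IH x y le xy.
have [z /andP[yz zx]|h] := pickP [pred z | e y z && (z != x)].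
  have sub := branch_next_sub xy yz zx.
  have [|w wB w1] := IH y z _ yz.
    rewrite ltnS in le; apply: leq_trans le; apply: proper_card.
    apply/properP; split=> //; exists y; rewrite ?branch_far //.
    exact: branch_near.
  by exists w => //; apply: (subsetP sub).
exists y; first exact: branch_far.
rewrite /deg1 (_ : [set z | e y z] = [set x]) ?cards1 //.
apply/setP=> z; rewrite !inE; have := h z; rewrite /=.
case: eqP => [->|_]; rewrite ?(e_sym y x) ?xy ?andbT // => ->.
Qed.

Lemma deg1_nbr x y z : deg1 x -> e x y -> e x z -> y = z.
Proof.
move=> /cards1P[w /setP wE] xy xz.
have := wE y; have := wE z; rewrite !inE xy xz.
by move=> /esym/eqP-> /esym/eqP->.
Qed.

Lemma branch_from_leaf l p : deg1 l -> e l p -> branch l p = setT :\ l.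
Proof.
move=> l1 lp; apply/setP=> z; rewrite in_setD1 in_setT andbT.
have pl : e p l by rewrite e_sym.
case: eqP => [->|/eqP zl] /=; first exact/negbTE/branch_near.
apply/negPn/negP; rewrite -branchC // => zB.
have zl' : z \notin [set l] by rewrite inE.
have [u [w [uB wB uw]]] := subtree_exit (subtree_branch p l) (branch_far p l) zB
  (set11 l) zl'.
rewrite !inE => /eqP ul wl; subst u.
by move: wB; rewrite (deg1_nbr l1 uw lp) (negbTE (branch_near pl)).
Qed.

End Trees.

(** * Intervals of a tree-type poset and the maps between them *)

Section Poset.
Context {d : Order.disp_t} (P : finPOrderType d).
Hypothesis treeP : tree_type P.
Local Open Scope order_scope.

Notation cov x y := (covers y x).
Notation adj := (hasse_adj P).

Lemma adjE (x y : P) : adj x y = cov x y || cov y x.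
Proof. by rewrite /hasse_adj /= !inE. Qed.

Lemma cov_adj (x y : P) : cov x y -> adj x y. Proof. by rewrite adjE => ->. Qed.
Lemma cov_adj' (x y : P) : cov x y -> adj y x. Proof. by rewrite adjE orbC => ->. Qed.

Lemma cov_lt (x y : P) : cov x y -> x < y. Proof. by case/andP. Qed.

Lemma cov_asym (x y : P) : cov x y -> cov y x = false.
Proof.
move=> /cov_lt xy; apply/negP => /cov_lt yx.
by have := lt_trans xy yx; rewrite ltxx.
Qed.

Lemma adj_sym : symmetric adj. Proof. by case: treeP. Qed.

Lemma le_path (x y : P) : x <= y -> exists2 p, path (fun a b => cov a b) x p & last x p = y.
Proof.
have [n] := ubnP #|[set z | x <= z < y]|; elim: n x y => // n IH x y le.
rewrite le_eqVlt => /predU1P[->|xy]; first by exists [::].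
(* An element of ]x, y] with fewest elements below it covers x. *)
have [z /andP[xz zy] zmin] :=
  @arg_minnP _ y (fun z => (x < z) && (z <= y)) (fun z => #|[set w | w < z]|)
    (introT andP (conj xy (lexx y))).
have xzc : cov x z.
  rewrite /covers xz; apply/forallP => w; apply/negP => /andP[xw wz].
  have := zmin w; rewrite xw (le_trans (ltW wz) zy) => /(_ isT).
  rewrite leqNgt => /negP; apply; apply: proper_card; apply/properP; split.
    by apply/subsetP => u; rewrite !inE => uw; apply: lt_trans wz.
  by exists w; rewrite !inE ?ltxx.
have [|p pp <-] := IH z y _ zy; last by exists (z :: p); rewrite //= xzc.
rewrite ltnS in le; apply: leq_trans le; apply: proper_card; apply/properP; split.
  by apply/subsetP => u; rewrite !inE => /andP[zu ->]; rewrite (le_trans (ltW xz) zu).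
by exists x; rewrite !inE ?lexx ?xy // lt_geF.
Qed.

Lemma cov_above (x y : P) : x < y -> exists2 z, cov x z & z <= y.
Proof.
move=> xy; have [[|z p] /= pp pl] := le_path (ltW xy); first by rewrite pl ltxx in xy.
case/andP: pp => xz pz; exists z => //.
elim: p z {xz xy} pz pl => [|w p IH] z /=; first by move=> _ ->.
by case/andP=> /cov_lt/ltW zw pw lw; apply: le_trans zw (IH _ pw lw).
Qed.

Lemma cov_path_le (x : P) p : path (fun a b => cov a b) x p ->
  {subset x :: p <= [pred z | x <= z <= last x p]}.
Proof.
elim: p x => [|y p IH] x /=; first by move=> _ z; rewrite !inE => /eqP ->; rewrite !lexx.
case/andP=> /cov_lt xy /IH h z; rewrite inE => /predU1P[->|/h].
  rewrite inE lexx /=; have := h y; rewrite inE eqxx => /(_ isT); rewrite inE.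
  by case/andP=> _; apply: le_trans (ltW xy).
by rewrite !inE => /andP[yz ->]; rewrite (le_trans (ltW xy)).
Qed.

Lemma chain_on (S : {set P}) x y : x <= y -> (forall z, x <= z <= y -> z \in S) ->
  connect (on adj S) x y.
Proof.
move=> xy h; have [p pp lp] := le_path xy; rewrite -lp; apply: path_connect_on.
  by apply: sub_path pp => a b; apply: cov_adj.
by move=> z zp; apply: h; rewrite -lp; apply: cov_path_le pp _ zp.
Qed.

Lemma subtree_seg (u v : P) : subtree adj [set z | u <= z <= v].
Proof.
apply: (subtree_from treeP (x := u)) => y; rewrite inE => /andP[uy yv].
by apply: chain_on => // z /andP[uz zy]; rewrite inE uz (le_trans zy).
Qed.

Lemma cov_path_uniq (x : P) p : path (fun a b => cov a b) x p -> uniq (x :: p).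
Proof.
move=> pp; have : sorted <%O (x :: p) by apply: sub_path pp => a b; apply: cov_lt.
by apply: sorted_uniq; [apply: lt_trans|apply: ltxx].
Qed.

(** A saturated chain is a path of the tree, and a subtree contains the path
    between any two of its points. *)
Lemma subtree_convex (S : {set P}) x y z : subtree adj S -> x \in S -> y \in S ->
  x <= z <= y -> z \in S.
Proof.
move=> cS xS yS /andP[xz zy].
have [p pp lp] := le_path xz; have [q pq lq] := le_path zy.
have pc : path (fun a b => cov a b) x (p ++ q) by rewrite cat_path pp lp.
have pa : path adj x (p ++ q) by apply: sub_path pc => a b; apply: cov_adj.
have := path_in treeP pa (cov_path_uniq pc) cS xS.
rewrite last_cat lp lq => /(_ yS); apply.
by rewrite -lp -cat_cons mem_cat mem_last.
Qed.

Lemma interval_subtree (S : interval P) : subtree adj (val S).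
Proof.
case: S => S /= /andP[/forall_inP convS /forall_inP connS].
have cv x y z : x \in S -> y \in S -> x <= z <= y -> z \in S.
  move=> xS yS xzy; have /forall_inP/(_ y yS)/forallP/(_ z) := convS x xS.
  by rewrite xzy.
apply/subtreeP => x y xS yS; have /forall_inP/(_ y yS) := connS x xS.
apply: connect_sub => a b /and3P[aS bS /orP[ab|ba]].
  by apply: chain_on => // z; apply: cv.
rewrite (on_sym treeP); apply: chain_on => // z; exact: cv.
Qed.

Lemma subtree_interval (S : {set P}) : subtree adj S -> convex_set S && connected_set S.
Proof.
move=> cS; apply/andP; split.
  apply/forall_inP => x xS; apply/forall_inP => y yS; apply/forallP => z.
  by apply/implyP; apply: subtree_convex cS xS yS.
apply/forall_inP => x xS; apply/forall_inP => y yS.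
move/subtreeP/(_ x y xS yS): cS; apply: connect_impl => a b.
rewrite /on /= adjE => /and3P[-> -> /orP[/cov_lt/ltW ab|/cov_lt/ltW ab]] /=.
  by rewrite /Order.comparable ab.
by rewrite /Order.comparable ab orbT.
Qed.

Definition to_interval (S : {set P}) (cS : subtree adj S) : interval P :=
  Sub S (subtree_interval cS).

(** A chain leaving a branch does so through its edge, which must then point
    out of the branch. *)
Lemma le_cross (x y u v : P) : adj x y -> u <= v -> u \in branch adj x y ->
  v \notin branch adj x y -> [/\ cov y x, u <= y & x <= v].
Proof.
move=> xy uv uB vB.
have cr w : u <= w -> w \notin branch adj x y -> u <= y <= w /\ u <= x <= w.
  move=> uw wB.
  have := subtree_cross treeP xy (subtree_seg u w) _ uB _ wB.
  by rewrite !inE !lexx uw => /(_ isT isT) /andP[].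
have [/andP[uy yv] /andP[ux xv]] := cr v uv vB; split=> //.
move: (xy); rewrite adjE => /orP[xyc|//].
have [/andP[_ yx] _] := cr x ux (branch_near treeP xy).
by have := lt_le_trans (cov_lt xyc) yx; rewrite ltxx.
Qed.

Lemma le_cross' (x y u v : P) : adj x y -> v <= u -> u \in branch adj x y ->
  v \notin branch adj x y -> [/\ cov x y, y <= u & v <= x].
Proof.
move=> xy vu uB vB; have yx : adj y x by rewrite adj_sym.
have vB' : v \in branch adj y x by rewrite branchC.
have uB' : u \notin branch adj y x by rewrite branchC // uB.
by have [? ? ?] := le_cross yx vu vB' uB'.
Qed.

(** For subtrees that meet, this says that the intersection is a down-set of [S]
    and an up-set of [T], the condition for the identity on it to define a
    morphism I_S -> I_T.  It is tested on covers only. *)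
Definition linked (S T : {set P}) : bool :=
  [forall u : P, forall v : P, cov u v ==>
    ([&& u \in S, v \in S & v \in T] ==> (u \in T)) &&
    ([&& u \in S, u \in T & v \in T] ==> (v \in S))].

Lemma linkedP (S T : {set P}) :
  reflect (forall u v : P, cov u v ->
    (u \in S -> v \in S -> v \in T -> u \in T) /\
    (u \in S -> u \in T -> v \in T -> v \in S)) (linked S T).
Proof.
apply: (iffP forallP) => [h u v uv|h u].
  have /forallP/(_ v)/implyP/(_ uv)/andP[/implyP h1 /implyP h2] := h u.
  by split=> a b c; [apply: h1|apply: h2]; rewrite a b c.
apply/forallP => v; apply/implyP => /h[h1 h2]; apply/andP; split.
  by apply/implyP => /and3P[]; apply: h1.
by apply/implyP => /and3P[]; apply: h2.
Qed.

Lemma linked_down (S T : {set P}) u v : subtree adj S -> linked S T ->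
  u <= v -> u \in S -> v \in S -> v \in T -> u \in T.
Proof.
move=> cS /linkedP h uv uS vS vT; have [p pp lp] := le_path uv.
have sub : {subset u :: p <= S}.
  move=> z /(cov_path_le pp); rewrite inE lp; exact: subtree_convex.
rewrite -{}lp {uv vS} in vT; elim: p u {uS} pp sub vT => //= w p IH u.
case/andP=> uw pw sub lT; have wS : w \in S by rewrite sub // !inE eqxx orbT.
have uS : u \in S by rewrite sub // !inE eqxx.
have wT : w \in T by apply: IH => // z zp; apply: sub; rewrite inE zp orbT.
by have [h1 _] := h _ _ uw; apply: h1.
Qed.

Lemma linked_up (S T : {set P}) u v : subtree adj T -> linked S T ->
  u <= v -> u \in S -> u \in T -> v \in T -> v \in S.
Proof.
move=> cT /linkedP h uv uS uT vT; have [p pp lp] := le_path uv.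
have sub : {subset u :: p <= T}.
  move=> z /(cov_path_le pp); rewrite inE lp; exact: subtree_convex.
rewrite -{}lp {uv uT} in vT *; elim: p u uS pp sub vT => //= w p IH u uS.
case/andP=> uw pw sub lT; have wT : w \in T by rewrite sub // !inE eqxx orbT.
have uT : u \in T by rewrite sub // !inE eqxx.
apply: IH => // [|z zp]; last by apply: sub; rewrite inE zp orbT.
by have [_ h1] := h _ _ uw; apply: h1.
Qed.

(** The composite I_S -> I_X -> I_Y is nonzero at [p], and a map from I_S to I_Y is
    determined by one value, so it is nonzero on all of [S :&: Y]. *)
Lemma linked_mid (S X Y : {set P}) p : subtree adj S -> subtree adj Y ->
  p \in S -> p \in X -> p \in Y -> linked S X -> linked X Y -> S :&: Y \subset X.
Proof.
move=> cS cY pS pX pY /linkedP h1 /linkedP h2; apply/subsetP => z zSY.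
have pSY : p \in S :&: Y by rewrite inE pS.
have /subtreeP/(_ p z pSY zSY) := subtreeI treeP cS cY.
move=> pz; apply: (connect_inv _ pz) => // a b.
rewrite /on /= !inE adjE => /and3P[/andP[aS aY] /andP[bS bY] /orP[ab|ba]] aX.
  by have [_] := h2 _ _ ab; apply.
by have [+ _] := h1 _ _ ba; apply.
Qed.

Lemma linked_trans (S X Y : {set P}) p : subtree adj S -> subtree adj Y ->
  p \in S -> p \in X -> p \in Y -> linked S X -> linked X Y -> linked S Y.
Proof.
move=> cS cY pS pX pY SX XY.
have /subsetP sub := linked_mid cS cY pS pX pY SX XY.
move/linkedP: SX => h1; move/linkedP: XY => h2.
apply/linkedP => u v uv; have [a1 a2] := h1 _ _ uv; have [b1 b2] := h2 _ _ uv; split.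
  move=> uS vS vY; have vX : v \in X by rewrite sub // inE vS.
  by apply: b1 => //; apply: a1.
move=> uS uY vY; have uX : u \in X by rewrite sub // inE uS.
by apply: a2 => //; apply: b2.
Qed.

Lemma linked_refl S : linked S S.
Proof. by apply/linkedP. Qed.

Section Scalar.
Variable k : fieldType.
Local Open Scope ring_scope.

(** A morphism I_S -> I_T as the family of scalars by which it acts. *)
Definition scalar_hom (S T : {set P}) (c : P -> k) : Prop :=
  (forall x, ~~ ((x \in S) && (x \in T)) -> c x = 0) /\
  (forall x y, (x <= y)%O -> x \in S -> c y = if y \in T then c x else 0).

Lemma scalar_hom_const (S T : {set P}) c x y : subtree adj S -> subtree adj T ->
  scalar_hom S T c -> x \in S :&: T -> y \in S :&: T -> c x = c y.
Proof.
move=> cS cT [_ cc] xI yI.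
have /subtreeP/(_ x y xI yI) xy := subtreeI treeP cS cT.
suff : y \in [pred y | c x == c y] by rewrite inE => /eqP.
apply: (connect_inv _ xy); last by rewrite inE eqxx.
move=> a b; rewrite /on /= !inE adjE.
case/and3P=> /andP[aS aT] /andP[bS bT] /orP[]/cov_lt/ltW ab /eqP ->.
  by rewrite (cc _ _ ab aS) bT.
by rewrite (cc _ _ ab bS) aT.
Qed.

Lemma scalar_hom_zero (S T : {set P}) c x : subtree adj S -> subtree adj T ->
  scalar_hom S T c -> ~~ linked S T -> c x = 0.
Proof.
move=> cS cT cc; have [c0 c1] := cc => nl.
have [xI|] := boolP (x \in S :&: T); last by rewrite inE; apply: c0.
rewrite /linked negb_forall in nl; case/existsP: nl => u.
rewrite negb_forall => /existsP[v]; rewrite negb_imply negb_and !negb_imply.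
case/andP=> /cov_lt/ltW uv /orP[/andP[/and3P[uS vS vT] uT]|/andP[/and3P[uS uT vT] vS]].
  have vI : v \in S :&: T by rewrite inE vS.
  rewrite (scalar_hom_const cS cT cc xI vI) (c1 _ _ uv uS) vT c0 //.
  by rewrite (negbTE uT) andbF.
have uI : u \in S :&: T by rewrite inE uS.
rewrite (scalar_hom_const cS cT cc xI uI).
by have := c1 _ _ uv uS; rewrite vT => <-; rewrite c0 // (negbTE vS).
Qed.

Lemma scalar_hom_indicator (S T : {set P}) (g : k) : subtree adj S -> subtree adj T ->
  linked S T -> scalar_hom S T (fun x => if x \in S :&: T then g else 0).
Proof.
move=> cS cT ST; split=> [x|x y xy xS]; first by rewrite inE => /negbTE ->.
rewrite !inE xS /=; case: ifP => [/andP[yS yT]|].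
  by rewrite yT (linked_down cS ST xy).
case: ifP => // yT; rewrite andbT => yS; case: ifP => // xT.
by rewrite (linked_up cT ST xy) in yS.
Qed.

(** A cube of spaces of dimension at most one: [E s] is the support of a generator
    at the vertex [s], empty when the space is zero.  When two adjacent supports are
    nonempty they are nested, so the map between them preserves the generator and
    the cube reduces to one of scalars, where a direction that does not change
    the vanishing of [E] is contractible. *)
Lemma scalar_cube_exact (O : finType) (E : {set O} -> {set P}) (a : O) (n : nat)
    (g : {set O} -> k) :
  (forall (s : {set O}) b, b \notin s -> E s != set0 -> E (b |: s) != set0 ->
    E s \subset E (b |: s)) ->
  (forall s : {set O}, a \notin s -> (E s == set0) = (E (a |: s) == set0)) ->
  (forall s : {set O}, #|s| != n -> g s = 0) ->
  (forall s x, x \in E s -> \sum_(b | b \notin s)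
      cube_sign k b s * (if x \in E (b |: s) then g (b |: s) else 0) = 0) ->
  exists g' : {set O} -> k,
    (forall s : {set O}, #|s| != n.+1 -> g' s = 0) /\
    (forall s x, x \in E s -> \sum_(b | b \notin s)
      cube_sign k b s * (if x \in E (b |: s) then g' (b |: s) else 0) = g s).
Proof.
move=> nest good gn g0.
pose H : pred {set O} := fun s => E s != set0.
pose c s : k^o := if H s then g s else 0.
have memE (f : {set O} -> k) s x b : x \in E s -> b \notin s ->
    (forall s, ~~ H s -> f s = 0) ->
    (if x \in E (b |: s) then f (b |: s) else 0) = f (b |: s).
  move=> xs bs f0; case: ifPn => // xE; rewrite f0 //; apply: contra xE => Hb.
  have Hs : E s != set0 by apply/set0Pn; exists x.
  exact: (subsetP (nest _ _ bs Hs Hb)).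
have [|s Hs|s sn|s|w [w0 wn bw]] := @cube_diff_exact k O k^o H a c n.
- by move=> s as0; rewrite /H good.
- by rewrite /c (negbTE Hs).
- by rewrite /c gn // if_same.
- rewrite /cube_diff; case: ifP => // /set0Pn[x xs]; rewrite -[RHS](g0 s x xs).
  apply: eq_bigr => b bs; congr (_ * _).
  rewrite -(memE c s x b xs bs); last by move=> s' /negbTE Hs'; rewrite /c Hs'.
  case: ifP => // xE; rewrite /c; case: ifP => // /set0Pn[]; by exists x.
exists w; split=> // s x xs.
have Hs : H s by apply/set0Pn; exists x.
transitivity (c s : k); last by rewrite /c Hs.
rewrite -bw /cube_diff Hs; apply: eq_bigr => b bs; congr (_ * _).
exact: memE.
Qed.

End Scalar.
End Poset.

(** * Sections, cosections and sums of interval modules *)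

Section Sections.
Context (k : fieldType) {d : Order.disp_t} (P : finPOrderType d).
Local Open Scope ring_scope.
Local Open Scope lfun_scope.

Notation rep := (rep k P).

(** Morphisms I_S -> N; using families of vectors of [N] keeps [S] out of the type. *)
Definition is_section (N : rep) (S : {set P}) (v : forall x, N x) : Prop :=
  (forall x, x \notin S -> v x = 0) /\
  (forall x y (xy : (x <= y)%O), x \in S -> rep_map N xy (v x) = v y).

(** Morphisms N -> I_S, with the same purpose. *)
Definition is_cosection (N : rep) (S : {set P}) (p : forall x, 'Hom(N x, k^o)) : Prop :=
  (forall x v, x \notin S -> p x v = 0) /\
  (forall x y (xy : (x <= y)%O) v,
     p y (rep_map N xy v) = if y \in S then p x v else 0).

Lemma hom_natE (M N : rep) (f : hom M N) x y (xy : (x <= y)%O) v :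
  rep_map N xy (f x v) = f y (rep_map M xy v).
Proof. by have /lfunP/(_ v) := hom_nat f xy; rewrite !comp_lfunE. Qed.

Lemma rep_mapE (M : rep) x y z (xy : (x <= y)%O) (yz : (y <= z)%O) (xz : (x <= z)%O) v :
  rep_map M xz v = rep_map M yz (rep_map M xy v).
Proof. by rewrite (rep_map_comp M xy yz) comp_lfunE. Qed.

Lemma hom_exists (M N : rep) (f : forall x, M x -> N x) :
  (forall x, linear (f x)) ->
  (forall x y (xy : (x <= y)%O) v, rep_map N xy (f x v) = f y (rep_map M xy v)) ->
  exists h : hom M N, forall x v, h x v = f x v.
Proof.
move=> lf nf.
pose m x := GRing.isLinear.Build k (M x) (N x) _ (f x) (lf x).
pose F x : {linear M x -> N x} := HB.pack (f x) (m x).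
have nat x y (xy : (x <= y)%O) :
    (rep_map N xy \o linfun (F x) = linfun (F y) \o rep_map M xy)%VF.
  by apply/lfunP => v; rewrite !comp_lfunE !lfunE /= nf.
by exists (Hom nat) => x v; apply: (lfunE (F x)).
Qed.

Lemma section_hom (M N : rep) (f : hom M N) S v :
  is_section S v -> is_section S (fun x => f x (v x)).
Proof.
case=> v0 vn; split=> [x /v0 ->|x y xy xS]; first by rewrite linear0.
by rewrite hom_natE vn.
Qed.

Lemma section0 (N : rep) S : is_section S (fun x => 0 : N x).
Proof. by split=> // x y xy _; rewrite linear0. Qed.

Lemma sectionD (N : rep) S (v w : forall x, N x) :
  is_section S v -> is_section S w -> is_section S (fun x => v x + w x).
Proof.
move=> [v0 v1] [w0 w1]; split=> [x xS|x y xy xS]; first by rewrite v0 ?w0 ?addr0.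
by rewrite linearD /= v1 ?w1.
Qed.

Lemma sectionZ (N : rep) S (a : k) (v : forall x, N x) :
  is_section S v -> is_section S (fun x => a *: v x).
Proof.
move=> [v0 v1]; split=> [x xS|x y xy xS]; first by rewrite v0 ?scaler0.
by rewrite linearZ /= v1.
Qed.

Lemma section_sum (N : rep) S (I : Type) (r : seq I) (p : pred I)
    (v : I -> forall x, N x) :
  (forall i, p i -> is_section S (v i)) -> is_section S (fun x => \sum_(i <- r | p i) v i x).
Proof.
move=> sv; split=> [x xS|x y xy xS].
  by rewrite big1 // => i /sv[-> //].
by rewrite linear_sum; apply: eq_bigr => i pi /=; have [_ ->] := sv i pi.
Qed.

Lemma section_eq (N : rep) S (v w : forall x, N x) :
  (forall x, v x = w x) -> is_section S v -> is_section S w.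
Proof.
move=> vw [v0 v1]; split=> [x xS|x y xy xS]; rewrite -!vw; first exact: v0.
exact: v1.
Qed.

Lemma section_if (N : rep) S (v : forall x, N x) : is_section S v ->
  forall x, v x = if x \in S then v x else 0.
Proof. by case=> v0 _ x; case: ifPn => // /v0. Qed.

Lemma section_coord (N : rep) S T (v : forall x, N x) (p : forall x, 'Hom(N x, k^o)) : is_section S v -> is_cosection T p ->
  scalar_hom S T (fun x => p x (v x) : k).
Proof.
move=> [v0 v1] [p0 p1]; split=> [x|x y xy xS].
  by rewrite negb_and => /orP[/v0 ->|/p0 ->//]; rewrite linear0.
by rewrite -(v1 x y xy xS) p1.
Qed.

Lemma scalar_hom_section (N : rep) S T (v : forall x, N x) (c : P -> k) :
  scalar_hom S T c -> is_section T v -> is_section S (fun x => c x *: v x).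
Proof.
move=> [c0 c1] [v0 v1]; split=> [x xS|x y xy xS].
  by rewrite c0 ?scale0r // (negbTE xS).
rewrite linearZ /= (c1 x y xy xS).
have [xT|xT] := boolP (x \in T).
  by rewrite v1 //; case: ifP => // yT; rewrite v0 ?yT // !scaler0.
by rewrite (c0 x) ?(negbTE xT) ?andbF // if_same !scale0r.
Qed.

(** The composite M -> I_S -> N is natural. *)
Lemma cosection_section_nat (M N : rep) S (p : forall x, 'Hom(M x, k^o)) (v : forall x, N x)
    x y (xy : (x <= y)%O) (u : M x) :
  is_cosection S p -> is_section S v ->
  rep_map N xy (p x u *: v x) = p y (rep_map M xy u) *: v y.
Proof.
move=> [p0 p1] [v0 v1]; rewrite linearZ /= p1.
have [xS|xS] := boolP (x \in S).
  by rewrite v1 //; case: ifP => // yS; rewrite v0 ?yS // !scaler0.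
by rewrite p0 // if_same !scale0r.
Qed.

Lemma pid_const (a b : bool) :
  (const_mx 1 : 'rV[k]_a) *m (pid_mx 1 : 'M[k]_(a, b)) =
  if a then const_mx 1 else 0.
Proof.
apply/matrixP => i j; case: a b i j => -[] i j; try by case: j.
  by rewrite !mxE big_ord1 !mxE !ord1 /= mulr1.
by rewrite !mxE big_ord0.
Qed.

(** The coordinate of a row with zero or one entry. *)
Definition row_coord (a : bool) (u : 'rV[k]_a) : k := \sum_j u 0 j.

Lemma row_coord_linear (a : bool) : linear (@row_coord a : 'rV[k]_a -> k^o).
Proof.
move=> c u v; rewrite /row_coord scaler_sumr -big_split /=.
by apply: eq_bigr => j _; rewrite !mxE.
Qed.

Lemma row_coord_const (a : bool) : row_coord (const_mx 1 : 'rV[k]_a) = a%:R.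
Proof.
rewrite /row_coord (eq_bigr (fun=> 1)) => [|j _]; last by rewrite mxE.
by rewrite sumr_const card_ord.
Qed.

Lemma row_coordK (a : bool) (u : 'rV[k]_a) : row_coord u *: const_mx 1 = u.
Proof.
apply/matrixP => i j; rewrite !mxE mulr1 (ord1 i) /row_coord.
case: a u j => u j; last by case: j.
by rewrite big_ord1 (ord1 j).
Qed.

Lemma row_coord_pid (a b : bool) (u : 'rV[k]_a) :
  row_coord (u *m (pid_mx 1 : 'M[k]_(a, b))) = if b then row_coord u else 0.
Proof.
rewrite -{1}(row_coordK u) -scalemxAl pid_const.
have -> (v : 'rV[k]_b) : row_coord (row_coord u *: v) = row_coord u * row_coord v.
  by rewrite /row_coord mulr_sumr; apply: eq_bigr => j _; rewrite mxE.
case: a u => u.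
  by rewrite row_coord_const; case: b; rewrite ?mulr1 ?mulr0.
by rewrite {1 3}/row_coord big_ord0 mul0r if_same.
Qed.

Definition int_coord (S : {set P}) x (u : intmod_obj k S x) : k := row_coord (u : 'rV_(x \in S)).
Definition int_one (S : {set P}) x : intmod_obj k S x := (const_mx 1 : 'rV_(x \in S)).

Lemma int_coord_linear (S : {set P}) x : linear (@int_coord S x : intmod_obj k S x -> k^o).
Proof. exact: row_coord_linear. Qed.

Lemma int_coord0 (S : {set P}) x : @int_coord S x 0 = 0.
Proof. by rewrite /int_coord /row_coord big1 // => j _; rewrite mxE. Qed.

Lemma int_coordK (S : {set P}) x (u : intmod_obj k S x) : int_coord u *: int_one S x = u.
Proof. exact: row_coordK. Qed.

Lemma int_coord_one (S : {set P}) x : int_coord (int_one S x) = (x \in S)%:R.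
Proof. exact: row_coord_const. Qed.

Lemma int_coord_map (S : {set P}) x y (u : intmod_obj k S x) :
  int_coord (intmod_map k S x y u) = if y \in S then int_coord u else 0.
Proof. by rewrite /intmod_map lfunE; apply: row_coord_pid. Qed.

Lemma int_coord_out (S : {set P}) x (u : intmod_obj k S x) : x \notin S -> int_coord u = 0.
Proof.
rewrite /int_coord; move: u; rewrite /intmod_obj; case: (x \in S) => // u _.
by rewrite /row_coord big_ord0.
Qed.

Lemma int_coord_inj (S : {set P}) x (u v : intmod_obj k S x) : int_coord u = int_coord v -> u = v.
Proof. by move=> uv; rewrite -(int_coordK u) uv int_coordK. Qed.

Lemma int_one_out (S : {set P}) x : x \notin S -> int_one S x = 0.
Proof. by move=> xS; apply: int_coord_inj; rewrite !int_coord_out. Qed.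

Lemma int_one_map (S : {set P}) x y : x \in S -> intmod_map k S x y (int_one S x) = int_one S y.
Proof. by move=> xS; apply: int_coord_inj; rewrite int_coord_map !int_coord_one xS; case: ifP. Qed.

Lemma hom_section (S : interval P) (N : rep) (g : hom (interval_module k S) N) :
  is_section (val S) (fun x => g x (int_one (val S) x)).
Proof.
split=> [x xS|x y xy xS]; first by rewrite int_one_out // linear0.
by rewrite hom_natE /= int_one_map.
Qed.

Lemma section_to_hom (S : interval P) (N : rep) v : is_section (val S) v ->
  exists g : hom (interval_module k S) N, forall x u, g x u = int_coord u *: v x.
Proof.
move=> [v0 v1].
apply: (@hom_exists (interval_module k S) N (fun x u => int_coord u *: v x)).
  by move=> x a u w; rewrite int_coord_linear scalerDl scalerA.
move=> x y xy u; rewrite linearZ /= int_coord_map.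
have [xS|xS] := boolP (x \in val S).
  by rewrite v1 //; case: ifPn => // yS; rewrite v0 // !scaler0.
by rewrite int_coord_out // if_same !scale0r.
Qed.

(** The inclusions and projections that make [V] the direct sum of the I_(S t). *)
Definition biproduct (V : rep) (T : finType) (S : T -> interval P)
    (i : T -> forall x, V x) (p : T -> forall x, 'Hom(V x, k^o)) : Prop :=
  [/\ forall t, is_section (val (S t)) (i t), forall t, is_cosection (val (S t)) (p t),
      forall x v, \sum_t (p t x v : k) *: i t x = v
    & forall t u x, x \in val (S u) -> p t x (i u x) = (t == u)%:R].

Lemma lfun_exists (V W : vectType k) (f : V -> W) : linear f ->
  {g : 'Hom(V, W) | forall v, g v = f v}.
Proof.
move=> lf; pose m := GRing.isLinear.Build k V W _ f lf.
pose F : {linear V -> W} := HB.pack f m.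
by exists (linfun F) => v; rewrite lfunE.
Qed.

Lemma foldr_dsum_biproduct (T : finType) (S : T -> interval P) (r : seq T) : uniq r ->
  let V := foldr (@dsum k d P) (rep0 k P) (map (interval_module k (P:=P)) (map S r)) in
  exists (i : T -> forall x, V x) (p : T -> forall x, 'Hom(V x, k^o)),
  [/\ forall t, is_section (val (S t)) (i t), forall t, is_cosection (val (S t)) (p t),
      forall x v, \sum_(t <- r) (p t x v : k) *: i t x = v
    & forall t u x, t \in r -> u \in r -> x \in val (S u) -> p t x (i u x) = (t == u)%:R].
Proof.
elim: r => [_ V|t r IH /= /andP[tr ur]].
  exists (fun _ _ => 0), (fun _ _ => 0); split=> //.
  - by move=> t; apply: section0.
  - by move=> t; split=> [x v _|x y xy v]; rewrite !lfunE //= if_same.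
  - by move=> x v; rewrite big_nil; apply/matrixP => a [].
have [i [p [si sp sv dv]]] := IH ur.
set V := foldr _ _ _ in i p si sp sv dv *.
pose I := interval_module k (S t).
pose W := dsum I V.
pose j (u : T) x : W x := if u == t then (int_one (val (S t)) x, 0) else (0, i u x).
have qP u x : {g : 'Hom(W x, k^o) | forall v, g v =
    if u == t then int_coord (v.1 : intmod_obj k (val (S t)) x) else p u x v.2}.
  apply: lfun_exists => a v w; case: (u == t); last by rewrite linearP.
  exact: int_coord_linear.
pose q u x := sval (qP u x).
have qE u x v : q u x v = _ := svalP (qP u x) v.
exists j, q.
have rmE x y (xy : (x <= y)%O) (v : W x) :
    rep_map W xy v = (intmod_map k (val (S t)) x y v.1, rep_map V xy v.2).
  by rewrite [LHS]lfunE.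
split.
- move=> u; split=> [x xS|x y xy xS]; rewrite /j; case: eqP => [ut|_].
  + by rewrite int_one_out // -ut.
  + by have [-> //] := si u.
  + by rewrite rmE /= linear0 int_one_map // -ut.
  + by rewrite rmE /= linear0; have [_ ->] := si u.
- move=> u; split=> [x v xS|x y xy v]; rewrite !qE; case: eqP => [ut|_].
  + by rewrite int_coord_out // -ut.
  + by have [-> //] := sp u.
  + by rewrite rmE /= int_coord_map ut.
  + by rewrite rmE /=; have [_ ->] := sp u.
- move=> x v; rewrite big_cons qE /j eqxx.
  rewrite (eq_big_seq (fun u => (0, (p u x v.2 : k) *: i u x) : W x)); last first.
    move=> u ur'; have ut : u != t by apply: contraNneq tr => <-.
    rewrite qE (negbTE ut).
    by congr (_, _); rewrite scaler0.
  case: v => v1 v2 /=.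
  transitivity ((v1, 0) + (0, v2) : W x); last by congr (_, _); rewrite ?addr0 ?add0r.
  congr (_ + _).
    by congr (_, _); rewrite ?scaler0 // int_coordK.
  rewrite -[in RHS](sv x v2).
  elim/big_rec2: _ => // u y1 y2 _ ->.
  by congr (_, _); rewrite addr0.
- move=> u w x; rewrite !inE => uR wR xS; rewrite qE /j.
  case: (u =P t) uR => [-> _|/eqP ut /= ur'].
    case: (w =P t) => [wt|/eqP wt]; last by rewrite int_coord0 eq_sym (negbTE wt).
    by rewrite int_coord_one -wt eqxx xS.
  case: (w =P t) wR => [wt _|_ /= wr]; last exact: dv.
  by rewrite linear0 wt (negbTE ut).
Qed.

Lemma biproduct_exists (T : finType) (S : T -> interval P) :
  exists V i p, interval_decomposable V /\ @biproduct V T S i p.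
Proof.
have [i [p [si sp sv dv]]] := foldr_dsum_biproduct S (enum_uniq T).
exists (foldr (@dsum k d P) (rep0 k P) (map (interval_module k (P:=P)) (map S (enum T)))).
exists i, p; split.
  exists (map S (enum T)).
  set V := foldr _ _ _.
  have n x y (xy : (x <= y)%O) : rep_map V xy \o \1 = \1 \o rep_map V xy.
    by rewrite comp_lfun1l comp_lfun1r.
  by exists (Hom n), (Hom n) => x /=; rewrite comp_lfun1l.
split=> // [x v|t u x xS]; first by rewrite -[RHS](sv x v) big_enum.
by apply: dv => //; rewrite mem_enum.
Qed.

Lemma decomposable_biproduct (V : rep) : interval_decomposable V ->
  exists (T : finType) (S : T -> interval P) i p, @biproduct V T S i p.
Proof.
move=> [s [f [g fg]]].
pose T : finType := 'I_(size s).
pose S : T -> interval P := tnth (in_tuple s).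
have sE : map S (enum T) = s by rewrite map_tnth_enum.
rewrite -sE in f g fg.
have [i [p [si sp sv dv]]] := foldr_dsum_biproduct S (enum_uniq T).
exists T, S, (fun t x => g x (i t x)), (fun t x => p t x \o f x); split.
- by move=> t; apply: section_hom.
- move=> t; have [p0 p1] := sp t; split=> [x v xS|x y xy v].
    by rewrite comp_lfunE p0.
  by rewrite !comp_lfunE -hom_natE p1.
- move=> x v; have [/lfunP/(_ v) gf _] := fg x.
  rewrite comp_lfunE id_lfunE in gf; rewrite -[RHS]gf -[in RHS](sv x (f x v)).
  rewrite big_enum linear_sum; apply: eq_bigr => t _.
  by rewrite comp_lfunE linearZ.
- move=> t u x xS; have [_ /lfunP fg'] := fg x.
  rewrite comp_lfunE -(dv t u x) ?mem_enum //; congr (p t x _).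
  by have := fg' (i u x); rewrite comp_lfunE id_lfunE.
Qed.

Lemma intmod_decomposable (S : interval P) : interval_decomposable (interval_module k S).
Proof.
exists [:: S] => /=.
pose I := interval_module k S; pose V := dsum I (rep0 k P).
have [|x y xy v|f fE] := @hom_exists I V (fun x v => (v, 0)).
- by move=> x a u v; congr (_, _); rewrite /= scaler0 addr0.
- by rewrite [LHS]lfunE; congr (_, _); apply: linear0.
have [|x y xy v|g gE] := @hom_exists V I (fun x v => v.1).
- by move=> x a u v.
- by rewrite [rep_map V xy v]lfunE.
exists f, g => x; split; apply/lfunP => v; rewrite comp_lfunE id_lfunE.
  by rewrite fE gE.
rewrite gE fE; case: v => v1 v2; congr (_, _).
by apply/matrixP => a [].
Qed.

(** Covers lift sections, by the lifting property applied to an interval module. *)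
Lemma cover_lift (V M : rep) (phi : hom V M) (S : interval P) (v : forall x, M x) :
  interval_cover phi -> is_section (val S) v ->
  exists w : forall x, V x, is_section (val S) w /\ forall x, phi x (w x) = v x.
Proof.
move=> [_ lift _] sv; have [g gE] := section_to_hom sv.
have [h hE] := lift _ (intmod_decomposable S) g.
exists (fun x => h x (int_one (val S) x)); split; first exact: hom_section.
move=> x; have := gE x (int_one (val S) x).
rewrite hE comp_lfunE int_coord_one => ->; rewrite (section_if sv x).
by case: ifP => _; rewrite ?scale1r ?scale0r.
Qed.

End Sections.

(** * Cochains of a cube of intervals *)

Section Kernels.
Context (k : fieldType) {d : Order.disp_t} (P : finPOrderType d).
Hypothesis treeP : tree_type P.
Local Open Scope ring_scope.
Notation rep := (rep k P).
Notation adj := (hasse_adj P).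

(** Precomposition with the canonical morphism I_S -> I_T. *)
Lemma section_restrict (N : rep) (S T : {set P}) v : subtree adj S -> subtree adj T ->
  linked S T -> is_section T v -> is_section S (fun x => if x \in S then v x else 0 : N x).
Proof.
move=> cS cT ST [v0 v1]; split=> [x /negbTE -> //|x y xy xS]; rewrite xS.
have [xT|xT] := boolP (x \in T).
  rewrite v1 //; case: ifP => // yS; apply: v0.
  by apply: contraFN yS => yT; apply: linked_up xy xS xT yT.
rewrite (v0 x xT) linear0; case: ifP => // yS; rewrite v0 //.
by apply: contra xT => yT; apply: linked_down xy xS yS yT.
Qed.

Definition is_kernel (K V N : rep) (i : hom K V) (f : hom V N) : Prop :=
  (forall x, lker (i x) = 0%VS) /\ (forall x, limg (i x) = lker (f x)).

Lemma kernel_lift (K V N : rep) (i : hom K V) (f : hom V N) (S : {set P}) v :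
  is_kernel i f -> is_section S v -> (forall x, f x (v x) = 0) ->
  is_section S (fun x => (i x)^-1%VF (v x)) /\ forall x, i x ((i x)^-1%VF (v x)) = v x.
Proof.
move=> [i0 iE] [v0 v1] fv.
have iK x : i x ((i x)^-1%VF (v x)) = v x.
  by rewrite limg_lfunVK // iE memv_ker fv.
split=> //; split=> [x xS|x y xy xS]; first by rewrite v0 ?linear0.
by apply: (lker0P (introT eqP (i0 y))); rewrite -hom_natE !iK v1.
Qed.

Lemma kernel_inj (K V N : rep) (i : hom K V) (f : hom V N) x u v :
  is_kernel i f -> i x u = i x v -> u = v.
Proof. by move=> [i0 _]; apply: (lker0P (introT eqP (i0 x))). Qed.

Lemma kernel0 (K V N : rep) (i : hom K V) (f : hom V N) x u :
  is_kernel i f -> f x (i x u) = 0.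
Proof. by move=> [_ iE]; apply/eqP; rewrite -memv_ker -iE memv_img ?memvf. Qed.

Section Cochains.
Variables (O : finType) (F : {set O} -> {set P}).
Hypothesis cF : forall s, subtree adj (F s).
Hypothesis lF : forall (s : {set O}) b, b \notin s -> linked (F s) (F (b |: s)).
Hypothesis nestF : forall (s : {set O}) b, b \notin s ->
  (F s \subset F (b |: s)) || (F (b |: s) \subset F s).
Hypothesis convF : forall (s : {set O}) b c x, b \notin s -> c \notin s ->
  x \in F s -> x \in F (c |: (b |: s)) -> x \in F (b |: s).

(** A morphism from the sum of the I_(F s), over the [s] with [n] elements, to [N]. *)
Definition cochain (N : rep) (n : nat) (z : {set O} -> forall x, N x) : Prop :=
  (forall s, is_section (F s) (z s)) /\
  (forall s : {set O}, #|s| != n -> forall x, z s x = 0).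

Definition cochain_diff (N : rep) (z : {set O} -> forall x, N x) (s : {set O}) (x : P) : N x :=
  cube_diff (fun s => x \in F s) (fun s => z s x) s.

Lemma cochain_diff_eq (N : rep) (z z' : {set O} -> forall x, N x) s x :
  (forall s, z s x = z' s x) -> cochain_diff z s x = cochain_diff z' s x.
Proof.
move=> zz; rewrite /cochain_diff /cube_diff; case: ifP => // _.
by apply: eq_bigr => b _; rewrite zz.
Qed.

Lemma cochain_diff_hom (M N : rep) (f : hom M N) (z : {set O} -> forall x, M x) s x :
  f x (cochain_diff z s x) = cochain_diff (fun s x => f x (z s x)) s x.
Proof.
rewrite /cochain_diff /cube_diff; case: ifP => // _; last by rewrite linear0.
by rewrite linear_sum; apply: eq_bigr => b _; rewrite linearZ.
Qed.

Lemma cochain_diffB (N : rep) (z z' : {set O} -> forall x, N x) s x :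
  cochain_diff (fun s x => z s x - z' s x) s x = cochain_diff z s x - cochain_diff z' s x.
Proof.
rewrite /cochain_diff /cube_diff; case: ifP => _; last by rewrite subr0.
by rewrite -sumrB; apply: eq_bigr => b _; rewrite scalerBr.
Qed.

Lemma cochain_diff_cochain (N : rep) n (z : {set O} -> forall x, N x) :
  cochain n.+1 z -> cochain n (cochain_diff z).
Proof.
move=> [zs zn]; split=> [s|s sn x].
  apply: (@section_eq k d P N (F s) (fun x => \sum_(b | b \notin s)
     cube_sign k b s *: (if x \in F s then z (b |: s) x else 0))).
    move=> x; rewrite /cochain_diff /cube_diff; case: ifP => // _.
    by rewrite big1 // => b _; rewrite scaler0.
  apply: section_sum => b bs; apply: sectionZ; apply: section_restrict (zs _) => //.
  exact: lF.
rewrite /cochain_diff /cube_diff; case: ifP => // _; rewrite big1 // => b bs.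
rewrite zn ?scaler0 //; apply: contra sn.
by rewrite cardsU1 bs add1n eqSS.
Qed.

Lemma cochain_diff_sqr (N : rep) n (z : {set O} -> forall x, N x) s x :
  cochain n z -> cochain_diff (cochain_diff z) s x = 0.
Proof.
move=> [zs _]; rewrite /cochain_diff; apply: cube_diff_sqr => [s' xs|a b as0 bs xs xab].
  by have [-> //] := zs s'.
exact: convF xab.
Qed.

Definition exact_at (N : rep) (n : nat) : Prop :=
  forall z : {set O} -> forall x, N x, cochain n z -> (forall s x, cochain_diff z s x = 0) ->
  exists w : {set O} -> forall x, N x,
    cochain n.+1 w /\ forall s x, cochain_diff w s x = z s x.

Lemma cochain_lift (V N : rep) (phi : hom V N) n (u : {set O} -> forall x, N x) :
  interval_cover phi -> cochain n u ->
  exists w : {set O} -> forall x, V x,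
    cochain n w /\ forall s x, phi x (w s x) = u s x.
Proof.
move=> cov [us un].
have lift s : exists w : forall x, V x,
    is_section (F s) w /\ forall x, phi x (w x) = u s x.
  exact: (@cover_lift k d P V N phi (to_interval treeP (cF s)) (u s) cov (us s)).
have [w wE] := fin_all_exists lift.
exists (fun (s : {set O}) x => if #|s| == n then w s x else 0); split.
  split=> [s|s /negbTE-> //].
  by case: (#|s| == n); [have [] := wE s|apply: section0].
move=> s x; case: ifPn => sn; first by have [_ ->] := wE s.
by rewrite linear0 un.
Qed.

(** Dimension shifting for 0 -> K -> V -> N -> 0.  Push the primitive [w] of the cocycle
    down to [N], where it becomes a cocycle, hence a coboundary; lift a primitive
    of it along the cover and correct [w] by the coboundary of that lift. *)
Lemma exact_shift (K V N : rep) (i : hom K V) (phi : hom V N) n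
    (z : {set O} -> forall x, K x) (w : {set O} -> forall x, V x) :
  interval_cover phi -> is_kernel i phi -> exact_at N n.+1 ->
  cochain n z -> cochain n.+1 w -> (forall s x, cochain_diff w s x = i x (z s x)) ->
  exists w' : {set O} -> forall x, K x,
    cochain n.+1 w' /\ forall s x, cochain_diff w' s x = z s x.
Proof.
move=> cov ker exN cz cw wz.
have cphi : cochain n.+1 (fun s x => phi x (w s x)).
  have [ws wn] := cw; split=> [s|s sn x]; first exact: section_hom.
  by rewrite wn ?linear0.
have [s x|u [cu uE]] := exN _ cphi.
  by rewrite -cochain_diff_hom wz (kernel0 _ ker).
have [v [cv vE]] := cochain_lift cov cu.
pose w1 s x := w s x - cochain_diff v s x.
have cw1 : cochain n.+1 w1.
  have [ws wn] := cw; have [bs bn] := cochain_diff_cochain cv; split=> [s|s sn x].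
    apply: (@section_eq k d P V (F s) (fun x => w s x + (-1) *: cochain_diff v s x)).
      by move=> x; rewrite scaleN1r.
    by apply: sectionD => //; apply: sectionZ.
  by rewrite /w1 wn // bn // subr0.
have phi0 s x : phi x (w1 s x) = 0.
  by rewrite linearB /= cochain_diff_hom (cochain_diff_eq (z' := u)) => [|s']; rewrite ?vE // uE subrr.
have lift s := kernel_lift ker (proj1 cw1 s) (fun x => phi0 s x).
exists (fun s x => (i x)^-1%VF (w1 s x)); split.
  split=> [s|s sn x]; first by have [] := lift s.
  by have [_ ->] := cw1; rewrite ?linear0.
move=> s x; apply: (kernel_inj ker); rewrite cochain_diff_hom -wz.
rewrite (cochain_diff_eq (z' := w1)); last by move=> s'; have [_ ->] := lift s'.
by rewrite cochain_diffB (cochain_diff_sqr _ _ cv) subr0.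
Qed.

Definition meets (S X : {set P}) : bool := linked S X && (S :&: X != set0).

(** The direction [a] is invisible to Hom(-, I_X): such a direction contracts the
    complex of the Hom(I_(F s), I_X). *)
Definition neutral_op (a : O) (X : {set P}) : Prop :=
  forall s : {set O}, a \notin s -> meets (F s) X = meets (F (a |: s)) X.

(** Componentwise, the space of morphisms I_(F s) -> I_(S t) has dimension at most
    one, so each component is a cube of scalars. *)
Lemma exact_decomposable (V : rep) (T : finType) (S : T -> interval P) j p n
    (z : {set O} -> forall x, V x) :
  @biproduct k d P V T S j p -> cochain n z -> (forall s x, cochain_diff z s x = 0) ->
  (forall t, (exists a, neutral_op a (val (S t))) \/ (forall s x, p t x (z s x) = 0)) ->
  exists w : {set O} -> forall x, V x,
    cochain n.+1 w /\ forall s x, cochain_diff w s x = z s x.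
Proof.
move=> [sj sp jp _] [zs zn] z0 good.
have comp t : exists c : {set O} -> P -> k,
    [/\ forall s, scalar_hom (F s) (val (S t)) (c s),
        forall s : {set O}, #|s| != n.+1 -> forall x, c s x = 0
      & forall s x, x \in F s -> \sum_(b | b \notin s) cube_sign k b s * c (b |: s) x
          = p t x (z s x)].
  have [[a ga]|c0] := good t; last first.
    exists (fun _ _ => 0); split=> //.
      by move=> s; split=> // x y _ _; rewrite if_same.
    by move=> s x xs; rewrite c0 big1 // => b _; rewrite mulr0.
  set X := val (S t) in ga *.
  have cX : subtree adj X := interval_subtree treeP (S t).
  pose E s := if linked (F s) X then F s :&: X else set0.
  have EE s : (E s == set0) = ~~ meets (F s) X.
    by rewrite /E /meets; case: ifP => _; rewrite ?negbK ?eqxx.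
  pose zt s x : k := p t x (z s x).
  have szt s : scalar_hom (F s) X (zt s) := section_coord (zs s) (sp t).
  pose g s := if [pick x in E s] is Some x then zt s x else 0.
  have ztE s x : zt s x = if x \in E s then g s else 0.
    have [l|l] := boolP (linked (F s) X); last first.
      by rewrite /E (negbTE l) inE (scalar_hom_zero treeP x (cF s) cX (szt s) l).
    rewrite {1}/E l.
    case: ifPn => xE; last by have [-> //] := szt s; rewrite inE in xE.
    rewrite /g; case: pickP => [y|/(_ x)]; last by rewrite /E l xE.
    by rewrite /E l => yE; apply: (scalar_hom_const treeP (cF s) cX (szt s) xE yE).
  have nest (s : {set O}) b : b \notin s -> E s != set0 -> E (b |: s) != set0 ->
      E s \subset E (b |: s).
    rewrite !EE !negbK => bs /andP[l1 n1] /andP[l2 n2]; rewrite /E l1 l2.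
    have [q [qF qF' qX]] : exists q, [/\ q \in F s, q \in F (b |: s) & q \in X].
      case/orP: (nestF bs) => /subsetP sub.
        by case/set0Pn: n1 => q; rewrite inE => /andP[q1 q2]; exists q; rewrite sub.
      by case/set0Pn: n2 => q; rewrite inE => /andP[q1 q2]; exists q; rewrite sub.
    have /subsetP sub := linked_mid treeP (cF s) cX qF qF' qX (lF bs) l2.
    by apply/subsetP => x xE; rewrite inE sub //; move: xE; rewrite inE => /andP[].
  have [s as0|s sn|s x xE|g' [g'n g'E]] := @scalar_cube_exact d P k O E a n g nest.
  - by rewrite !EE ga.
  - rewrite /g; case: pickP => // x _; by rewrite /zt zn ?linear0.
  - have xF : x \in F s by move: xE; rewrite /E; case: ifP => _; rewrite !inE // => /andP[].
    transitivity (p t x (cochain_diff z s x) : k); last by rewrite z0 linear0.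
    rewrite /cochain_diff /cube_diff xF linear_sum; apply: eq_bigr => b _.
    by rewrite -ztE linearZ.
  exists (fun s x => if x \in E s then g' s else 0); split.
  - move=> s; rewrite /E; have [l|l] := boolP (linked (F s) X); first exact: scalar_hom_indicator.
    by split=> [x _|x y _ _]; rewrite !inE // if_same.
  - by move=> s sn x; rewrite g'n // if_same.
  move=> s x xF; rewrite -/(zt s x) ztE; case: ifPn => xE; first exact: g'E.
  rewrite big1 // => b bs; case: ifPn => xE'; last by rewrite mulr0.
  case/negP: xE; move: xE'; rewrite /E; case l: (linked (F (b |: s)) X); last by rewrite inE.
  rewrite inE => /andP[xF' xX].
  by rewrite (linked_trans treeP (cF s) cX xF xF' xX (lF bs) l) inE xF.
have [c cE] := fin_all_exists comp.
exists (fun s x => \sum_t c t s x *: j t x); split.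
  split=> [s|s sn x].
    by apply: section_sum => t _; have [sc _ _] := cE t; apply: scalar_hom_section (sc s) (sj t).
  by rewrite big1 // => t _; have [_ -> //] := cE t; rewrite scale0r.
move=> s x; rewrite /cochain_diff /cube_diff; case: ifPn => xF; last by have [-> //] := zs s.
rewrite -[RHS](jp x).
rewrite (eq_bigr (fun b => \sum_t (cube_sign k b s * c t (b |: s) x) *: j t x)); last first.
  by move=> b _; rewrite scaler_sumr; apply: eq_bigr => t _; rewrite scalerA.
rewrite exchange_big; apply: eq_bigr => t _.
by rewrite -scaler_suml; have [_ _ ->] := cE t.
Qed.

End Cochains.
End Kernels.

(** * Elementary modifications of an interval *)

Section Ops.
Context {d : Order.disp_t} (P : finPOrderType d).
Hypothesis treeP : tree_type P.
Local Open Scope order_scope.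
Notation cov x y := (covers y x).
Notation adj := (hasse_adj P).
Notation br := (branch adj).

Lemma siblings x y y' z : adj x y -> adj x y' -> y != y' ->
  z \in br x y -> z \notin br x y'.
Proof.
move=> xy xy' yy' zB; apply/negP => zB'.
have y'B : y' \notin br x y.
  apply/negP => h; have y'x : adj y' x by rewrite (adj_sym treeP).
  have [e _] := branch_cross treeP xy y'x h (branch_near treeP xy).
  by rewrite e eqxx in yy'.
have := subtree_cross treeP xy (subtree_branch treeP x y') zB' zB (branch_far _ _ _) y'B.
by rewrite (negbTE (branch_near treeP xy')).
Qed.

Variable J : {set P}.
Hypothesis cJ : subtree adj J.

(** An operation is an edge [(x, y)] directed away from [x], acting on the branch of
    [y]: growing adds the elements above [y] in that branch, cutting removes
    the elements below [y], which must be all of [J] there. *)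
Definition grow (a : P * P) : bool := [&& cov a.2 a.1, a.1 \in J & a.2 \notin J].
Definition cut (a : P * P) : bool :=
  [&& cov a.1 a.2, a.2 \in J & [forall z in br a.1 a.2, (z \in J) == (z <= a.2)]].

(** The edge [st], with [s] in [J], is an obstruction to [J] being the down-set of
    [s] beyond it. *)
Definition fails (s t : P) : bool :=
  (cov t s && (t \notin J)) || (cov s t && (t \in J)).

Lemma fails_adj s t : fails s t -> adj s t.
Proof. by rewrite adjE => /orP[/andP[-> _]|/andP[-> _]]; rewrite ?orbT. Qed.

Lemma find_fail (B : {set P}) v z : subtree adj B -> v \in B -> z \in B -> v \in J ->
  (z \in J) != (z <= v) ->
  exists s t, [/\ s \in J, s \in B, t \in B, fails s t & v \notin br s t].
Proof.
move=> cB vB zB vJ.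
(* If z is in J but not below v, take the edge where a path in J from v to z leaves
   the down-set of v; otherwise the edge where a chain from v down to z leaves J. *)
have [zJ|zJ] := boolP (z \in J) => zv.
  have nzv : z \notin [set w | w <= v] by rewrite inE; case: (z <= v) zv.
  have vv : v \in [set w | w <= v] by rewrite inE lexx.
  have vI : v \in J :&: B by rewrite inE vJ.
  have zI : z \in J :&: B by rewrite inE zJ.
  have [s [t [sI tI st]]] := subtree_exit (subtreeI treeP cJ cB) vI zI vv nzv.
  rewrite !inE in sI tI *; case/andP: sI => sJ sB; case/andP: tI => tJ tB sv tv.
  have stc : cov s t.
    move: (st); rewrite adjE => /orP[//|/cov_lt/ltW ts].
    by rewrite (le_trans ts sv) in tv.
  exists s, t; split=> //; first by rewrite /fails stc tJ orbT.
  apply/negP => vst.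
  have [_ tv' _] := le_cross' treeP st sv vst (branch_near treeP st).
  by rewrite tv' in tv.
have {}zv : z <= v by case: (z <= v) zv.
have vI : v \in [set w | z <= w <= v] :&: B by rewrite !inE zv lexx.
have zI : z \in [set w | z <= w <= v] :&: B by rewrite !inE zv lexx.
have [s [t [sI tI st sJ tJ]]] :=
  subtree_exit (subtreeI treeP (subtree_seg treeP z v) cB) vI zI vJ zJ.
rewrite !inE in sI tI; case/andP: sI => /andP[zs sv] sB.
case/andP: tI => /andP[zt tv] tB.
have ts : cov t s.
  move: (st); rewrite adjE => /orP[/cov_lt/ltW st'|//].
  by rewrite (subtree_convex treeP cJ sJ vJ) ?st' in tJ.
exists s, t; split=> //; first by rewrite /fails ts tJ.
apply/negP => vst.
have [st' _ _] := le_cross' treeP st sv vst (branch_near treeP st).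
by rewrite (cov_asym ts) in st'.
Qed.

Lemma find_fail_branch u v z : adj u v -> z \in br u v -> v \in J ->
  (z \in J) != (z <= v) ->
  exists s t, [/\ s \in J, s \in br u v, fails s t & br s t \subset br u v].
Proof.
move=> uv zB vJ zJ.
have [s [t [sJ sB tB st vst]]] :=
  find_fail (subtree_branch treeP u v) (branch_far _ u v) zB vJ zJ.
exists s, t; split=> //; have st' := fails_adj st.
apply: branch_sub => //; apply/negP => ust.
have [ut _] := branch_cross treeP st' uv ust vst.
by move: tB; rewrite -ut (negbTE (branch_near treeP uv)).
Qed.

(** An obstruction is either an edge where [J] can grow, or an upward edge inside
    [J]; in the second case [J] can be cut there unless there is an obstruction
    further away. *)
Lemma fail_op u v : u \in J -> fails u v ->
  exists a, (grow a || cut a) /\ br a.1 a.2 \subset br u v.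
Proof.
have [n] := ubnP #|br u v|; elim: n u v => // n IH u v le uJ f.
have uv := fails_adj f; case/orP: (f) => /andP[c vJ].
  by exists (u, v); split=> //; rewrite /grow /= c uJ vJ.
have [cu|ncu] := boolP (cut (u, v)); first by exists (u, v); rewrite cu orbT.
move: ncu; rewrite /cut /= c vJ /= negb_forall => /existsP[z].
rewrite negb_imply => /andP[zB zJ].
have [s [t [sJ sB st sub]]] := find_fail_branch uv zB vJ zJ.
have [|a [aop sub']] := IH s t _ sJ st; last first.
  by exists a; split=> //; apply: subset_trans sub.
rewrite ltnS in le; apply: leq_trans le; apply: proper_card.
apply/properP; split=> //; exists s => //; apply: branch_near => //.
exact: fails_adj.
Qed.

Definition principal (J : {set P}) : Prop := exists y, J = [set z | z <= y].
(** The part of the down-set of [y] on the side of [y] of an edge [x -> y].  At this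
    edge [J] could both grow and be cut away entirely, and nothing would survive all
    the operations. *)
Definition half_principal (J : {set P}) : Prop :=
  exists x y, [/\ cov x y, x \notin J & J = [set z in br x y | z <= y]].

Definition op : predArgType := {a : P * P | grow a || cut a}.

Implicit Types (a b c : op) (s : {set op}).

Definition near a : P := (val a).1.
Definition far a : P := (val a).2.
Definition region a : {set P} := br (near a) (far a).
Definition isgrow a : bool := grow (val a).

Lemma op_adj a : adj (near a) (far a).
Proof.
by have := valP a; rewrite adjE => /orP[/and3P[-> _ _]|/and3P[-> _ _]]; rewrite ?orbT.
Qed.

Lemma growP a : isgrow a -> [/\ cov (far a) (near a), near a \in J & far a \notin J].
Proof. by case/and3P. Qed.

Lemma cutP a : ~~ isgrow a -> [/\ cov (near a) (far a), far a \in J &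
  forall z, z \in region a -> (z \in J) = (z <= far a)].
Proof.
move=> ng; have := valP a; rewrite -/(isgrow a) (negbTE ng) /=.
case/and3P=> c f /forall_inP h; split=> // z zR; exact/eqP/h.
Qed.

Lemma grow_out a z : isgrow a -> z \in region a -> z \notin J.
Proof.
move=> /growP[_ nJ fJ] zR; apply/negP => zJ.
have := subtree_cross treeP (op_adj a) cJ zJ zR nJ (branch_near treeP (op_adj a)).
by rewrite (negbTE fJ) andbF.
Qed.

Lemma far_region a : far a \in region a. Proof. exact: branch_far. Qed.
Lemma near_region a : near a \notin region a.
Proof. exact: branch_near (op_adj a). Qed.

Hypothesis npr : ~ principal J.
Hypothesis nhv : ~ half_principal J.

Lemma near_in a : near a \in J.
Proof.
have [/growP[]//|/cutP[c fJ h]] := boolP (isgrow a).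
apply/negPn/negP => nJ; apply: nhv; exists (near a), (far a); split=> //.
apply/setP=> z; rewrite in_set; case: (boolP (z \in region a)) => zR /=.
  by rewrite h // zR.
apply/negbTE/negP => zJ.
have := subtree_cross treeP (op_adj a) cJ fJ (far_region a) zJ zR.
by rewrite (negbTE nJ).
Qed.

Lemma region_nested a b z : z \in region a -> z \in region b ->
  near a \notin region b -> near b \notin region a -> a = b.
Proof.
move=> za zb na nb.
have ab : region a = region b.
  have sub c c' : near c \notin region c' -> z \in region c -> z \in region c' ->
      region c' \subset region c.
    move=> nc zc zc'; apply/subsetP => w wc'; apply/negPn/negP => wc.
    have := subtree_cross treeP (op_adj c) (subtree_branch treeP _ _) zc' zc wc' wc.
    by rewrite -/(region c') (negbTE nc).
  by apply/eqP; rewrite eqEsubset !sub.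
have fa : far a \in region b by rewrite -ab far_region.
have adjfn : adj (far a) (near a) by rewrite (adj_sym treeP) op_adj.
have [e1 e2] := branch_cross treeP (op_adj b) adjfn fa na.
apply: val_inj; move: e1 e2; rewrite /near /far.
by case: (val a) => ? ?; case: (val b) => ? ? /= -> ->.
Qed.

(** If the near end of [a] lies in the region of a cutting [b], both operations cut
    towards the same far end, and the two regions cover the tree: then [J]
    is the down-set of that end. *)
Lemma region_near_cut a b : a != b -> near a \in region b -> ~~ isgrow b ->
  far b \in J -> False.
Proof.
move=> ab nab ngb fbJ; have [cb _ hb] := cutP ngb.
have nle : near a <= far b by rewrite -hb // near_in.
have nba : near b \notin region b := near_region b.
have [ga|nga] := boolP (isgrow a).
  have [ca _ faJ] := growP ga.
  have fab : far a \in region b.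
    apply/negPn/negP => fab.
    have [e1 e2] := branch_cross treeP (op_adj b) (op_adj a) nab fab.
    by move: faJ; rewrite e2 near_in.
  by move: faJ; rewrite hb // (le_trans (ltW (cov_lt ca)) nle).
have [ca faJ ha] := cutP nga.
have fab : far a \in region b.
  apply/negPn/negP => fab.
  have [e1 e2] := branch_cross treeP (op_adj b) (op_adj a) nab fab.
  by have := cov_asym ca; rewrite e1 e2 cb.
have fle : far a <= far b by rewrite -hb.
have fE : far a = far b.
  apply/eqP; apply/negPn/negP => fne.
  have flt : far a < far b by rewrite lt_neqAle fne.
  have [c cf cfb] := cov_above flt.
  have cna : c != near a.
    apply/eqP => e; have := cov_lt cf; rewrite e => h.
    by have := lt_trans h (cov_lt ca); rewrite ltxx.
  have cR : c \in region a.
    apply/negPn/negP => cR.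
    have [_ e] := branch_cross treeP (op_adj a) (cov_adj cf) (far_region a) cR.
    by rewrite e eqxx in cna.
  have cJ' : c \in J.
    by apply: (subtree_convex treeP cJ faJ fbJ); rewrite (ltW (cov_lt cf)).
  move: cJ'; rewrite ha // => cle.
  by have := lt_le_trans (cov_lt cf) cle; rewrite ltxx.
apply: npr; exists (far b); apply/setP=> z; rewrite in_set.
have [zb|zb] := boolP (z \in region b); first exact: hb.
suff zR : z \in region a by rewrite ha // fE.
have adjb : adj (far b) (near b) by rewrite (adj_sym treeP) op_adj.
have zb' : z \in br (far b) (near b) by rewrite branchC // op_adj.
apply/negPn/negP => zR.
have nbR : near b \in region a.
  apply/negPn/negP => nbR.
  have adj' : adj (far a) (near b) by rewrite fE.
  have [_ e] := branch_cross treeP (op_adj a) adj' (far_region a) nbR.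
  by rewrite e nab in nba.
have := subtree_cross treeP (op_adj a) (subtree_branch treeP (far b) (near b))
  (branch_far _ _ _) nbR zb' zR.
by case/andP=> _; rewrite fE (negbTE (branch_near treeP adjb)).
Qed.

Lemma region_disj a b z : a != b -> z \in region a -> z \notin region b.
Proof.
move=> ab za; apply/negP => zb.
have key c c' : c != c' -> near c \in region c' -> False.
  move=> cc' nc; have [g|ng] := boolP (isgrow c').
    by move: (grow_out g nc); rewrite near_in.
  by apply: (region_near_cut cc' nc ng); have [_] := cutP ng.
have [na|na] := boolP (near a \in region b); first exact: key ab na.
have [nb|nb] := boolP (near b \in region a).
  by apply: key nb; rewrite eq_sym.
by rewrite (region_nested za zb na nb) eqxx in ab.
Qed.

Lemma near_out a b : near a \notin region b.
Proof.
have [->|ab] := eqVneq a b; first exact: near_region.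
apply/negP => nab.
have fab := region_disj ab (far_region a).
have [e1 e2] := branch_cross treeP (op_adj b) (op_adj a) nab fab.
have [ga|nga] := boolP (isgrow a).
  by have [_ _] := growP ga; rewrite e2 near_in.
have [ca _ _] := cutP nga.
have [gb|ngb] := boolP (isgrow b).
  by have [_ _] := growP gb; rewrite -e1 near_in.
by have [cb _ _] := cutP ngb; have := cov_asym ca; rewrite e1 e2 cb.
Qed.

(** Apply [find_fail] on the near side of [a].  If [J] is there the down-set of the
    near end, then [J] is half principal when [a] grows and principal when [a]
    cuts. *)
Lemma op_other a : exists b, b != a.
Proof.
have uv : adj (far a) (near a) by rewrite (adj_sym treeP) op_adj.
have [z /andP[zB zJ]|none] :=
    pickP [pred z | (z \in br (far a) (near a)) && ((z \in J) != (z <= near a))].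
  have [s [t [sJ _ st sub]]] := find_fail_branch uv zB (near_in a) zJ.
  have [b [bop sub']] := fail_op sJ st.
  exists (Sub b bop); apply/eqP => e.
  have : far a \in br (far a) (near a).
    apply: (subsetP (subset_trans sub' sub)).
    by rewrite (_ : far a = b.2) ?branch_far // -e.
  by rewrite (negbTE (branch_near treeP uv)).
have {}none z : z \notin region a -> (z \in J) = (z <= near a).
  move=> zR; have := none z; rewrite /= branchC ?op_adj // zR /=.
  by move/negbFE/eqP.
exfalso; have [ga|nga] := boolP (isgrow a).
  have [ca nJ fJ] := growP ga; apply: nhv; exists (far a), (near a); split=> //.
  apply/setP=> z; rewrite in_set branchC ?op_adj //.
  have [zR|zR] := boolP (z \in region a) => /=.
    exact/negbTE/grow_out/zR.
  exact: none.
have [ca fJ ha] := cutP nga; apply: npr; exists (far a).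
apply/setP=> z; rewrite in_set; have [zR|zR] := boolP (z \in region a); first exact: ha.
rewrite none //; apply/idP/idP => zle; first exact: le_trans (ltW (cov_lt ca)).
by have [] := le_cross' treeP (op_adj a) zle (far_region a) zR.
Qed.

Hypothesis J0 : J != set0.

Lemma op_exists : exists a : op, true.
Proof.
have /set0Pn[u uJ] := J0.
have [z zJ|none] := pickP [pred z | (z \in J) != (z <= u)].
  have [s [t [sJ _ _ st _]]] := find_fail (subtreeT treeP) (in_setT u) (in_setT z) uJ zJ.
  by have [b [bop _]] := fail_op sJ st; exists (Sub b bop).
exfalso; apply: npr; exists u; apply/setP=> z; rewrite in_set.
by have := none z; move/negbFE/eqP.
Qed.

(** All the operations in [s] performed at once. *)
Definition modify s : {set P} :=
  [set z | [exists a in s, [&& isgrow a, z \in region a & far a <= z]]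
        || (z \in J) && [forall a in s, z \notin region a]].

Lemma modify_in a s z : a \in s -> z \in region a ->
  (z \in modify s) = isgrow a && (far a <= z).
Proof.
move=> as0 zR; rewrite in_set.
have -> : [forall a in s, z \notin region a] = false.
  by apply/negbTE; rewrite negb_forall; apply/existsP; exists a; rewrite as0 zR.
rewrite andbF orbF; apply/existsP/andP => [[b /and4P[bs gb zb fb]]|[ga fa]].
  have [<- //|ab] := eqVneq b a.
  by rewrite (negbTE (region_disj ab zb)) in zR.
by exists a; rewrite as0 ga zR fa.
Qed.

Lemma modify_out s z : (forall a, a \in s -> z \notin region a) ->
  (z \in modify s) = (z \in J).
Proof.
move=> h; rewrite in_set.
have -> : [forall a in s, z \notin region a] by apply/forall_inP.
rewrite andbT; case: existsP => // -[a /and4P[as0 _ zR _]].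
by rewrite (negbTE (h a as0)) in zR.
Qed.

Lemma modify_cases s z :
  (exists2 a, a \in s & z \in region a) \/ (forall a, a \in s -> z \notin region a).
Proof.
have [a /andP[as0 zR]|none] := pickP [pred a | (a \in s) && (z \in region a)].
  by left; exists a.
by right=> a as0; have := none a; rewrite /= as0 => /negbT.
Qed.

Lemma modifyU_out b s z : z \notin region b -> (z \in modify (b |: s)) = (z \in modify s).
Proof.
move=> zb; case: (modify_cases s z) => [[a as0 zR]|h].
  by rewrite !(modify_in _ zR) // !inE as0 orbT.
by rewrite !modify_out // => a; rewrite in_setU1 => /predU1P[->//|]; apply: h.
Qed.

Lemma modify_notin b s z : b \notin s -> z \in region b -> (z \in modify s) = (z \in J).
Proof.
move=> bs zb; apply: modify_out => a as0; apply: region_disj zb.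
by apply: contraNneq bs => ->.
Qed.

Lemma modifyU_in b s z : z \in region b ->
  (z \in modify (b |: s)) = isgrow b && (far b <= z).
Proof. by move=> zb; apply: modify_in; rewrite ?setU11. Qed.

Lemma near_modify a s : near a \in modify s.
Proof. by rewrite modify_out ?near_in // => b _; apply: near_out. Qed.

Lemma modify0 : modify set0 = J.
Proof. by apply/setP=> z; apply: modify_out => a; rewrite inE. Qed.

Lemma modify_cut b s z : b \in s -> ~~ isgrow b -> z \in modify s -> z \notin region b.
Proof. by move=> bs ngb; apply: contraL => zb; rewrite (modify_in bs zb) (negbTE ngb). Qed.

Lemma modify_new s z : z \in modify s -> z \notin J ->
  exists a, [/\ a \in s, isgrow a, z \in region a & far a <= z].
Proof.
move=> zm zJ; case: (modify_cases s z) => [[a as0 zR]|h].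
  by move: zm; rewrite (modify_in as0 zR) => /andP[ga fa]; exists a.
by rewrite modify_out ?(negbTE zJ) in zm.
Qed.

Lemma modify_lost s z : z \in J -> z \notin modify s ->
  exists b, [/\ b \in s, ~~ isgrow b & z \in region b].
Proof.
move=> zJ zm; case: (modify_cases s z) => [[b bs zR]|h].
  by exists b; split=> //; apply: contraL zJ => gb; apply: grow_out zR.
by rewrite modify_out ?zJ in zm.
Qed.

Lemma on_subset (S S' : {set P}) x y : S \subset S' ->
  connect (on adj S) x y -> connect (on adj S') x y.
Proof.
move=> /subsetP sub; apply: connect_impl => a b /and3P[/sub aS /sub bS ab].
by rewrite /on /= aS bS.
Qed.

(** The core, [J] minus the regions of [s], is an intersection of subtrees, and each
    added up-set is attached to it at the near end of its operation. *)
Lemma subtree_modify s : subtree adj (modify s).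
Proof.
have [->|[a0 a0s]] := set_0Vmem s; first by rewrite modify0.
pose core := [set z in J | [forall a in s, z \notin region a]].
have sub : core \subset modify s.
  apply/subsetP => z; rewrite in_set => /andP[zJ /forall_inP h].
  by rewrite modify_out.
have ccore : subtree adj core.
  pose G (o : option op) := if o is Some a then
    if a \in s then br (far a) (near a) else setT else J.
  apply: (@subtree_bigcap _ _ treeP _ G).
    move=> [a|] //=; case: ifP => _; [exact: subtree_branch|exact: subtreeT].
  move=> z; apply: (iffP idP); rewrite in_set.
    case/andP=> zJ /forall_inP h [a|] //=; case: ifP => as0; last by rewrite inE.
    by rewrite branchC ?op_adj // h.
  move=> h; rewrite (h None) /=; apply/forall_inP => a as0.
  by have := h (Some a); rewrite /= as0 branchC ?op_adj.
have nearc a : near a \in core.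
  by rewrite in_set near_in; apply/forall_inP => b _; apply: near_out.
apply: (subtree_from treeP (x := near a0)) => z zm.
have [zc|zc] := boolP (z \in core).
  by apply: on_subset sub _; apply: (subtreeP _ _ ccore) => //; apply: nearc.
have [zJ|zJ] := boolP (z \in J).
  have [b [bs _ zb]] : exists b, [/\ b \in s, ~~ isgrow b & z \in region b].
    move: zc; rewrite in_set zJ /= negb_forall => /existsP[b].
    rewrite negb_imply negbK => /andP[bs zb]; exists b; split=> //.
    by apply: contraL zJ => gb; apply: grow_out zb.
  case/negP: zc; exfalso; have := modify_in bs zb; rewrite zm => /esym/andP[gb _].
  by have := grow_out gb zb; rewrite zJ.
have [a [as0 ga zR fz]] := modify_new zm zJ; have [ca _ _] := growP ga.
apply: (connect_trans (y := near a)).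
  by apply: on_subset sub _; apply: (subtreeP _ _ ccore); apply: nearc.
have segm w : far a <= w <= z -> w \in modify s.
  case/andP=> fw wz; suff wR : w \in region a by rewrite (modify_in as0 wR) ga.
  apply/negPn/negP => wR.
  have [c _ _] := le_cross' treeP (op_adj a) wz zR wR.
  by rewrite (cov_asym ca) in c.
apply: (connect_trans (y := far a)); last exact: chain_on.
apply: connect1; rewrite /on /= near_modify op_adj segm //.
by rewrite lexx.
Qed.

Lemma modify_linked s b : b \notin s -> linked (modify s) (modify (b |: s)).
Proof.
move=> bs; apply/linkedP => u v uv; split.
  move=> um vm vm'; have [uR|uR] := boolP (u \in region b); last by rewrite modifyU_out.
  move: um; rewrite (modify_notin bs uR) => uJ.
  have ngb : ~~ isgrow b by apply: contraL uJ => gb; apply: grow_out uR.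
  have vR : v \notin region b by apply: modify_cut vm'; rewrite ?setU11.
  have [e1 e2] := branch_cross treeP (op_adj b) (cov_adj uv) uR vR.
  by have [c _ _] := cutP ngb; have := cov_asym c; rewrite -e1 -e2 uv.
move=> um um' vm'; have [vR|vR] := boolP (v \in region b); last by rewrite (modifyU_out _ vR) in vm'.
move: vm'; rewrite modifyU_in // => /andP[gb _].
have uR : u \notin region b.
  by apply: contraL um => uR; rewrite (modify_notin bs uR) (grow_out gb uR).
have [e1 e2] := branch_cross treeP (op_adj b) (cov_adj' uv) vR uR.
by have [c _ _] := growP gb; have := cov_asym c; rewrite -e1 -e2 uv.
Qed.

Lemma modify_nest s b : b \notin s ->
  (modify s \subset modify (b |: s)) || (modify (b |: s) \subset modify s).
Proof.
move=> bs; have [gb|ngb] := boolP (isgrow b); apply/orP; [left|right]; apply/subsetP => z zm.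
  have [zR|zR] := boolP (z \in region b); last by rewrite modifyU_out.
  by move: zm; rewrite (modify_notin bs zR) (negbTE (grow_out gb zR)).
have zR : z \notin region b by apply: modify_cut ngb zm; rewrite setU11.
by rewrite -(modifyU_out s zR).
Qed.

Lemma modify_conv s b c x : b \notin s -> c \notin s -> x \in modify s ->
  x \in modify (c |: (b |: s)) -> x \in modify (b |: s).
Proof.
move=> bs cs xm xm'; have [cb|cb] := eqVneq c b.
  by rewrite cb setUA setUid in xm'.
have [xR|xR] := boolP (x \in region c); last by rewrite (modifyU_out _ xR) in xm'.
by rewrite modifyU_out // (region_disj cb).
Qed.


(** The condition of [linked] at one edge. *)
Definition linked_edge (S X : {set P}) (u v : P) : bool :=
  ([&& u \in S, v \in S & v \in X] ==> (u \in X)) &&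
  ([&& u \in S, u \in X & v \in X] ==> (v \in S)).

Lemma meets_eq (S S' X : {set P}) :
  (forall u v : P, cov u v -> linked_edge S X u v = linked_edge S' X u v) ->
  (S :&: X == set0) = (S' :&: X == set0) -> meets S X = meets S' X.
Proof.
move=> h e; rewrite /meets e; congr (_ && _); rewrite /linked.
apply: eq_forallb => u; apply: eq_forallb => v.
by case c: (cov u v) => //=; apply: h.
Qed.

Local Notation neutral_op := (@neutral_op d P op modify).

(** If [X] contains the edge at which [J] grows, then beyond that edge both
    the old and the new interval meet [X] correctly. *)
Lemma neutral_grow a (X : {set P}) : subtree adj X -> isgrow a ->
  near a \in X -> far a \in X -> neutral_op a X.
Proof.
move=> cX ga nX fX s as0; have [ca nJ fJ] := growP ga.
apply: meets_eq => [u v uv|]; last first.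
  have n s' : modify s' :&: X == set0 = false.
    by apply/negbTE/set0Pn; exists (near a); rewrite inE near_modify.
  by rewrite !n.
have mU z : z \in region a -> (z \in modify s) = false.
  by move=> zR; rewrite (modify_notin as0 zR) (negbTE (grow_out ga zR)).
have mV z : z \in region a -> (z \in modify (a |: s)) = (far a <= z).
  by move=> zR; rewrite modifyU_in // ga.
have mO z : z \notin region a -> (z \in modify (a |: s)) = (z \in modify s).
  exact: modifyU_out.
have cross : u \notin region a -> v \in region a -> False.
  move=> uR vR; have [e1 e2] := branch_cross treeP (op_adj a) (cov_adj' uv) vR uR.
  by have := cov_asym ca; rewrite -e1 -e2 uv.
have [vR|vR] := boolP (v \in region a); have [uR|uR] := boolP (u \in region a).
- rewrite /linked_edge !mU // !mV //=; symmetry; apply/andP; split.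
    apply/implyP => /and3P[fu _ vX].
    by apply: (subtree_convex treeP cX fX vX); rewrite fu (ltW (cov_lt uv)).
  by apply/implyP => /and3P[fu _ _]; apply: le_trans fu (ltW (cov_lt uv)).
- by case: (cross uR vR).
- have [e1 e2] := branch_cross treeP (op_adj a) (cov_adj uv) uR vR.
  by rewrite /linked_edge e1 e2 !near_modify fX !implybT.
- by rewrite /linked_edge !mO.
Qed.

Lemma neutral_away a (X : {set P}) : (forall z, z \in X -> z \notin region a) ->
  (isgrow a -> near a \notin X) -> neutral_op a X.
Proof.
move=> XR nX s as0.
have mO z : z \in X -> (z \in modify (a |: s)) = (z \in modify s).
  by move=> /XR; apply: modifyU_out.
apply: meets_eq => [u v uv|]; last first.
  congr (_ == set0); apply/setP=> z; rewrite !in_setI andbC [RHS]andbC.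
  by case zX: (z \in X) => //=; rewrite mO.
rewrite /linked_edge; have [vX|vX] := boolP (v \in X); last by rewrite !andbF.
rewrite !andbT (mO v vX); have [uX|uX] := boolP (u \in X).
  by rewrite (mO u uX).
have [uR|uR] := boolP (u \in region a); last by rewrite modifyU_out.
have [e1 e2] := branch_cross treeP (op_adj a) (cov_adj uv) uR (XR v vX).
have [ga|nga] := boolP (isgrow a); first by rewrite -e2 vX in nX; have := nX ga.
by have [c _ _] := cutP nga; have := cov_asym c; rewrite -e1 -e2 uv.
Qed.

Lemma neutral_inside a b (X : {set P}) : b != a -> (forall z, z \in X -> z \in region a) ->
  neutral_op b X.
Proof.
move=> ba XR; apply: neutral_away => [z zX|_]; first by apply: (region_disj (a := a)); rewrite ?XR // eq_sym.
by apply/negP => /XR; rewrite (negbTE (near_out b a)).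
Qed.

(** After cutting at [b], an interval [X] that reaches into the region of [b] runs
    out of the modified interval along an upward edge. *)
Lemma cut_unlinked b s (X : {set P}) w q : subtree adj X -> b \in s -> ~~ isgrow b ->
  q \in X -> q \in modify s -> w \in X -> w \in region b -> ~~ linked (modify s) X.
Proof.
move=> cX bs ngb qX qm wX wR; have qR := modify_cut bs ngb qm.
have /andP[nX fX] := subtree_cross treeP (op_adj b) cX wX wR qX qR.
have [c _ _] := cutP ngb; apply/negP => /linkedP /(_ _ _ c)[_ h].
have := h (near_modify _ _) nX fX.
by rewrite (modify_in bs (far_region b)) (negbTE ngb).
Qed.

Lemma neutral_never (X : {set P}) :
  (forall s q, q \in X -> q \in modify s -> ~~ linked (modify s) X) ->
  exists a, neutral_op a X.
Proof.
move=> h; have [a _] := op_exists; exists a => s _.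
have n s' : meets (modify s') X = false.
  apply/negbTE/negP => /andP[l /set0Pn[q]]; rewrite inE => /andP[qm qX].
  by have := h _ _ qX qm; rewrite l.
by rewrite !n.
Qed.

(** If [X] misses [J], it meets the cube only inside the region of one growing
    operation, and any other one is neutral.  Otherwise, consider an edge where [X] and
    [J] part.  If [J] can grow along it, that operation is neutral; if [X] leaves
    [J] upwards, or [J] leaves [X] downwards, there is no map from the cube to [X]
    at all; if [J] leaves [X] upwards, there is an operation beyond that edge, away
    from [X]. *)
Lemma neutral_exists (X : {set P}) : subtree adj X -> X != J -> exists a, neutral_op a X.
Proof.
move=> cX XJ.
have [/eqP XJ0|] := boolP (X :&: J == set0).
  have XnJ z : z \in X -> z \notin J.
    move=> zX; apply/negP => zJ; have := in_set0 z; rewrite -XJ0 inE zX zJ //.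
  have [/existsP[s /existsP[q /andP[qX qm]]]|none] :=
      boolP [exists s : {set op}, exists q, (q \in X) && (q \in modify s)]; last first.
    apply: neutral_never => s q qX qm; case/negP: none.
    by apply/existsP; exists s; apply/existsP; exists q; rewrite qX.
  have [a [as0 ga qR _]] := modify_new qm (XnJ q qX).
  have [b ba] := op_other a; exists b; apply: (neutral_inside ba) => z zX.
  apply/negPn/negP => zR.
  have /andP[nX _] := subtree_cross treeP (op_adj a) cX qX qR zX zR.
  by have := XnJ _ nX; rewrite near_in.
case/set0Pn=> p; rewrite inE => /andP[pX pJ].
have [a /and3P[ga nX fX]|nogrow] :=
    pickP [pred a : op | [&& isgrow a, near a \in X & far a \in X]].
  by exists a; apply: neutral_grow.
have nogrow' u v : cov v u -> u \in X -> u \in J -> v \in X -> v \in J.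
  move=> vu uX uJ vX; apply/negPn/negP => vJ.
  have ga : grow (u, v) by rewrite /grow /= vu uJ.
  have gop : grow (u, v) || cut (u, v) by rewrite ga.
  by have := nogrow (Sub (u, v) gop); rewrite /= /isgrow /near /far /= ga uX vX.
have [/subsetP XsJ|] := boolP (X \subset J); last first.
  case/subsetPn=> t0 t0X t0J.
  have [s [t [sX tX st sJ tJ]]] := subtree_exit cX pX t0X pJ t0J.
  have stc : cov s t.
    move: (st); rewrite adjE => /orP[//|ts].
    by rewrite (nogrow' s t ts) in tJ.
  apply: neutral_never => r q qX qm; apply/negP => l.
  have tm : t \notin modify r.
    apply/negP => tm; have [a [_ ga tR _]] := modify_new tm tJ.
    have sR : s \notin region a by apply: contraL sJ; apply: grow_out.
    have [c _ _] := growP ga.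
    have [e1 e2] := branch_cross treeP (op_adj a) (cov_adj' stc) tR sR.
    by have := cov_asym c; rewrite -e1 -e2 stc.
  have [sm|sm] := boolP (s \in modify r).
    by have /linkedP/(_ _ _ stc)[_ h] := l; rewrite h in tm.
  have [b [br' ngb sR]] := modify_lost sJ sm.
  by move: l; apply/negP; apply: (cut_unlinked cX br' ngb qX qm sX sR).
have [z zJ zX] : exists2 z, z \in J & z \notin X.
  by apply/subsetPn; apply: contra XJ => h; rewrite eqEsubset h andbT; apply/subsetP.
have [s [t [sJ tJ st sX tX]]] := subtree_exit cJ pJ zJ pX zX.
move: (st); rewrite adjE => /orP[stc|tsc].
  have f : fails s t by rewrite /fails stc tJ orbT.
  have [a0 [aop sub]] := fail_op sJ f; pose a : op := Sub a0 aop.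
  have sub' : region a \subset br s t by [].
  have Xbr w : w \in X -> w \notin br s t.
    move=> wX; apply/negP => wB.
    have := subtree_cross treeP st cX wX wB sX (branch_near treeP st).
    by rewrite (negbTE tX) andbF.
  exists a; apply: neutral_away => [w /Xbr|ga].
    by apply: contra; apply: (subsetP sub').
  apply/negP => nX; have [_ _ fJ] := growP ga.
  have fB : far a \in br s t by apply: (subsetP sub'); apply: far_region.
  have adjfn : adj (far a) (near a) by rewrite (adj_sym treeP) op_adj.
  have [e1 _] := branch_cross treeP st adjfn fB (Xbr _ nX).
  by rewrite e1 tJ in fJ.
apply: neutral_never => r q qX qm; apply/negP => l.
have [sm|sm] := boolP (s \in modify r); last first.
  have [b [br' ngb sR]] := modify_lost sJ sm.
  by move: l; apply/negP; apply: (cut_unlinked cX br' ngb qX qm sX sR).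
have [tm|tm] := boolP (t \in modify r).
  by have /linkedP/(_ _ _ tsc)[h _] := l; rewrite h in tX.
have [b [br' ngb tR]] := modify_lost tJ tm.
have [c _ _] := cutP ngb; have sR := modify_cut br' ngb sm.
have [e1 e2] := branch_cross treeP (op_adj b) (cov_adj tsc) tR sR.
by have := cov_asym c; rewrite -e1 -e2 tsc.
Qed.

Lemma modify_unlinked s : s != set0 -> ~~ linked (modify s) J.
Proof.
case/set0Pn=> a as0; have [ga|nga] := boolP (isgrow a).
  have [c nJ fJ] := growP ga; apply/negP => /linkedP/(_ _ _ c)[h _].
  by rewrite h ?near_modify // (modify_in as0 (far_region a)) ga lexx in fJ.
have [c fJ _] := cutP nga; apply/negP => /linkedP/(_ _ _ c)[_ h].
have := h (near_modify _ _) (near_in _) fJ.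
by rewrite (modify_in as0 (far_region a)) (negbTE nga).
Qed.

Section Top.
Variables (k : fieldType) (N : rep k P).
Local Open Scope ring_scope.

Lemma setCU a : setT = a |: ~: [set a].
Proof. by apply/setP=> b; rewrite !inE orbN. Qed.

Lemma modify_setT z : z \in modify setT -> exists a, z \in modify (~: [set a]).
Proof.
move=> zm; have [a _] := op_exists.
have out b : z \notin region b -> z \in modify (~: [set b]).
  by move=> zR; rewrite -(modifyU_out _ zR) -setCU.
have [zR|zR] := boolP (z \in region a); last by exists a; apply: out.
have [b ba] := op_other a; exists b; apply: out.
by apply: region_disj zR; rewrite eq_sym.
Qed.

Lemma setC2 a b : a != b -> ~: [set a] = b |: ~: [set a; b].
Proof.
move=> ab; apply/setP=> c; rewrite !inE negb_or.
by case: (c =P b) => [->|_]; rewrite ?andbT // eq_sym ab.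
Qed.

(** The right end of the cube is right exact as a complex of modules.  In top
    degree, the intervals one step below cover the last one.  One degree lower, a cocycle
    is a family of sections over those intervals that agree on overlaps up
    to sign, so it glues to a section over the last one. *)
Lemma exact_top n : (#|op| <= n.+1)%N -> @exact_at k d P op modify N n.
Proof.
move=> le z [zs zn] z0.
have [lt|ge] := ltnP #|op| n.
  exists (fun _ _ => 0); split; first by split=> [s|//]; apply: section0.
  move=> s x; rewrite zn.
    by rewrite /cochain_diff /cube_diff; case: ifP => // _; rewrite big1 // => b _; rewrite scaler0.
  by rewrite neq_ltn (leq_ltn_trans (max_card _) lt).
have bdT a x : cochain_diff modify z (~: [set a]) x =
   if x \in modify (~: [set a]) then cube_sign k a (~: [set a]) *: z setT x else 0.
  rewrite /cochain_diff /cube_diff; case: ifP => // _.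
  rewrite (eq_bigl (pred1 a)) ?big_pred1_eq -?setCU // => b.
  by rewrite !inE negbK.
have sg0 a s : cube_sign k a s != 0.
  by apply/eqP => e; have := cube_sign_sqr k a s; rewrite e mul0r => /esym/eqP; rewrite oner_eq0.
have [e|ne] := eqVneq n #|op|.
  exists (fun _ _ => 0); split; first by split=> [s|//]; apply: section0.
  move=> s x; transitivity (0 : N x).
    by rewrite /cochain_diff /cube_diff; case: ifP => // _; rewrite big1 // => b _; rewrite scaler0.
  have [->|sT] := eqVneq s setT; last first.
    rewrite zn // e -cardsT; apply: contra sT => /eqP h.
    by rewrite eqEcard subsetT h leqnn.
  have [xm|xm] := boolP (x \in modify setT); last by have [-> //] := zs setT.
  have [a xa] := modify_setT xm; have := z0 (~: [set a]) x.
  rewrite bdT xa => /eqP; rewrite scaler_eq0 (negbTE (sg0 _ _)) /=.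
  by move/eqP.
have en : n.+1 = #|op| by apply/eqP; rewrite eqn_leq le andbT ltn_neqAle ne ge.
(* The cocycle condition at the vertices of codimension 2. *)
have comp a b x : a != b -> x \in modify (~: [set a; b]) ->
    cube_sign k b (~: [set a; b]) *: z (~: [set a]) x
    = - (cube_sign k a (~: [set a; b]) *: z (~: [set b]) x).
  move=> ab xm; apply/eqP; rewrite -addr_eq0; apply/eqP.
  have := z0 (~: [set a; b]) x; rewrite /cochain_diff /cube_diff xm => <-.
  have ba : b != a by rewrite eq_sym.
  rewrite (bigD1 b) ?inE ?eqxx ?orbT //= (bigD1 a) ?inE ?eqxx //= big1 ?addr0.
    by rewrite -setC2 // setUC -setC2.
  by move=> c; rewrite !inE negbK => /andP[/andP[/orP[]/eqP-> ]]; rewrite eqxx ?andbF.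
pose y a x := cube_sign k a (~: [set a]) *: z (~: [set a]) x.
have inab a b x : a != b -> x \notin region a -> x \notin region b ->
    (x \in modify (~: [set a; b])) = (x \in modify setT).
  move=> ab xa xb; rewrite [in RHS](setCU a) modifyU_out // [in RHS](setC2 ab).
  by rewrite modifyU_out.
(* Outside the last interval there is nothing to glue with, so z vanishes. *)
have lost a x : x \in modify (~: [set a]) -> x \notin modify setT -> z (~: [set a]) x = 0.
  move=> xa xT; have xR : x \in region a.
    by apply/negPn/negP => xR; move: xT; rewrite (setCU a) modifyU_out // xa.
  have [b ba] := op_other a; have ab : a != b by rewrite eq_sym.
  have xb : x \notin region b by apply: region_disj xR.
  have xm : x \in modify (~: [set a; b]) by rewrite -(modifyU_out _ xb) -setC2.
  have xnb : x \notin modify (~: [set b]).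
    by rewrite -(modifyU_out _ xb) -setCU.
  have := comp a b x ab xm; have [-> // _] := zs (~: [set b]).
  rewrite scaler0 oppr0 => /eqP; rewrite scaler_eq0 (negbTE (sg0 _ _)) /=.
  by move/eqP.
have yy a b x : x \in modify (~: [set a]) -> x \in modify (~: [set b]) ->
    x \in modify setT -> y a x = y b x.
  have [-> //|ab] := eqVneq a b; move=> xa xb xT.
  have nin c c' : c != c' -> x \in modify (~: [set c]) -> x \in modify (~: [set c']) ->
      x \notin region c.
    move=> cc' xc xc'; apply/negP => xR.
    have cs : c \in ~: [set c'] by rewrite !inE.
    have cs' : c \notin ~: [set c] by rewrite !inE eqxx.
    have [gc|ngc] := boolP (isgrow c).
      by move: xc; rewrite (modify_notin cs' xR) (negbTE (grow_out gc xR)).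
    by move: (modify_cut cs ngc xc'); rewrite xR.
  have ba : b != a by rewrite eq_sym.
  have xaR := nin a b ab xa xb; have xbR := nin b a ba xb xa.
  have xm : x \in modify (~: [set a; b]) by rewrite inab.
  have h := comp a b x ab xm; rewrite /y.
  have Ea := setC2 ab.
  have Eb : ~: [set b] = a |: ~: [set a; b] by rewrite (setC2 ba) (setUC [set b]).
  have aS : a \notin ~: [set a; b] by rewrite !inE eqxx.
  have bS : b \notin ~: [set a; b] by rewrite !inE eqxx orbT.
  have sC := cube_signC k ab aS bS; rewrite -Ea -Eb in sC.
  have -> : z (~: [set a]) x = - ((cube_sign k b (~: [set a; b]) *
      cube_sign k a (~: [set a; b])) *: z (~: [set b]) x).
    by rewrite -scalerA -scalerN -h scalerA cube_sign_sqr scale1r.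
  rewrite scalerN scalerA -scaleNr; congr (_ *: _).
  transitivity (cube_sign k a (~: [set a; b]) *
      (cube_sign k a (~: [set a; b]) * cube_sign k b (~: [set b]))).
    by rewrite sC mulrN [in RHS]mulrA [in RHS]mulrC [_ * cube_sign k b _ in RHS]mulrC.
  by rewrite mulrA cube_sign_sqr mul1r.
(* The glued section. *)
pose wT x := if x \in modify setT then
  (if [pick a | x \in modify (~: [set a])] is Some a then y a x else 0) else 0.
have wTE a x : x \in modify setT -> x \in modify (~: [set a]) -> wT x = y a x.
  move=> xT xa; rewrite /wT xT; case: pickP => [b xb|/(_ a)]; last by rewrite xa.
  exact: yy.
have wT0 x : x \notin modify setT -> wT x = 0 by rewrite /wT => /negbTE->.
have swT : is_section (modify setT) wT.
  split=> // x x' xx' xT; have [a xa] := modify_setT xT.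
  have [za0 za1] := zs (~: [set a]).
  rewrite (wTE a) // /y linearZ /= za1 //.
  have [x'T|x'T] := boolP (x' \in modify setT); last first.
    rewrite wT0 //; have [x'a|x'a] := boolP (x' \in modify (~: [set a])).
      by rewrite lost ?scaler0.
    by rewrite za0 ?scaler0.
  have [x'a|x'a] := boolP (x' \in modify (~: [set a])); first by rewrite (wTE a).
  exfalso; have x'R : x' \in region a.
    by apply/negPn/negP => h; move: x'a; rewrite -(modifyU_out _ h) -setCU x'T.
  have [ga|nga] := boolP (isgrow a); last first.
    by have := modify_cut (in_setT a) nga x'T; rewrite x'R.
  have aa : a \notin ~: [set a] by rewrite !inE eqxx.
  have xR : x \notin region a.
    by apply/negP => h; move: xa; rewrite (modify_notin aa h) (negbTE (grow_out ga h)).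
  have [c _ _] := le_cross' treeP (op_adj a) xx' x'R xR.
  by have [c' _ _] := growP ga; rewrite (cov_asym c') in c.
exists (fun s x => if s == setT then wT x else 0); split.
  split=> [s|s sn x]; first by case: eqP => [->|_] //; apply: section0.
  by case: eqP => // sT; rewrite sT cardsT en eqxx in sn.
move=> s x; have [sn|sn] := eqVneq #|s| n; last first.
  rewrite zn // /cochain_diff /cube_diff; case: ifP => // _; rewrite big1 // => b bs.
  case: eqP => [e|_]; last by rewrite scaler0.
  have : #|b |: s| = #|op| by rewrite e cardsT.
  by rewrite cardsU1 bs add1n -en => -[e']; rewrite e' eqxx in sn.
have /cards1P[a sa] : #|~: s| == 1%N.
  by have := cardsC s; rewrite sn -en -addn1 => /addnI ->.
have {sa sn}-> : s = ~: [set a] by rewrite -sa setCK.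
have aa : a \notin ~: [set a] by rewrite !inE eqxx.
have [xa|xa] := boolP (x \in modify (~: [set a])); last first.
  by rewrite /cochain_diff /cube_diff (negbTE xa); have [-> //] := zs (~: [set a]).
rewrite /cochain_diff /cube_diff xa (bigD1 a) //= big1 => [|b]; last first.
  by rewrite !inE negbK => /andP[->].
rewrite -setCU eqxx addr0; have [xT|xT] := boolP (x \in modify setT).
  by rewrite (wTE a) // /y scalerA cube_sign_sqr scale1r.
by rewrite wT0 // lost // scaler0.
Qed.
End Top.
End Ops.

(** * Counting operations, and the exceptional intervals *)

Section Leaves.
Context {d : Order.disp_t} (P : finPOrderType d).
Hypothesis treeP : tree_type P.
Local Open Scope order_scope.
Notation cov x y := (covers y x).
Notation adj := (hasse_adj P).
Notation br := (branch adj).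

Lemma leafE (x : P) : (x \in leaf P) = deg1 adj x.
Proof.
rewrite /leaf /deg1 inE; congr (_ == _).
pose f (a : P * P) := if a.1 == x then a.2 else a.1.
have covxx (y : P) : cov y y = false by apply/negP => /cov_lt; rewrite ltxx.
rewrite -(@card_in_imset _ _ f); last first.
  move=> [a b] [a' b']; rewrite !inE /f /=.
  case/andP=> c1 /orP[]/eqP e1 /andP[c2 /orP[]/eqP e2]; subst; rewrite ?eqxx.
  - by move=> ->.
  - case: eqP => e; first by move: c2; rewrite e covxx.
    by move=> e'; subst; have := cov_asym c1; rewrite c2.
  - case: eqP => e; first by move: c1; rewrite e covxx.
    by move=> e'; subst; have := cov_asym c1; rewrite c2.
  - case: eqP => e; first by move: c1; rewrite e covxx.
    by case: eqP => e2; [move: c2; rewrite e2 covxx|move=> ->].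
congr #|pred_of_set _|; apply/setP=> y; rewrite [RHS]inE adjE.
apply/imsetP/idP => [[[a b]]|/orP[] c].
- rewrite !inE /f /= => /andP[c /orP[]/eqP e ->]; subst.
    by rewrite eqxx c.
  by case: eqP => [e|_]; [move: c; rewrite e covxx|rewrite c orbT].
- by exists (x, y); rewrite ?inE /f /= ?eqxx ?c.
exists (y, x); rewrite ?inE /f /= ?eqxx ?c ?orbT //.
by case: eqP => // e; move: c; rewrite e covxx.
Qed.

Lemma branch_leaf x y : adj x y -> exists2 z, z \in br x y & z \in leaf P.
Proof. by move=> xy; have [z zB z1] := branch_deg1 treeP xy; exists z; rewrite ?leafE. Qed.

(** The regions are disjoint branches, and every branch contains a leaf. *)
Lemma card_op (J : {set P}) : subtree adj J -> ~ principal J -> ~ half_principal J ->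
  (#|op J| <= #|leaf P|)%N.
Proof.
move=> cJ npr nhv.
have ex (a : op J) : exists z, z \in region a /\ z \in leaf P.
  by have [z zB zl] := branch_leaf (op_adj a); exists z.
have [f fE] := fin_all_exists ex.
have inj : injective f.
  move=> a b fab; apply/eqP/negPn/negP => ab.
  have [fa _] := fE a; have [fb _] := fE b; rewrite fab in fa.
  by have := region_disj treeP cJ npr nhv ab fa; rewrite fb.
rewrite -(card_imset predT inj); apply: subset_leq_card.
by apply/subsetP => z /imsetP[a _ ->]; have [] := fE a.
Qed.

Lemma leaf_ge2 : (2 <= #|P|)%N -> (2 <= #|leaf P|)%N.
Proof.
move=> /card_gt1P[x [y [_ _ xy]]].
have [z xz] : exists z, adj x z.
  have [_ _ /(_ x y) /connectP[[|z p] /= pp e] _] := treeP.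
    by rewrite e eqxx in xy.
  by case/andP: pp; exists z.
have [l lB lL] := branch_leaf xz.
have [l' lB' lL'] : exists2 l', l' \in br z x & l' \in leaf P.
  by apply: branch_leaf; rewrite (adj_sym treeP).
apply/card_gt1P; exists l, l'; split=> //.
by apply: contraTneq lB => ->; rewrite -branchC.
Qed.

Lemma subtree_down (y : P) : subtree adj [set z | z <= y].
Proof.
apply: (subtree_from treeP (x := y)) => z; rewrite inE => zy.
by rewrite (on_sym treeP); apply: chain_on => // w /andP[_ wy]; rewrite inE.
Qed.

Lemma subtree_up (y : P) : subtree adj [set z | y <= z].
Proof.
apply: (subtree_from treeP (x := y)) => z; rewrite inE => zy.
by apply: chain_on => // w /andP[wy _]; rewrite inE.
Qed.

Lemma cov_below (x y : P) : x < y -> exists2 z, cov z y & x <= z.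
Proof.
move=> xy; have [p pp pl] := le_path (ltW xy).
case/lastP: p => [|p z] in pp pl *; first by move: xy; rewrite -pl /= ltxx.
rewrite last_rcons in pl; subst z; move: pp; rewrite rcons_path => /andP[pp c].
exists (last x p) => //; have := cov_path_le pp (mem_head x p).
by rewrite inE => /andP[].
Qed.

Lemma principal_step (x y : P) : cov x y ->
  linked [set z | z <= y] [set z | z <= x] /\ ~~ linked [set z | z <= x] [set z | z <= y].
Proof.
move=> xy; have lt := cov_lt xy; split.
  apply/linkedP => u v /cov_lt/ltW uv; rewrite !inE; split=> [_ _|_ _] vx.
    exact: le_trans vx.
  exact: le_trans vx (ltW lt).
apply/linkedP => /(_ _ _ xy)[_]; rewrite !inE !lexx (ltW lt) => /(_ isT isT isT).
by move/(lt_le_trans lt); rewrite ltxx.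
Qed.

(** I_J is the injective hull of the simple module at [y]: a nonzero map to an
    interval module that is nonzero at [y] is an isomorphism. *)
Lemma downset_only (y : P) (X : {set P}) : subtree adj X ->
  linked [set z | z <= y] X -> y \in X -> X = [set z | z <= y].
Proof.
move=> cX l yX; have cJ := subtree_down y.
have yJ : y \in [set z | z <= y] by rewrite inE.
apply/eqP; rewrite eqEsubset; apply/andP; split; last first.
  apply/subsetP => u uJ; apply: (linked_down treeP cJ l _ uJ yJ yX).
  by move: uJ; rewrite inE.
apply/negPn/negP => /subsetPn[w wX wJ].
have [s [t [sX tX st sJ tJ]]] := subtree_exit cX yX wX yJ wJ.
move: st; rewrite adjE => /orP[st|/cov_lt/ltW ts].
  by move/linkedP: l => /(_ _ _ st)[_ h]; rewrite h in tJ.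
by move: sJ tJ; rewrite !inE => /(le_trans ts) ->.
Qed.

Section Halved.
Variables (x y : P).
Hypothesis xy : cov x y.
Let J : {set P} := [set z in br x y | z <= y].
Let N : {set P} := [set z in br y x | x <= z].
Let axy : adj x y := cov_adj xy.
Let ayx : adj y x := cov_adj' xy.

Lemma subtree_half_down : subtree adj J.
Proof.
have -> : J = br x y :&: [set z | z <= y] by apply/setP=> z; rewrite !in_set.
by apply: subtreeI => //; [apply: subtree_branch|apply: subtree_down].
Qed.

Lemma subtree_half_up : subtree adj N.
Proof.
have -> : N = br y x :&: [set z | x <= z] by apply/setP=> z; rewrite !in_set.
by apply: subtreeI => //; [apply: subtree_branch|apply: subtree_up].
Qed.

Let JE z : (z \in J) = (z \in br x y) && (z <= y). Proof. by rewrite in_set. Qed.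
Let NE z : (z \in N) = (z \in br y x) && (x <= z). Proof. by rewrite in_set. Qed.
Let yJ : y \in J. Proof. by rewrite in_set branch_far lexx. Qed.
Let xN : x \in N. Proof. by rewrite in_set branch_far lexx. Qed.
Let JR z : z \in J -> z \in br x y. Proof. by rewrite in_set => /andP[]. Qed.
Let NR z : z \in N -> z \notin br x y.
Proof. by rewrite in_set branchC // => /andP[]. Qed.
Let JNR z : z \in br x y -> (z \in J :|: N) = (z \in J).
Proof.
move=> zR; rewrite in_setU; case zN: (z \in N); last by rewrite orbF.
by have := NR zN; rewrite zR.
Qed.
Let JNR' z : z \notin br x y -> (z \in J :|: N) = (z \in N).
Proof.
move=> zR; rewrite in_setU; case zJ: (z \in J) => //.
by have := JR zJ; rewrite (negbTE zR).
Qed.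

Lemma subtree_halves : subtree adj (J :|: N).
Proof.
have sJ : J \subset J :|: N by apply: subsetUl.
have sN : N \subset J :|: N by apply: subsetUr.
apply: (subtree_from treeP (x := y)) => z; rewrite in_setU => /orP[zJ|zN].
  by apply: on_subset sJ _; apply: (subtreeP _ _ subtree_half_down).
apply: (connect_trans (y := x)).
  by apply: connect1; rewrite /on /= !in_setU yJ xN orbT.
by apply: on_subset sN _; apply: (subtreeP _ _ subtree_half_up).
Qed.

Let cross u v : cov u v -> u \in br x y -> v \notin br x y -> False.
Proof.
move=> uv uR vR; have [e1 e2] := branch_cross treeP axy (cov_adj uv) uR vR.
by have := cov_asym xy; rewrite -e1 -e2 uv.
Qed.

Let cross' u v : cov u v -> u \notin br x y -> v \in br x y -> u = x /\ v = y.
Proof.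
by move=> uv uR vR; have [-> ->] := branch_cross treeP axy (cov_adj' uv) vR uR.
Qed.

Lemma halves_step : linked J (J :|: N) /\ ~~ linked (J :|: N) J.
Proof.
split.
  apply/linkedP => u v uv; split; first by move=> uJ _ _; rewrite in_setU uJ.
  move=> uJ _ vJN; have [vR|vR] := boolP (v \in br x y); first by rewrite -JNR.
  by case: (cross uv (JR uJ) vR).
apply/linkedP => /(_ _ _ xy)[h _].
have : x \in J by apply: h; rewrite ?in_setU ?xN ?yJ ?orbT.
by move/JR; rewrite (negbTE (branch_near treeP axy)).
Qed.

Lemma halves_to_upper : linked (J :|: N) N.
Proof.
apply/linkedP => u v uv; split; last by move=> _ _ vN; rewrite in_setU vN orbT.
move=> uJN _ vN; have [uR|uR] := boolP (u \in br x y); last by rewrite -JNR'.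
by case: (cross uv uR (NR vN)).
Qed.

(** Maps from I_J to the other interval modules extend along the monomorphism
    from I_J to the interval module of [J :|: N]. *)
Lemma halves_extend (X : {set P}) q : subtree adj X -> X != J -> linked J X ->
  q \in J -> q \in X -> linked (J :|: N) X.
Proof.
move=> cX XJ l qJ qX; have qR := JR qJ.
have cJ := subtree_half_down.
have mem_xy z : z \in X -> z \notin br x y -> (x \in X) && (y \in X).
  by move=> zX zR; apply: (subtree_cross treeP axy cX qX qR zX zR).
have yXx : y \in X -> x \in X.
  move=> yX; apply/negPn/negP => xX.
  have XR z : z \in X -> z \in br x y.
    move=> zX; apply/negPn/negP => zR; have := mem_xy z zX zR.
    by rewrite (negbTE xX).
  case/negP: XJ; rewrite eqEsubset; apply/andP; split; last first.
    apply/subsetP => u uJ; apply: (linked_down treeP cJ l _ uJ yJ yX).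
    by move: uJ; rewrite in_set => /andP[].
  apply/negPn/negP => /subsetPn[w wX wJ].
  have [s [t [sX tX st sJ tJ]]] := subtree_exit cX yX wX yJ wJ.
  move: st; rewrite adjE => /orP[st|/cov_lt/ltW ts].
    by move/linkedP: l => /(_ _ _ st)[_ h]; rewrite h in tJ.
  move: sJ tJ; rewrite !JE (XR t tX) => /andP[_ sy].
  by rewrite (le_trans ts sy).
have /linkedP lP := l.
apply/linkedP => u v uv; have [h1 h2] := lP _ _ uv.
have [uR|uR] := boolP (u \in br x y); have [vR|vR] := boolP (v \in br x y).
- by rewrite !JNR.
- by case: (cross uv uR vR).
- have [-> ->] := cross' uv uR vR; split=> [_ _|_ _ _]; first exact: yXx.
  by rewrite in_setU yJ.
- rewrite !JNR' //; split.
    move=> uN vN vX; have /andP[xX _] := mem_xy v vX vR.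
    apply: (subtree_convex treeP cX xX vX); rewrite (ltW (cov_lt uv)) andbT.
    by move: uN; rewrite in_set => /andP[].
  rewrite !NE => /andP[_ xu] _ _; rewrite branchC // vR.
  exact: le_trans xu (ltW (cov_lt uv)).
Qed.

End Halved.
End Leaves.

(** * The upper bound *)

Section Upper.
Context (k : fieldType) {d : Order.disp_t} (P : finPOrderType d).
Hypothesis treeP : tree_type P.
Local Open Scope ring_scope.
Notation rep := (rep k P).
Notation cov x y := (covers y x).
Notation adj := (hasse_adj P).
Notation br := (branch adj).

Lemma ker_incl_kernel (V N : rep) (f : hom V N) : is_kernel (ker_incl f) f.
Proof.
have iE x (u : subvs_of (lker (f x))) : ker_incl f x u = vsval u by rewrite /= lfunE.
split=> x; apply/eqP.
  by apply/lker0P => u v; rewrite !iE => /subvs_inj.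
rewrite eqEsubv; apply/andP; split; apply/subvP => v.
  by case/memv_imgP => u _ ->; rewrite iE subvsP.
move=> vk; apply/memv_imgP; exists (vsproj (lker (f x)) v); rewrite ?memvf //.
by rewrite iE vsprojK.
Qed.

Definition syzygy (M : rep) (V : interval_resolution M) (n : nat) : rep :=
  match n with
  | 0 => M
  | 1 => ker (res_aug V)
  | n'.+2 => ker (res_diff V n')
  end.

(** The resolution factors [f] through a cover [psi] of the previous syzygy; both have
    the same kernel. *)
Lemma kernel_comp (K V W N : rep) (i : hom K V) (f : hom V W) (psi : hom V N) (j : hom N W) :
  is_kernel i f -> (forall x, lker (j x) = 0%VS) ->
  (forall x, f x = (j x \o psi x)%VF) -> is_kernel i psi.
Proof.
move=> [i0 iE] j0 fE; split=> // x; rewrite iE; apply/vspaceP => v.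
rewrite !memv_ker fE comp_lfunE -[0 in LHS](linear0 (j x)).
by apply/eqP/eqP => [/(lker0P (introT eqP (j0 x)))|->].
Qed.

Lemma syzygy_cover (M : rep) (V : interval_resolution M) n :
  exists phi : hom (V n) (syzygy V n), interval_cover phi /\
    exists i : hom (syzygy V n.+1) (V n), is_kernel i phi.
Proof.
case: n => [|[|n]].
- exists (res_aug V); split; first exact: res_cover_aug.
  by exists (ker_incl (res_aug V)); apply: ker_incl_kernel.
- have [psi cov pE] := res_cover0 V; exists psi; split=> //.
  exists (ker_incl (res_diff V 0)); apply: kernel_comp pE; first exact: ker_incl_kernel.
  by move=> x; have [] := ker_incl_kernel (res_aug V).
- have [psi cov pE] := res_coverS V n; exists psi; split=> //.
  exists (ker_incl (res_diff V n.+1)); apply: kernel_comp pE; first exact: ker_incl_kernel.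
  by move=> x; have [] := ker_incl_kernel (res_diff V n).
Qed.

(** The base case is [exact_top]; each further syzygy gains one degree. *)
Lemma exact_syzygy (J : {set P}) (M : rep) (V : interval_resolution M) :
  subtree adj J -> ~ principal J -> ~ half_principal J -> J != set0 ->
  forall i n, (0 < n)%N -> (#|leaf P| <= (n + i).+1)%N ->
  exact_at (@modify d P J) (syzygy V i) n.
Proof.
move=> cJ npr nhv J0.
have cF := subtree_modify treeP cJ npr nhv.
have lF := modify_linked treeP cJ npr nhv.
have nF := modify_nest treeP cJ npr nhv.
have vF := modify_conv treeP cJ npr nhv.
elim=> [|i IH] n n0 le.
  apply: exact_top => //; apply: leq_trans (card_op treeP cJ npr nhv) _.
  by rewrite addn0 in le.
have [phi [cov [j ker]]] := syzygy_cover V i.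
move=> z cz z0.
have [V_dec _ _] := cov.
have [T [S [io [p bip]]]] := decomposable_biproduct V_dec.
have cjz : cochain (@modify d P J) n (fun s x => j x (z s x)).
  have [zs zn] := cz; split=> [s|s sn x]; first exact: section_hom.
  by rewrite zn ?linear0.
have [s x|t|w [cw wz]] := exact_decomposable treeP cF lF nF bip cjz.
- by rewrite -cochain_diff_hom z0 linear0.
- have [SJ|SJ] := eqVneq (val (S t)) J; last first.
    by left; apply: neutral_exists => //; apply: interval_subtree.
  right=> s x; have [-> |s0] := eqVneq s set0.
    by have [_ ->] := cjz; rewrite ?linear0 // cards0 eq_sym -lt0n.
  have [_ sp _ _] := bip.
  apply: (scalar_hom_zero treeP x (cF s) cJ (c := fun x => p t x (j x (z s x)))).
    have spJ : is_cosection J (p t) by rewrite -SJ.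
    by apply: section_coord spJ; have [zs _] := cjz.
  exact: modify_unlinked.
apply: (exact_shift treeP cF lF vF cov ker _ cz cw wz).
by apply: IH => //; rewrite addSnnS.
Qed.

(** If the projection to the summand [t] were nonzero, it would split off the
    image of [g], which lies in the kernel of the cover; projecting this summand
    away would be a non-invertible endomorphism compatible with the cover. *)
Lemma cover_radical (V N : rep) (phi : hom V N) (T : finType) (S : T -> interval P) io p
    t (g : forall x, V x) :
  interval_cover phi -> @biproduct k d P V T S io p -> is_section (val (S t)) g ->
  (forall x, phi x (g x) = 0) -> forall x, p t x (g x) = 0.
Proof.
move=> [_ _ minV] [_ sp _ _] sg phig x; apply/eqP/negPn/negP => c0.
have cS := interval_subtree treeP (S t).
pose c y : k := p t y (g y); have sc : scalar_hom (val (S t)) (val (S t)) c := section_coord sg (sp t).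
have xS : x \in val (S t).
  by apply/negPn/negP => xS; move: c0; have [-> // _] := sg; rewrite linear0 eqxx.
have cE y : y \in val (S t) -> c y = c x.
  by move=> yS; apply: (scalar_hom_const treeP cS cS sc); rewrite inE ?xS ?yS.
have cx0 : c x != 0 by [].
have [|y y' yy' v|kap kapE] := @hom_exists k d P V V (fun y v => v - ((c x)^-1 * (p t y v : k)) *: g y).
- move=> y a u v; rewrite scalerBr addrACA -opprD; congr (_ - _).
  rewrite scalerA -scalerDl; congr (_ *: _).
  by rewrite linearP /= mulrDr mulrCA.
- rewrite linearB /= -!scalerA linearZ /=; congr (_ - _ *: _).
  exact: cosection_section_nat.
have [y|h /(_ x)[/lfunP hk _]] := minV kap.
  apply/lfunP => v; rewrite comp_lfunE kapE linearB linearZ /= phig scaler0 subr0 //.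
have := hk (g x); rewrite comp_lfunE kapE id_lfunE -/(c x) mulVf // scale1r subrr linear0.
by move=> g0; move: cx0; rewrite /c -g0 linear0 eqxx.
Qed.

(** Induction on the number of intervals through [q] that receive a map from
    [J] which is nonzero at [q]. *)
Lemma syzygy_sections_zero (M : rep) (V : interval_resolution M) i :
  (#|leaf P| <= i.+2)%N ->
  forall (J : {set P}) (f : forall x, syzygy V i.+1 x) (q : P),
    subtree adj J -> q \in J -> is_section J f -> f q = 0.
Proof.
move=> leafi J f q.
have [phi [cover [j ker]]] := syzygy_cover V i.
have [V_dec _ _] := cover.
have [T [S [io [p bip]]]] := decomposable_biproduct V_dec.
have [sio sp sumV _] := bip.
pose up (J : {set P}) := [set X | [&& subtree adj X, q \in X & linked J X]].
have [n] := ubnP #|up J|; elim: n J f => // n IH J f le cJ qJ sf.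
have step (J' : {set P}) (f' : forall x, syzygy V i.+1 x) : subtree adj J' -> q \in J' ->
    linked J J' -> ~~ linked J' J -> is_section J' f' -> f' q = 0.
  move=> cJ' qJ' l nl sf'; apply: (IH J') => //.
  rewrite ltnS in le; apply: leq_trans le; apply: proper_card; apply/properP; split.
    apply/subsetP => X; rewrite !inE => /and3P[cX qX l']; rewrite cX qX /=.
    exact: (linked_trans treeP cJ cX qJ qJ' qX).
  by exists J; rewrite !inE cJ qJ ?linked_refl.
pose g x := j x (f x); have sg : is_section J g by apply: section_hom.
have phig x : phi x (g x) = 0 by apply: kernel0 ker.
have radical t x : val (S t) = J -> p t x (g x) = 0.
  by move=> SJ; apply: (cover_radical cover bip) => //; rewrite SJ.
have inj0 x u : j x u = 0 -> u = 0.
  by move=> ju; apply: (kernel_inj ker); rewrite ju linear0.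
(* J is the down-set of y: f vanishes at y by injectivity of I_J, hence it comes from
   the down-sets of the elements covered by y. *)
have [/existsP[y /eqP Jy]|npr'] := boolP [exists y, J == [set z : P | (z <= y)%O]].
  have yJ : y \in J by rewrite Jy inE.
  have fy : f y = 0.
    apply: inj0; rewrite -/(g y) -(sumV y (g y)) big1 // => t _.
    suff -> : p t y (g y) = 0 by rewrite scale0r.
    have cS := interval_subtree treeP (S t).
    have [l|nl] := boolP (linked J (val (S t))); last first.
      exact: (scalar_hom_zero treeP y cJ cS (section_coord sg (sp t)) nl).
    have [yX|yX] := boolP (y \in val (S t)); last by have [-> //] := sp t.
    by apply: radical; rewrite Jy; apply: downset_only yX => //; rewrite -Jy.
  have [-> //|qy] := eqVneq q y.
  have {}qy : (q < y)%O by rewrite lt_neqAle qy; move: qJ; rewrite Jy inE.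
  have [x xy qx] := cov_below qy.
  have yx : adj y x by apply: cov_adj'.
  pose J' := [set z : P | (z <= x)%O]; pose f' z := if z \in J' then f z else 0.
  have [l nl] := principal_step xy.
  have qJ' : q \in J' by rewrite inE.
  have f'q : f' q = f q by rewrite /f' qJ'.
  rewrite -f'q; apply: (step J') => //; rewrite ?Jy //; first exact: subtree_down.
  have [f0 f1] := sf; split=> [z /negbTE zJ'|u w uw uJ']; first by rewrite /f' zJ'.
  have ux : (u <= x)%O by rewrite inE in uJ'.
  have uJ : u \in J by rewrite Jy inE (le_trans ux (ltW (cov_lt xy))).
  rewrite {1}/f' uJ' f1 // /f'; case: ifPn => // wJ'.
  have [wJ|wJ] := boolP (w \in J); last exact: f0.
  suff -> : w = y by [].
  have wy : (w <= y)%O by rewrite Jy inE in wJ.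
  apply/eqP; rewrite eq_le wy /=.
  have uB : u \in br y x.
    apply/negPn/negP => uB.
    have [c _ _] := le_cross' treeP yx ux (branch_far _ _ _) uB.
    by rewrite (cov_asym xy) in c.
  have [wB|wB] := boolP (w \in br y x).
    have [_ wx _] := le_cross treeP yx wy wB (branch_near treeP yx).
    by rewrite inE wx in wJ'.
  by have [] := le_cross treeP yx uw uB wB.
have npr : ~ principal J.
  by case=> y e; case/negP: npr'; apply/existsP; exists y; apply/eqP.
(* J is half of the down-set of y: the sequence I_J -> I_(J :|: N) -> I_N is exact.  Extend
   f to J :|: N inside the cover, then correct by a lift of a section over N. *)
have [/existsP[x /existsP[y /and3P[xy xJ /eqP JE]]]|nhv'] :=
  boolP [exists x, exists y, [&& cov x y, x \notin J & J == [set z in br x y | (z <= y)%O]]].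
  pose N := [set z in br y x | (x <= z)%O].
  have cN : subtree adj N by apply: subtree_half_up.
  have cJN : subtree adj (J :|: N) by rewrite JE; apply: subtree_halves.
  have lN : linked (J :|: N) N by rewrite JE; apply: halves_to_upper.
  have [lJ nlJ] : linked J (J :|: N) /\ ~~ linked (J :|: N) J by rewrite JE; apply: halves_step.
  have JN z : z \in J -> z \notin N.
    rewrite JE => zJ; apply/negP; rewrite in_set => /andP[zN _].
    move: zJ; rewrite in_set => /andP[zR _].
    by have := branch_disj treeP (cov_adj xy) zR; rewrite zN.
  have ext t : exists c : P -> k, scalar_hom (J :|: N) (val (S t)) c /\
      forall z, z \in J -> c z = p t z (g z).
    have cS := interval_subtree treeP (S t).
    have sc := section_coord sg (sp t).
    have [z /andP[zJ cz]|none] := pickP [pred z | (z \in J) && (p t z (g z) != 0)]; last first.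
      exists (fun=> 0); split; first by split=> // u v _ _; rewrite if_same.
      by move=> z zJ; have := none z; rewrite /= zJ => /negbFE/eqP.
    have SJ : val (S t) != J by apply: contraNneq cz => e; rewrite radical.
    have l : linked J (val (S t)).
      by apply: contraNT cz => nl; rewrite (scalar_hom_zero treeP z cJ cS sc nl).
    have zS : z \in val (S t).
      by apply: contraNT cz => zS; have [-> //] := sp t.
    exists (fun u => if u \in (J :|: N) :&: val (S t) then p t z (g z) else 0); split.
      apply: scalar_hom_indicator => //; rewrite JE.
      by apply: (@halves_extend _ _ treeP x y xy _ z) => //; rewrite -JE.
    move=> u uJ; rewrite in_setI in_setU uJ /=; case: ifPn => uS; last by have [-> //] := sp t.
    by apply: (scalar_hom_const treeP cJ cS sc); rewrite in_setI ?zJ ?uJ.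
  have [c cE] := fin_all_exists ext.
  pose w z := \sum_t c t z *: io t z.
  have sw : is_section (J :|: N) w.
    by apply: section_sum => t _; have [sc _] := cE t; apply: scalar_hom_section sc (sio t).
  have wg z : z \in J -> w z = g z.
    move=> zJ; rewrite -[RHS](sumV z); apply: eq_bigr => t _.
    by have [_ ->] := cE t.
  have [w0 w1] := section_hom phi sw.
  have sphi : is_section N (fun z => phi z (w z)).
    split=> [z zN|u v uv uN]; last by apply: w1; rewrite in_setU uN orbT.
    have [zJ|zJ] := boolP (z \in J); first by rewrite wg ?phig.
    by rewrite w0 // in_setU negb_or zJ zN.
  have [u [su uE]] := cover_lift (S := to_interval treeP cN) cover sphi.
  have {}su : is_section N u := su.
  have su' : is_section (J :|: N) u.
    apply: section_eq (section_restrict treeP cJN cN lN su) => z.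
    have [u0 _] := su; case: ifPn => //; rewrite in_setU negb_or => /andP[_ zN].
    by rewrite u0.
  have swu : is_section (J :|: N) (fun z => w z + (-1) *: u z).
    by apply: sectionD => //; apply: sectionZ.
  have phi0 z : phi z (w z + (-1) *: u z) = 0.
    by rewrite linearD linearZ /= uE scaleN1r subrr.
  have [sl lE] := kernel_lift ker swu phi0.
  have := lE q; rewrite (step _ _ cJN _ lJ nlJ sl) ?in_setU ?qJ // linear0.
  have [u0 _] := su; rewrite u0 ?JN // scaler0 addr0 wg // => /esym; exact: inj0.
have nhv : ~ half_principal J.
  case=> x [y [xy xJ e]]; case/negP: nhv'; apply/existsP; exists x.
  by apply/existsP; exists y; rewrite xy xJ; apply/eqP.
(* Otherwise f, as a cochain of degree 0, is a coboundary in the cover, hence in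
   the kernel. *)
have J0 : J != set0 by apply/set0Pn; exists q.
have cF := subtree_modify treeP cJ npr nhv.
have lF := modify_linked treeP cJ npr nhv.
have nF := modify_nest treeP cJ npr nhv.
have vF := modify_conv treeP cJ npr nhv.
pose z (s : {set op J}) x := if s == set0 then f x else 0.
have cz : cochain (@modify d P J) 0 z.
  split=> [s|s s0 x]; last by rewrite /z -cards_eq0 (negbTE s0).
  rewrite /z; case: eqP => [->|_]; last exact: section0.
  by rewrite modify0.
have cjz : cochain (@modify d P J) 0 (fun s x => j x (z s x)).
  have [zs zn] := cz; split=> [s|s sn x]; first exact: section_hom.
  by rewrite zn ?linear0.
have U0 (s : {set op J}) b : (b |: s == set0) = false.
  by apply/negbTE/set0Pn; exists b; rewrite setU11.
have [s x|t|w [cw wz]] := exact_decomposable treeP cF lF nF bip cjz.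
- rewrite /cochain_diff /cube_diff; case: ifP => // _; rewrite big1 // => b _.
  by rewrite /z U0 linear0 scaler0.
- have [SJ|SJ] := eqVneq (val (S t)) J; last first.
    by left; apply: neutral_exists => //; apply: interval_subtree.
  right=> s x; rewrite /z; case: eqP => _; first exact: radical.
  by rewrite !linear0.
have exN := @exact_syzygy J M V cJ npr nhv J0 i 1 isT.
have [|w' [cw' wz']] := exact_shift treeP cF lF vF cover ker _ cz cw wz.
  exact: exN.
have := wz' set0 q; rewrite /z eqxx => <-; rewrite /cochain_diff /cube_diff; case: ifP => // _.
rewrite big1 // => b _; have [ws _] := cw'.
have b0 : b |: set0 != set0 by rewrite U0.
have [qb|qb] := boolP (q \in modify (b |: set0)); last first.
  by have [-> //] := ws (b |: set0); rewrite scaler0.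
rewrite (step (modify (b |: set0))) ?scaler0 //.
  by have := lF set0 b; rewrite modify0 inE; apply.
exact: modify_unlinked.
Qed.

Lemma is_zeroP (M : rep) : reflect (forall x (v : M x), v = 0) (is_zero M).
Proof.
apply: (iffP forallP) => h x.
  move=> v; apply/eqP; rewrite -memv0; have := h x.
  by rewrite dimv_eq0 => /eqP <-; apply: memvf.
rewrite dimv_eq0 -subv0; apply/subvP => v _.
by rewrite (h x v) mem0v.
Qed.

Lemma section_through (N : rep) x (v : N x) :
  exists s : forall y, N y, is_section [set y | (x <= y)%O] s /\ s x = v.
Proof.
pose s y : N y := if (x <= y)%O =P true is ReflectT xy then rep_map N xy v else 0.
have sE y (xy : (x <= y)%O) : s y = rep_map N xy v.
  by rewrite /s; case: eqP => // xy'; rewrite (bool_irrelevance xy xy').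
exists s; split; last by rewrite (sE x (lexx x)) rep_map_id id_lfunE.
split=> [y|y z yz]; rewrite inE => xy.
  by rewrite /s; case: eqP => // xy'; rewrite xy' in xy.
rewrite (sE y xy) (sE z (le_trans xy yz)); symmetry; exact: rep_mapE.
Qed.

(** The zero endomorphism is compatible with a cover of zero. *)
Lemma cover_zero (V N : rep) (phi : hom V N) :
  interval_cover phi -> is_zero N -> is_zero V.
Proof.
move=> [_ _ minV] /is_zeroP N0; apply/is_zeroP => x v.
have [| |kap kapE] := @hom_exists k d P V V (fun y v => 0).
- by move=> y a u w; rewrite scaler0 addr0.
- by move=> y z yz w; rewrite linear0.
have [y|h /(_ x)[/lfunP hk _]] := minV kap.
  by apply/lfunP => w; rewrite (N0 y (phi y w)) [RHS]N0.
by have := hk v; rewrite comp_lfunE kapE linear0 id_lfunE.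
Qed.

Lemma syzygy_zero (M : rep) (V : interval_resolution M) i m :
  (#|leaf P| <= i.+2)%N -> (i < m)%N -> is_zero (syzygy V m).
Proof.
move=> leafi; elim: m => // m IH; rewrite ltnS leq_eqVlt => /predU1P[<-|im].
  apply/is_zeroP => x v; have [s [ss <-]] := section_through v.
  apply: (syzygy_sections_zero leafi (subtree_up treeP x) _ ss).
  by rewrite inE.
have [phi [cov [j ker]]] := syzygy_cover V m.
have /is_zeroP V0 := cover_zero cov (IH im).
by apply/is_zeroP => x v; apply: (kernel_inj ker); rewrite (V0 x (j x v)) linear0.
Qed.

Lemma resolution_bound (M : rep) (V : interval_resolution M) m :
  (2 <= #|leaf P|)%N -> ~~ is_zero (V m) -> (m.+2 <= #|leaf P|)%N.
Proof.
move=> L2; apply: contraNT; rewrite -ltnNge => lt.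
have [phi [cov _]] := syzygy_cover V m.
apply: (cover_zero cov); apply: (@syzygy_zero M V (#|leaf P|.-2) m).
  by case: #|leaf P| L2 => [|[|n]].
by case: #|leaf P| L2 lt => [|[|n]].
Qed.

End Upper.

(** * The cube of leaf deletions *)

Section LeafCube.
Context {d : Order.disp_t} (P : finPOrderType d).
Hypothesis treeP : tree_type P.
Hypothesis leaf3 : (2 < #|leaf P|)%N.
Local Open Scope order_scope.
Notation cov x y := (covers y x).
Notation adj := (hasse_adj P).
Notation br := (branch adj).

Definition leafT : predArgType := {x : P | x \in leaf P}.
Implicit Types (l : leafT) (r : {set leafT}).

Lemma leafT_deg1 l : deg1 adj (val l). Proof. by rewrite -leafE // (valP l). Qed.

Lemma card_leafT : #|leafT| = #|leaf P|. Proof. by rewrite card_sig; apply: eq_card. Qed.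

Lemma neighbour_exists l : exists p, adj (val l) p.
Proof.
by have /cards1P[p pE] := leafT_deg1 l; exists p; have := set11 p; rewrite -pE inE.
Qed.

Definition neighbour l : P := xchoose (neighbour_exists l).
Lemma neighbour_adj l : adj (val l) (neighbour l). Proof. exact: xchooseP. Qed.

Lemma neighbour_unique l z : adj (val l) z -> z = neighbour l.
Proof. by move=> lz; apply: (deg1_nbr (leafT_deg1 l) lz (neighbour_adj l)). Qed.

Lemma leafT_other (x y : P) : exists l, val l != x /\ val l != y.
Proof.
have [z /andP[zL zxy]|none] := pickP [pred z | (z \in leaf P) && (z \notin [set x; y])].
  by exists (Sub z zL); move: zxy; rewrite !inE negb_or => /andP[].
have sub : leaf P \subset [set x; y].
  by apply/subsetP => z zL; have := none z; rewrite /= zL => /negbFE.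
have := leq_trans leaf3 (subset_leq_card sub).
by rewrite cards2; case: (x != y).
Qed.

Lemma neighbour_nonleaf l : neighbour l \notin leaf P.
Proof.
apply/negP => pL; have lp := neighbour_adj l.
have pl : adj (neighbour l) (val l) by rewrite (adj_sym treeP).
have p1 : deg1 adj (neighbour l) by rewrite -leafE.
have [z [zl zp]] := leafT_other (val l) (neighbour l).
have zB : val z \in br (val l) (neighbour l).
  by rewrite (branch_from_leaf treeP (leafT_deg1 l) lp) !inE andbT.
have := branch_disj treeP lp zB.
by rewrite (branch_from_leaf treeP p1 pl) !inE andbT zp.
Qed.

Lemma leaf_neq_neighbour l l' : val l != neighbour l'.
Proof. by apply: contraTneq (valP l) => ->; rewrite neighbour_nonleaf. Qed.

(** A leaf is a minimal element of P when it is low, and a maximal one otherwise. *)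
Definition low l : bool := cov (val l) (neighbour l).

Lemma high l : ~~ low l -> cov (neighbour l) (val l).
Proof. by have := neighbour_adj l; rewrite adjE /low => /orP[->|]. Qed.

Lemma low_below l z : low l -> cov z (val l) -> False.
Proof.
move=> c c'; have e := neighbour_unique (cov_adj' c'); subst z.
by have := cov_asym c; rewrite c'.
Qed.

Lemma high_above l z : ~~ low l -> cov (val l) z -> False.
Proof.
move=> c c'; have e := neighbour_unique (cov_adj c'); subst z.
by rewrite /low c' in c.
Qed.

(** With this convention, adding a leaf to [r] always gives a map
    I_(trim (l |: r)) -> I_(trim r): an inclusion if [l] is low, a
    quotient otherwise. *)
Definition trim r : {set P} :=
  [set z | [forall l : leafT, (val l == z) ==> (low l == (l \notin r))]].

Lemma trim_leaf r l : (val l \in trim r) = (low l == (l \notin r)).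
Proof.
rewrite in_set; apply/forallP/idP => [/(_ l)|h l']; first by rewrite eqxx.
by apply/implyP => /eqP/val_inj ->.
Qed.

Lemma trim_nonleaf r z : z \notin leaf P -> z \in trim r.
Proof.
move=> zL; rewrite in_set; apply/forallP => l; apply/implyP => /eqP e.
by rewrite -e (valP l) in zL.
Qed.

Lemma trim_neighbour r l : neighbour l \in trim r.
Proof. by apply: trim_nonleaf; apply: neighbour_nonleaf. Qed.

Lemma trimU r l z : z != val l -> (z \in trim (l |: r)) = (z \in trim r).
Proof.
move=> zl; rewrite !in_set; apply: eq_forallb => l'.
case: eqP => // e; rewrite !implyTb in_setU1; suff -> : (l' == l) = false by [].
by apply/negbTE; apply: contra zl => /eqP <-; rewrite e.
Qed.

Lemma trimU_leaf r l : (val l \in trim (l |: r)) = ~~ low l.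
Proof. by rewrite trim_leaf setU11; case: (low l). Qed.

Lemma trim_leaf_out r l : l \notin r -> (val l \in trim r) = low l.
Proof. by move=> lr; rewrite trim_leaf lr; case: (low l). Qed.

Lemma subtree_trim r : subtree adj (trim r).
Proof.
apply: (@subtree_bigcap _ _ treeP leafT
  (fun l => if low l == (l \notin r) then setT else setT :\ val l)).
  move=> l; case: ifP => _; first exact: subtreeT.
  by rewrite -(branch_from_leaf treeP (leafT_deg1 l) (neighbour_adj l)); apply: subtree_branch.
move=> z; apply: (iffP idP).
  rewrite in_set => /forallP h l; have := h l; case: ifP => [|ne]; first by rewrite inE.
  by rewrite !inE andbT eq_sym; case: eqP.
move=> h; rewrite in_set; apply/forallP => l; apply/implyP => /eqP e.
by have := h l; case: ifP => //; rewrite !inE e eqxx.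
Qed.

Lemma trim_linked r l : l \notin r -> linked (trim (l |: r)) (trim r).
Proof.
move=> lr; apply/linkedP => u v uv; split=> [ur vr' vr|ur' ur vr].
  have [e|ul] := eqVneq u (val l); last by rewrite -(trimU r ul).
  rewrite e trim_leaf_out //; apply/negPn/negP => nl.
  by apply: (@high_above l v nl); rewrite -e.
have [e|vl] := eqVneq v (val l); last by rewrite (trimU r vl).
rewrite e trimU_leaf; apply/negP => lo.
by apply: (@low_below l u lo); rewrite -e.
Qed.

Lemma linked_trim r r' : linked (trim r) (trim r') -> r' \subset r.
Proof.
move=> /linkedP h; apply/subsetP => l lr'; apply/negPn/negP => lr.
have lt : (val l \in trim r) = low l := trim_leaf_out lr.
have lt' : (val l \in trim r') = ~~ low l by rewrite trim_leaf lr'; case: (low l).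
have [lo|hi] := boolP (low l).
  have [h1 _] := h _ _ lo.
  by move: (h1); rewrite lt lt' lo !trim_neighbour => /(_ isT isT isT).
have [_ h1] := h _ _ (high hi).
by move: (h1); rewrite lt lt' !trim_neighbour (negbTE hi) => /(_ isT isT isT).
Qed.

Lemma trim_conv r l l' z : z \in trim r -> z \in trim (l' |: (l |: r)) ->
  z \in trim (l |: r).
Proof.
move=> zr; have [->|ll'] := eqVneq l' l; first by rewrite setUA setUid.
have [->|zl] := eqVneq z (val l); last by rewrite (trimU r zl) => _.
by rewrite trimU //; apply: contra ll' => /eqP/val_inj ->.
Qed.

Lemma lone_leaf (X : {set P}) l z : subtree adj X -> val l \in X -> neighbour l \notin X ->
  z \in X -> z = val l.
Proof.
move=> cX lX pX zX; apply/eqP/negPn/negP => zl.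
have zl' : z \notin [set val l] by rewrite inE.
have [u [w [uX wX uw]]] := subtree_exit cX lX zX (set11 _) zl'.
rewrite inE => /eqP e _; rewrite e in uw.
by move: pX; rewrite -(neighbour_unique uw) wX.
Qed.

Lemma neutral_low_leaf (X : {set P}) l r : subtree adj X -> low l -> l \notin r ->
  ~~ ((val l \in X) && (neighbour l \in X)) -> meets X (trim r) = meets X (trim (l |: r)).
Proof.
move=> cX lo lr nX.
have lt : val l \in trim r by rewrite trim_leaf_out.
have lt' : val l \notin trim (l |: r) by rewrite trimU_leaf lo.
have [lX|lX] := boolP (val l \in X).
  have pX : neighbour l \notin X by rewrite lX in nX.
  have XE := lone_leaf cX lX pX.
  transitivity false.
    apply/negbTE/negP => /andP[/linkedP/(_ _ _ lo)[_ h] _].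
    by rewrite h ?trim_neighbour in pX.
  apply/esym/negbTE/negP => /andP[_ /set0Pn[z]]; rewrite inE => /andP[zX].
  by rewrite (XE z zX) (negbTE lt').
have tE z : z != val l -> (z \in trim (l |: r)) = (z \in trim r) := @trimU r l z.
have nl z : z \in X -> z != val l by apply: contraTneq => ->.
have IE : X :&: trim (l |: r) = X :&: trim r.
  by apply/setP=> z; rewrite !in_setI; case zX: (z \in X) => //=; rewrite tE ?nl.
rewrite /meets IE; congr (_ && _); rewrite /linked; apply: eq_forallb => u; apply: eq_forallb => v.
case uv: (cov u v) => //=; case uX: (u \in X) => //=.
have vl : v != val l.
  by apply/eqP => e; apply: (@low_below l u lo); rewrite -e.
by rewrite !tE // nl.
Qed.

Lemma neutral_high_leaf (X : {set P}) l r : subtree adj X -> ~~ low l -> l \notin r ->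
  (val l \in X) = (neighbour l \in X) -> meets X (trim r) = meets X (trim (l |: r)).
Proof.
move=> cX hi lr eX.
have lt : val l \notin trim r by rewrite trim_leaf_out.
have lt' : val l \in trim (l |: r) by rewrite trimU_leaf hi.
have tE z : z != val l -> (z \in trim (l |: r)) = (z \in trim r) := @trimU r l z.
have edge u v : cov u v -> u != val l.
  by move=> uv; apply/eqP => e; apply: (@high_above l v hi); rewrite -e.
rewrite /meets; congr (_ && _).
  rewrite /linked; apply: eq_forallb => u; apply: eq_forallb => v.
  case uv: (cov u v) => //=; case uX: (u \in X) => //=.
  rewrite (tE u (edge u v uv)).
  have [e|vl] := eqVneq v (val l); last by rewrite !tE.
  have ue : u = neighbour l by apply: neighbour_unique; rewrite -e; apply: cov_adj'.
  have uT r' : u \in trim r' by rewrite ue trim_neighbour.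
  by rewrite e eX -ue uX !uT (negbTE lt) lt'.
have [lX|lX] := boolP (val l \in X).
  have nX : neighbour l \in X by rewrite -eX.
  have n r' : X :&: trim r' != set0 by apply/set0Pn; exists (neighbour l); rewrite inE nX trim_neighbour.
  by rewrite !n.
suff -> : X :&: trim (l |: r) = X :&: trim r by [].
apply/setP=> z; rewrite !in_setI; case zX: (z \in X) => //=.
by rewrite tE //; apply: contraNneq lX => <-.
Qed.

(** If no leaf is neutral, then [X] contains each low leaf together with its
    neighbour, and exactly one of the two for each other leaf.  A lone leaf cannot be
    [X], because of the remaining leaves, so [X] contains all the neighbours; by
    connectedness it contains every inner vertex, and [X] is [trim set0]. *)
Lemma neutral_leaf (X : {set P}) : subtree adj X -> X != trim set0 ->
  exists l, forall r, l \notin r -> meets X (trim r) = meets X (trim (l |: r)).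
Proof.
move=> cX XT.
have [l /andP[lo nX]|nolow] :=
    pickP [pred l | low l && ~~ ((val l \in X) && (neighbour l \in X))].
  by exists l => r lr; apply: neutral_low_leaf.
have [l /andP[hi /eqP eX]|nohigh] :=
    pickP [pred l | ~~ low l && ((val l \in X) == (neighbour l \in X))].
  by exists l => r lr; apply: neutral_high_leaf.
exfalso; case/negP: XT; apply/eqP.
have lowX l : low l -> (val l \in X) && (neighbour l \in X).
  by move=> lo; have := nolow l; rewrite /= lo => /negbFE.
have highX l : ~~ low l -> (val l \in X) = (neighbour l \notin X).
  move=> hi; have := nohigh l; rewrite /= hi /=.
  by case: (val l \in X); case: (neighbour l \in X).
have nbrX l : neighbour l \in X.
  have [/lowX/andP[]//|hi] := boolP (low l).
  apply/negPn/negP => pX; have lX : val l \in X by rewrite highX.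
  have XE := lone_leaf cX lX pX.
  have [l' [l'l _]] := leafT_other (val l) (val l).
  have l'X : val l' \notin X by apply: contra l'l => /XE ->.
  have [/lowX/andP[l'X' _]|hi'] := boolP (low l'); first by rewrite l'X' in l'X.
  have /XE e : neighbour l' \in X by apply/negPn; rewrite -highX.
  by have := leaf_neq_neighbour l l'; rewrite e eqxx.
apply/setP=> z; have [zL|zL] := boolP (z \in leaf P).
  pose l : leafT := Sub z zL; rewrite -[z]/(val l) trim_leaf_out ?inE //.
  have [/lowX/andP[]//|hi] := boolP (low l).
  by apply/negbTE; rewrite highX // nbrX.
rewrite (trim_nonleaf _ zL).
have [l0 _] := leafT_other z z.
have [y1 zy1] : exists y, adj z y.
  have [_ _ /(_ z (val l0)) /connectP[[|y p] /= pp e] _] := treeP.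
    by rewrite -e (valP l0) in zL.
  by case/andP: pp; exists y.
have [y2 zy2 y12] : exists2 y, adj z y & y != y1.
  have [y /andP[zy yy]|none] := pickP [pred y | adj z y && (y != y1)]; first by exists y.
  case/negP: zL; rewrite leafE // /deg1; apply/cards1P; exists y1; apply/setP=> y.
  rewrite !inE; have := none y; rewrite /=; case: eqP => [->|_]; rewrite ?zy1 ?andbT //.
have [l1 l1B l1L] := branch_leaf treeP zy1; have [l2 l2B l2L] := branch_leaf treeP zy2.
have nb y (l : leafT) : adj z y -> val l \in br z y -> (neighbour l == z) || (neighbour l \in br z y).
  move=> zy lB; case nB: (neighbour l \in br z y); first by rewrite orbT.
  by have [_ ->] := branch_cross treeP zy (neighbour_adj l) lB (negbT nB); rewrite eqxx.
have /orP[/eqP <-|n1] := nb y1 (Sub l1 l1L) zy1 l1B; first exact: nbrX.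
have /orP[/eqP <-|n2] := nb y2 (Sub l2 l2L) zy2 l2B; first exact: nbrX.
have n2' : neighbour (Sub l2 l2L) \notin br z y1 := siblings treeP zy2 zy1 y12 n2.
by case/andP: (subtree_cross treeP zy1 cX (nbrX _) n1 (nbrX _) n2').
Qed.

End LeafCube.

(** * A module with an interval resolution of length L - 2 *)

Section Lower.
Context (k : fieldType) {d : Order.disp_t} (P : finPOrderType d).
Hypothesis treeP : tree_type P.
Hypothesis leaf3 : (2 < #|leaf P|)%N.
Local Open Scope ring_scope.
Notation rep := (rep k P).
Notation adj := (hasse_adj P).
Notation leafT := (leafT P).
Implicit Types (l : leafT) (r : {set leafT}).

Lemma hom_to_ker (U V N : rep) (g : hom U V) (f : hom V N) :
  (forall x u, f x (g x u) = 0) ->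
  exists h : hom U (ker f), forall x, g x = (ker_incl f x \o h x)%VF.
Proof.
move=> fg.
have iE x (u : subvs_of (lker (f x))) : ker_incl f x u = vsval u by rewrite /= lfunE.
have gk x u : g x u \in lker (f x) by rewrite memv_ker fg.
have [|x y xy u|h hE] := @hom_exists k d P U (ker f) (fun x u => vsproj (lker (f x)) (g x u)).
- by move=> x a u v; rewrite !linearP.
- apply: subvs_inj; rewrite [RHS](vsprojK (gk y _)) -hom_natE.
  rewrite -[in RHS](vsprojK (gk x u)); exact: (ker_mapE xy (vsproj _ (g x u))).
by exists h => x; apply/lfunP => u; rewrite comp_lfunE iE hE (vsprojK (gk x u)).
Qed.

(** Empty intervals off degree [n] let all the C_n be indexed by all sets of leaves. *)
Definition trim_deg (n : nat) (r : {set leafT}) : {set P} :=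
  if #|r| == n then trim r else set0.

Lemma subtree_trim_deg n r : subtree adj (trim_deg n r).
Proof. by rewrite /trim_deg; case: ifP => _; [apply: subtree_trim|apply: subtree0]. Qed.

Definition trim_int n r : interval P := to_interval treeP (subtree_trim_deg n r).

Lemma trim_deg_linked n r l : l \notin r -> linked (trim_deg n.+1 (l |: r)) (trim_deg n r).
Proof.
move=> lr; rewrite /trim_deg cardsU1 lr add1n eqSS; case: eqP => _; first exact: trim_linked.
by apply/linkedP => u v _; rewrite !inE.
Qed.

Variables (C : nat -> rep) (io : forall n, {set leafT} -> forall x, C n x)
  (pr : forall n, {set leafT} -> forall x, 'Hom(C n x, k^o)).
Arguments io {n}.
Arguments pr {n}.
Hypothesis C_dec : forall n, interval_decomposable (C n).
Hypothesis bip : forall n, biproduct (trim_int n) (@io n) (@pr n).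

Let sio n r : is_section (trim_deg n r) (@io n r). Proof. by have [h _ _ _] := bip n; apply: h. Qed.
Let spr n r : is_cosection (trim_deg n r) (@pr n r). Proof. by have [_ h _ _] := bip n; apply: h. Qed.
Let sumC n x (v : C n x) : \sum_(r : {set leafT}) (pr r x v : k) *: io r x = v.
Proof. by have [_ _ h _] := bip n; apply: h. Qed.
Let prio n r r' x : x \in trim_deg n r' -> pr r x (@io n r' x) = (r == r')%:R.
Proof. by have [_ _ _ h] := bip n => xr; apply: h. Qed.

Let pr_inj n x (u v : C n x) : (forall r, pr r x u = pr r x v) -> u = v.
Proof. by move=> uv; rewrite -(sumC u) -(sumC v); apply: eq_bigr => r _; rewrite uv. Qed.

Let prio' n r r' x : pr r x (@io n r' x) = ((r == r') && (x \in trim_deg n r))%:R.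
Proof.
have [xr|xr] := boolP (x \in trim_deg n r').
  by rewrite prio //; case: eqP => [->|] //; rewrite xr.
have [-> // _] := sio n r'; rewrite linear0.
by case: eqP => //= ->; rewrite (negbTE xr).
Qed.

Lemma trim_diff_exists n : exists D : hom (C n.+1) (C n), forall x v,
  D x v = \sum_(r : {set leafT}) \sum_(l : leafT | l \notin r) (cube_sign k l r * (pr (l |: r) x v : k)) *: io r x.
Proof.
apply: hom_exists.
  move=> x a u v; rewrite scaler_sumr -big_split /=; apply: eq_bigr => r _.
  rewrite scaler_sumr -big_split /=; apply: eq_bigr => l _.
  by rewrite linearP mulrDr mulrCA scalerDl scalerA.
move=> x y xy v; rewrite linear_sum; apply: eq_bigr => r _.
rewrite linear_sum; apply: eq_bigr => l lr /=.
rewrite -!scalerA linearZ /=; congr (_ *: _).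
have [p0 p1] := spr n.+1 (l |: r).
have sr := section_restrict treeP (subtree_trim_deg n.+1 (l |: r)) (subtree_trim_deg n r)
  (trim_deg_linked n lr) (sio n r).
have E z (u : C n.+1 z) : (pr (l |: r) z u : k) *: io r z =
    pr (l |: r) z u *: (if z \in trim_deg n.+1 (l |: r) then io r z else 0).
  by case: ifPn => // zr; rewrite p0 // !scale0r.
rewrite !E; exact: (cosection_section_nat xy v (spr n.+1 (l |: r)) sr).
Qed.

Variable D : forall n, hom (C n.+1) (C n).
Hypothesis DE : forall n x v, D n x v =
  \sum_(r : {set leafT}) \sum_(l : leafT | l \notin r) (cube_sign k l r * (pr (l |: r) x v : k)) *: io r x.

Let pr_deg n r x (v : C n x) : #|r| != n -> pr r x v = 0.
Proof.
move=> rn; have [p0 _] := spr n r; apply: p0.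
by rewrite /trim_deg (negbTE rn) inE.
Qed.

Let pr_out n r x (v : C n x) : x \notin trim r -> pr r x v = 0.
Proof.
move=> xr; have [p0 _] := spr n r; apply: p0.
by rewrite /trim_deg; case: ifP => _ //; rewrite inE.
Qed.

Lemma coord_D n r x v : pr r x (D n x v) =
  cube_diff (W := k^o) (fun r => x \in trim r) (fun r => pr r x v) r.
Proof.
rewrite /cube_diff; case: ifPn => xr; last exact: pr_out.
have [rn|rn] := eqVneq #|r| n; last first.
  rewrite pr_deg // big1 // => l lr; rewrite pr_deg ?scaler0 //.
  by rewrite cardsU1 lr add1n eqSS.
rewrite DE linear_sum (bigD1 r) //= [X in _ + X]big1 ?addr0 => [|r' rr']; last first.
  rewrite linear_sum big1 // => l _; rewrite linearZ /= prio'.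
  by rewrite eq_sym (negbTE rr') scaler0.
rewrite linear_sum; apply: eq_bigr => l _; rewrite linearZ /= prio' eqxx.
by rewrite /trim_deg rn eqxx xr /= -[_ *: _]/(_ * _) mulr1.
Qed.

Lemma D_D n x v : D n x (D n.+1 x v) = 0.
Proof.
apply: pr_inj => r; rewrite coord_D linear0.
transitivity (cube_diff (W := k^o) (fun r => x \in trim r)
   (cube_diff (W := k^o) (fun r => x \in trim r) (fun r => pr r x v)) r).
  by rewrite /cube_diff; case: ifP => // _; apply: eq_bigr => l _; rewrite coord_D.
apply: cube_diff_sqr => [r' xr|l l' _ _]; first exact: pr_out.
exact: trim_conv.
Qed.

(** Hom(I_X, -)-exactness.  For [X] other than [trim set0] a neutral leaf contracts the
    complex; for [X = trim set0] the complex is concentrated in degree 0. *)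
Lemma D_exact n (X : {set P}) (v : forall x, C n.+1 x) : subtree adj X -> is_section X v ->
  (forall x, D n x (v x) = 0) ->
  exists w : forall x, C n.+2 x, is_section X w /\ forall x, D n.+1 x (w x) = v x.
Proof.
move=> cX sv Dv.
pose E r := if linked X (trim r) then X :&: trim r else set0.
have EE r : (E r == set0) = ~~ meets X (trim r).
  by rewrite /E /meets; case: ifP => _; rewrite ?negbK ?eqxx.
pose z r x : k := pr r x (v x).
have zn r x : #|r| != n.+1 -> z r x = 0 by apply: pr_deg.
have sz r : #|r| = n.+1 -> scalar_hom X (trim r) (z r).
  move=> rn; have := section_coord sv (spr n.+1 r).
  by rewrite /trim_deg rn eqxx.
have cT := subtree_trim treeP.
have [XT|XT] := eqVneq X (trim set0).
  exists (fun=> 0); split=> [|x]; first exact: section0.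
  rewrite linear0; apply: pr_inj => r; rewrite linear0 -/(z r x).
  have [rn|rn] := eqVneq #|r| n.+1; last by rewrite zn.
  rewrite (scalar_hom_zero treeP x cX (cT r) (sz r rn)) // XT.
  by apply/negP => /(linked_trim treeP leaf3); rewrite subset0 -cards_eq0 rn.
have [a good] := neutral_leaf treeP leaf3 cX XT.
pose g r := if [pick x in E r] is Some x then z r x else 0.
have zE r x : z r x = if x \in E r then g r else 0.
  have [rn|rn] := eqVneq #|r| n.+1; last first.
    by rewrite zn // /g; case: pickP => [y _|_]; rewrite ?zn // if_same.
  have [l|l] := boolP (linked X (trim r)); last first.
    by rewrite /E (negbTE l) inE (scalar_hom_zero treeP x cX (cT r) (sz r rn) l).
  rewrite {1}/E l; case: ifPn => xE; last by have [-> //] := sz r rn; rewrite inE in xE.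
  rewrite /g; case: pickP => [y|/(_ x)]; last by rewrite /E l xE.
  by rewrite /E l => yE; apply: (scalar_hom_const treeP cX (cT r) (sz r rn) xE yE).
have Elnk r x : x \in E r -> [/\ linked X (trim r), x \in X & x \in trim r].
  by rewrite /E; case: ifP => l; rewrite inE // => /andP[].
have Eup r l x : l \notin r -> x \in E (l |: r) -> x \in trim r -> x \in E r.
  move=> lr /Elnk[l1 xX xlr] xr.
  have l2 := linked_trans treeP cX (cT r) xX xlr xr l1 (trim_linked lr).
  by rewrite /E l2 inE xX.
have nest (r : {set leafT}) l : l \notin r -> E r != set0 -> E (l |: r) != set0 ->
    E r \subset E (l |: r).
  move=> lr; rewrite !EE !negbK => /andP[l1 n1] /andP[l2 n2].
  have [q [qX qr qlr]] : exists q, [/\ q \in X, q \in trim r & q \in trim (l |: r)].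
    have [lo|hi] := boolP (low l).
      case/set0Pn: n2 => q; rewrite inE => /andP[qX q2]; exists q; split=> //.
      by rewrite -(trimU r (l := l)) //; apply: contraTneq q2 => ->; rewrite trimU_leaf lo.
    case/set0Pn: n1 => q; rewrite inE => /andP[qX q1]; exists q; split=> //.
    by rewrite trimU //; apply: contraTneq q1 => ->; rewrite trim_leaf_out.
  have /subsetP sub := linked_mid treeP cX (cT r) qX qlr qr l2 (trim_linked lr).
  rewrite /E l1 l2; apply/subsetP => x xE; rewrite inE sub // andbT.
  by move: xE; rewrite inE => /andP[].
have [r ar|r rn|r x xE|g' [g'n g'E]] := @scalar_cube_exact d P k _ E a n.+1 g nest.
- by rewrite !EE good.
- by rewrite /g; case: pickP => // x _; apply: zn.
- have [_ xX xr] := Elnk r x xE.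
  transitivity (pr r x (D n x (v x)) : k); last by rewrite Dv linear0.
  by rewrite coord_D /cube_diff xr; apply: eq_bigr => l _; rewrite -zE.
exists (fun x => \sum_r (if x \in E r then g' r else 0) *: io r x); split.
  apply: section_sum => r _; have [rn|rn] := eqVneq #|r| n.+2; last first.
    apply: section_eq (section0 _ _) => x; by rewrite g'n // if_same scale0r.
  apply: scalar_hom_section (sio n.+2 r); rewrite /trim_deg rn eqxx /E.
  have [l|l] := boolP (linked X (trim r)); first exact: scalar_hom_indicator.
  by split=> [x _|x y _ _]; rewrite !inE // if_same.
move=> x; apply: pr_inj => r; rewrite coord_D -/(z r x) /cube_diff.
case: ifPn => xr; last by rewrite /z pr_out.
pose t r' : k := if x \in E r' then g' r' else 0.
have prw r' : pr r' x (\sum_r (if x \in E r then g' r else 0) *: @io n.+2 r x) = t r'.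
  rewrite linear_sum (bigD1 r') //= big1 ?addr0 => [|r'' rr]; last first.
    by rewrite linearZ /= prio' eq_sym (negbTE rr) scaler0.
  rewrite linearZ /= prio' eqxx /= -/(t r') /trim_deg.
  have [rn|rn] := eqVneq #|r'| n.+2; last by rewrite /t g'n // if_same scale0r.
  rewrite /t; case: ifPn => [/Elnk[_ _ ->]|_]; last by rewrite scale0r.
  by rewrite -[_ *: _]/(_ * _) mulr1.
rewrite (eq_bigr (fun l => cube_sign k l r * t (l |: r))); last by move=> l _; rewrite prw.
rewrite zE; case: ifPn => xE; first exact: g'E.
rewrite big1 // => l lr; rewrite /t; case: ifPn => [xE'|_]; last by rewrite mulr0.
by rewrite (Eup r l x lr xE' xr) in xE.
Qed.

Lemma C_nonzero n r : #|r| = n -> ~~ is_zero (C n).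
Proof.
move=> rn; apply/negP => /is_zeroP C0.
have /card_gt0P[z zL] : (0 < #|leaf P|)%N by apply: leq_trans leaf3.
pose x := neighbour (Sub z zL : leafT).
have := prio' n r r x; rewrite (C0 x (io r x)) linear0 eqxx /trim_deg rn eqxx trim_neighbour //.
by move/esym/eqP; rewrite oner_eq0.
Qed.

(** Lifting is [D_exact].  If [kap] is compatible with [psi], then [kap - 1] maps to
    cycles, so on each summand it factors through [C n.+3]; but there is
    no nonzero map from [C n.+2] to [C n.+3], so [kap = 1]. *)
Lemma D_cover n (W : rep) (f : hom (C n.+1) W) (psi : hom (C n.+2) (ker f)) :
  (forall x v, (f x v == 0) = (D n x v == 0)) ->
  (forall x, D n.+1 x = (ker_incl f x \o psi x)%VF) -> interval_cover psi.
Proof.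
move=> fD psiE.
have ker := ker_incl_kernel f.
have psiE' x v : D n.+1 x v = ker_incl f x (psi x v) by rewrite psiE comp_lfunE.
split=> // [U U_dec g|kap kapE].
  have [T [S [i [p [si sp sumU _]]]]] := decomposable_biproduct U_dec.
  have ex t : exists w : forall x, C n.+2 x, is_section (val (S t)) w /\
      forall x, D n.+1 x (w x) = ker_incl f x (g x (i t x)).
    apply: D_exact; first exact: interval_subtree.
      by apply: section_hom; apply: section_hom.
    by move=> x; apply/eqP; rewrite -fD; apply/eqP; apply: kernel0 ker.
  have [w wE] := fin_all_exists ex.
  have [|x y xy u|h hE] := @hom_exists k d P U (C n.+2) (fun x u => \sum_t (p t x u : k) *: w t x).
  - move=> x a u v; rewrite scaler_sumr -big_split; apply: eq_bigr => t _.
    by rewrite linearP scalerDl scalerA.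
  - rewrite linear_sum; apply: eq_bigr => t _; have [sw _] := wE t.
    exact: (cosection_section_nat xy u (sp t) sw).
  exists h => x; apply/lfunP => u; rewrite comp_lfunE; apply: (kernel_inj ker).
  rewrite -psiE' hE linear_sum -[in LHS](sumU x u) !linear_sum.
  by apply: eq_bigr => t _; have [_ wD] := wE t; rewrite !linearZ /= wD.
suff kap1 x : kap x = \1%VF.
  by exists kap => x; rewrite kap1 comp_lfun1l.
have kapD y v : D n.+1 y (kap y v) = D n.+1 y v.
  by rewrite !psiE' [in RHS]kapE comp_lfunE.
apply/lfunP => v; rewrite id_lfunE -[in RHS](sumC v) -[in LHS](sumC v) linear_sum.
apply: eq_bigr => r _; rewrite linearZ /=; congr (_ *: _).
have [rn|rn] := eqVneq #|r| n.+2; last first.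
  have [-> //] := sio n.+2 r; first by rewrite linear0.
  by rewrite /trim_deg (negbTE rn) inE.
have sr : is_section (trim r) (@io n.+2 r) by have := sio n.+2 r; rewrite /trim_deg rn eqxx.
have cT := subtree_trim treeP.
have su : is_section (trim r) (fun y => kap y (io r y) + (-1) *: io r y).
  by apply: sectionD; [apply: section_hom|apply: sectionZ].
have [y|w [sw wE]] := D_exact (cT r) su.
  by rewrite linearD linearZ /= kapD scaleN1r subrr.
apply/eqP; rewrite -subr_eq0 -scaleN1r -wE.
suff -> : w x = 0 by rewrite linear0.
apply: pr_inj => r'; rewrite linear0.
have [rn'|rn'] := eqVneq #|r'| n.+3; last exact: pr_deg.
have sp' : is_cosection (trim r') (@pr n.+3 r') by have := spr n.+3 r'; rewrite /trim_deg rn' eqxx.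
apply: (scalar_hom_zero treeP x (cT r) (cT r') (section_coord sw sp')).
apply/negP => /(linked_trim treeP leaf3)/subset_leq_card.
by rewrite rn rn' ltnn.
Qed.

Lemma D_limg n x : limg (D n.+1 x) = lker (D n x).
Proof.
apply/eqP; rewrite eqEsubv; apply/andP; split; apply/subvP => v.
  by case/memv_imgP => u _ ->; rewrite memv_ker D_D.
rewrite memv_ker => /eqP Dv; have [s [ss sx]] := section_through v.
have [y|w [_ wE]] := D_exact (subtree_up treeP x) ss.
  have sD := section_hom (D n) ss; have [s0 s1] := sD.
  have [xy|xy] := boolP (x <= y)%O; last by rewrite s0 // inE.
  by rewrite -(s1 x y xy) ?inE // sx Dv linear0.
by rewrite -sx -wE memv_img ?memvf.
Qed.

Lemma trim_resolution : exists (M : rep) (V : interval_resolution M),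
  ~~ is_zero M /\ ~~ is_zero (V #|leaf P|.-2).
Proof.
pose M := ker (D 0).
have aug n : exists h : hom (C n.+2) (ker (D n)),
    forall x, D n.+1 x = (ker_incl (D n) x \o h x)%VF.
  by apply: hom_to_ker => x u; apply: D_D.
have [au auE] := aug 0.
have auc : interval_cover au by apply: (D_cover (f := D 0)).
have au0 x v : (au x v == 0) = (D 1 x v == 0).
  rewrite auE comp_lfunE; apply/eqP/eqP => [->|]; first by rewrite linear0.
  have ker := ker_incl_kernel (D 0).
  by move=> h; apply: (kernel_inj ker); rewrite h linear0.
have [h2 h2E] : exists h : hom (C 3) (ker au), forall x, D 2 x = (ker_incl au x \o h x)%VF.
  by apply: hom_to_ker => x u; apply/eqP; rewrite au0 D_D.
have cov0 : covers_ker (D 2) au by exists h2 => //; apply: (D_cover (f := au)).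
have covS i : covers_ker (D i.+3) (D i.+2).
  by have [h hE] := aug i.+2; exists h => //; apply: (D_cover (f := D i.+2)).
have kau x : lker (au x) = lker (D 1 x).
  by apply/vspaceP => v; rewrite !memv_ker au0.
have ex0 x : limg (D 2 x) = lker (au x) by rewrite D_limg kau.
have exS i x : limg (D i.+3 x) = lker (D i.+2 x) by apply: D_limg.
have exa x : limg (au x) = fullv.
  apply/vspaceP => v; rewrite memvf; apply/memv_imgP.
  have : ker_incl (D 0) x v \in limg (D 1 x).
    by rewrite D_limg memv_ker; apply/eqP; apply: kernel0; apply: ker_incl_kernel.
  case/memv_imgP => u _; rewrite auE comp_lfunE => e; exists u; rewrite ?memvf //.
  exact: (kernel_inj (ker_incl_kernel (D 0)) e).
exists M, (@IntervalResolution k d P M (fun i => C i.+2) au (fun i => D i.+2)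
  exa ex0 exS auc cov0 covS); split.
  apply/negP => /(cover_zero auc); apply/negP.
  have /card_gt1P[a [b [aL bL ab]]] : (1 < #|leaf P|)%N by apply: ltnW.
  apply: (@C_nonzero 2 [set (Sub a aL : leafT); Sub b bL]).
  by rewrite cards2 -val_eqE /= ab.
apply: (@C_nonzero _ setT); rewrite cardsT card_leafT.
by case: #|leaf P| leaf3 => [|[|n]].
Qed.

End Lower.

(** * The global dimension *)
Lemma supremum_max (dT : Order.disp_t) (T : porderType dT) (x0 c : T)
    (A : classical_sets.set T) :
  A c -> (forall a, A a -> (a <= c)%O) -> classical_sets.supremum x0 A = c.
Proof.
move=> Ac ub; rewrite /classical_sets.supremum; case: eqP => [A0|_].
  by rewrite A0 in Ac.
have cS : classical_sets.supremums A c by split=> [a /ub//|u]; apply.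
by case: classical_sets.xgetP => [y _ yS|/(_ c)//]; apply: classical_sets.is_subset1_supremums yS cS.
Qed.

Lemma supremum_le (dT : Order.disp_t) (T : porderType dT) (x0 c : T)
    (A : classical_sets.set T) :
  (x0 <= c)%O -> (forall a, A a -> (a <= c)%O) -> (classical_sets.supremum x0 A <= c)%O.
Proof.
move=> x0c ub; rewrite /classical_sets.supremum; case: eqP => [//|_].
by case: classical_sets.xgetP => [y _ [_ h]|//]; apply: h => a; apply: ub.
Qed.

Section Global.
Context (k : fieldType) {d : Order.disp_t} (P : finPOrderType d).
Hypothesis treeP : tree_type P.
Hypothesis cardP : (2 <= #|P|)%N.
Local Open Scope ring_scope.

Let leaf2 : (2 <= #|leaf P|)%N := leaf_ge2 treeP cardP.

Lemma int_res_dim_le (M : rep k P) : (int_res_dim M <= (#|leaf P| - 2)%N%:Z%:E)%E.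
Proof.
have c0 : (0 <= (#|leaf P| - 2)%N%:Z%:E :> \bar int)%E by rewrite lee_fin.
rewrite /int_res_dim; case: ifP => // _; apply: supremum_le => // _ [V [m [Vm ->]]].
rewrite lee_fin lez_nat; have := resolution_bound treeP leaf2 Vm.
by rewrite leq_subRL // add2n.
Qed.

Lemma int_res_dim_max : exists M : rep k P, int_res_dim M = (#|leaf P| - 2)%N%:Z%:E.
Proof.
have [leaf3|] := ltnP 2 #|leaf P|; last first.
  move=> le; have e : #|leaf P| = 2 by apply/eqP; rewrite eqn_leq le.
  exists (rep0 k P); rewrite /int_res_dim ifT ?e //.
  by apply/is_zeroP => x v; apply/matrixP => i [].
have ex n := boolp.cid (biproduct_exists k (@trim_int d P treeP n)).
pose C n := sval (ex n).
have exi n := boolp.cid (svalP (ex n)).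
pose io n := sval (exi n).
have exp n := boolp.cid (svalP (exi n)).
pose pr n := sval (exp n).
have prP n := svalP (exp n).
have [Cdec bip] : (forall n, interval_decomposable (C n)) /\
    (forall n, biproduct (trim_int treeP n) (io n) (pr n)).
  by split=> n; have [] := prP n.
have exD n := boolp.cid (trim_diff_exists bip n).
have [M [V [M0 V0]]] := trim_resolution leaf3 Cdec bip (fun n => svalP (exD n)).
exists M; rewrite /int_res_dim (negbTE M0); apply: supremum_max.
  by exists V, (#|leaf P|.-2); split=> //; rewrite subn2.
move=> a [V' [m [Vm ->]]]; rewrite lee_fin lez_nat.
by have := resolution_bound treeP leaf2 Vm; rewrite leq_subRL // add2n.
Qed.

Lemma int_res_gldimE : int_res_gldim k P = (#|leaf P|%:Z - 2)%R%:E.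
Proof.
rewrite (subzn leaf2); have [M ME] := int_res_dim_max.
apply: supremum_max; first by exists M.
by move=> _ [N ->]; apply: int_res_dim_le.
Qed.

End Global.

Lemma card_leaf_iso (d d' : Order.disp_t) (P : finPOrderType d) (Q : finPOrderType d') :
  tree_type P -> tree_type Q -> graph_iso (hasse_adj P) (hasse_adj Q) ->
  #|leaf Q| = #|leaf P| /\ #|Q| = #|P|.
Proof.
move=> treeP treeQ [h bij hE]; have inj := bij_inj bij.
split; last by rewrite (bij_eq_card bij).
have degE x : deg1 (hasse_adj Q) (h x) = deg1 (hasse_adj P) x.
  rewrite /deg1 -(card_imset _ inj); congr (#|pred_of_set _| == _).
  have [g gK hK] := bij.
  apply/setP=> y; rewrite inE -[y]hK hE; apply/idP/imsetP => [xy|[z]].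
    by exists (g y); rewrite ?inE.
  by rewrite inE => xz /inj ->.
rewrite -(card_imset _ inj); apply: eq_card => y.
have [g gK hK] := bij.
apply/idP/imsetP => [yL|[x xL ->]]; last by rewrite leafE // degE -leafE.
by exists (g y) => //; rewrite leafE // -degE hK -leafE.
Qed.

Theorem proposition6p4 (k : fieldType) (d : Order.disp_t)
    (P : finPOrderType d) (treeP : tree_type P) (cardP : (2 <= #|P|)%N) :
  int_res_gldim k P = (#|leaf P|%:Z - 2)%R%:E /\
  (forall (d' : Order.disp_t) (Q : finPOrderType d'),
     tree_type Q -> graph_iso (hasse_adj P) (hasse_adj Q) ->
     int_res_gldim k Q = int_res_gldim k P).
Proof.
split=> [|d' Q treeQ iso]; first exact: int_res_gldimE.
have [leafE cardE] := card_leaf_iso treeP treeQ iso.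
by rewrite !int_res_gldimE // ?leafE // cardE.
Qed.
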